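(* Let $\mathbf m(t,x)=\mathbf m_\infty+\sum_{j=1}^N\frac{\mathbf s_j(t)}{x-x_j(t)}+\sum_{j=1}^N\frac{\bar{\mathbf s}_j(t)}{x-\bar x_j(t)}$ be a rational solution of the half-wave maps equation with matrix form $M(t,x)=M_\infty+\sum_{j=1}^N\frac{A_j(t)}{x-x_j(t)}+\sum_{j=1}^N\frac{A_j^*(t)}{x-\bar x_j(t)}$, and assume that the eigenvalues $v_1,\dots,v_N$ of $L(0)$ are pairwise distinct. Write $\Pi_-\mathbf m=\sum_j\frac{\mathbf s_j(t)}{x-x_j(t)}$ and $\Pi_-M=\sum_j\frac{A_j(t)}{x-x_j(t)}$. Then there exist functions $$f_\pm(t,x)=\sum_{j=1}^N\frac{r_j^\pm}{x-v_jt-a_j^\pm},\qquad F_\pm(t,x)=\sum_{j=1}^N\frac{R_j^\pm}{x-v_jt-a_j^\pm},$$ with $r_j^\pm\in\mathbb C^3$, $R_j^\pm\in\mathbb C^{2\times2}$, $a_j^\pm\in\mathbb C$, such that $\|\Pi_-\mathbf m(t,\cdot)-f_\pm(t,\cdot)\|_{\dot H^{1/2}}\to0$ and $\|\Pi_-M(t,\cdot)-F_\pm(t,\cdot)\|_{\dot H^{1/2}}\to0$ as $t\to\pm\infty$, and one has $$f_+(t,x)=f_-(t,x),\qquad F_+(t,x)=F_-(t,x)\qquad\forall t,x\in\mathbb R .$$ Moreover, let $E_1,\dots,E_N$, $F_1,\dots,F_N$ be half spins of $M$ at $t=0$, i.e. diagonal $2\times2$ matrices with $E_jHF_j=A_j(0)$,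 let $P$ be an invertible $N\times N$ matrix with $L(0)=PJP^{-1}$, $J=\operatorname{diag}(v_1,\dots,v_N)$, and let $K_1,\dots,K_N\in\mathbb C^{2\times2}$ be defined by $(K_1,\dots,K_N)^T=[P]^{-1}(F_1,\dots,F_N)^T$ (block columns). Then for every $j$ $$R_j^+=R_j^-=(E_1,\dots,E_N)\,\mathcal H\,[P]\,(0,\dots,0,K_j,0,\dots,0)^T,$$ where $K_j$ is in the $j$-th block; equivalently, $R_j^+=R_j^-=(E_1,\dots,E_N)\,\mathcal H\,[P]\,[\Delta_j]\,[P]^{-1}(F_1,\dots,F_N)^T$, where $\Delta_j$ is the $N\times N$ matrix whose only non-zero entry is a $1$ at position $(j,j)$.
   Context: The half-wave maps equation is $\partial_t\mathbf m=\mathbf m\times|\nabla|\mathbf m$ for $\mathbf m:\mathbb R_t\times\mathbb R_x\to\mathbb S^2\subset\mathbb R^3$, where $|\nabla|\mathbf m$ is the Hilbert transform of $\partial_x\mathbf m$, the Hilbert transform being $f\mapsto\mathrm{P.V.}\frac1\pi\int_{\mathbb R}\frac{f(y)}{x-y}\,dy$. A rational solution is a solution of the form displayed, with $\mathbf m_\infty\in\mathbb S^2$ constant, $\mathbf s_j(t)\in\mathbb C^3\setminus\{0\}$, and pairwise distinct $x_j(t)$ with $\operatorname{Im}x_j(t)>0$. Matrix form: with $\sigma_1,\sigma_2,\sigma_3$ the Pauli matrices and $\mathbf s\cdot\sigma=\sum_i\mathbf s_i\sigma_i$, $M=\mathbf m\cdot\sigma$, $M_\infty=\mathbf m_\infty\cdot\sigma$,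 $A_j=\mathbf s_j\cdot\sigma$. The norm is $\|f\|_{\dot H^{1/2}}^2=\int|\xi||\hat f(\xi)|^2d\xi$. Let $H=\begin{pmatrix}1&1\\1&1\end{pmatrix}$ and let $\mathcal H$ denote the $2N\times2N$ block-diagonal matrix $\operatorname{Diag}(H,\dots,H)$. For an $N\times N$ matrix $U$, $[U]$ is the $2N\times2N$ ''doubled'' matrix made of $2\times2$ blocks, the block at position $(i,j)$ being $U_{ij}I_2$. In the products, $(E_1,\dots,E_N)$ is the $2\times2N$ block row and $(F_1,\dots,F_N)^T$ the $2N\times2$ block column. With $E_j=\operatorname{diag}(e_j^1,e_j^2)$ and $F_j=\operatorname{diag}(\xi_j^1,\xi_j^2)$, put $e_j=(e_j^1,e_j^2)$, $\xi_j=(\xi_j^1,\xi_j^2)$ and $a\cdot b=\sum_ia_ib_i$; then $L(0)$ is the $N\times N$ matrix $$L(0)_{jj}=\dot x_j(0),\qquad L(0)_{jk}=\frac{\xi_j\cdot e_k}{x_j(0)-x_k(0)}\quad(j\neq k).$$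
   Formalization: The off-diagonal entries of L(0) are taken as (ξ_j·e_k)/(x_k(0)−x_j(0)), the opposite of the displayed sign; with the stated conventions the displayed sign makes the residue formula fail already for N=2 when A_1(0), A_2(0) do not commute. *)

(* Defs.v *)
From HB Require Import structures.
From mathcomp Require Import all_boot all_order all_algebra.
From mathcomp Require Import complex.
From mathcomp Require Import all_classical all_reals all_analysis.

Set Implicit Arguments.
Unset Strict Implicit.
Unset Printing Implicit Defensive.

Import Order.TTheory GRing.Theory Num.Theory.
Import numFieldNormedType.Exports.

Local Open Scope classical_set_scope.
Local Open Scope ring_scope.
Local Open Scope complex_scope.

Section Fourier.
Context {R : realType}.
Implicit Types f g : R -> R[i].

Local Notation mu := (@lebesgue_measure R).

Definition csqnorm (z : R[i]) : R := complex.Re z ^+ 2 + complex.Im z ^+ 2.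

Definition cintegrable f : Prop :=
  mu.-integrable setT (EFin \o (fun x => complex.Re (f x))) /\
  mu.-integrable setT (EFin \o (fun x => complex.Im (f x))).

Definition cintegral f : R[i] :=
  (\int[mu]_x complex.Re (f x)) +i* (\int[mu]_x complex.Im (f x)).

Definition L2sqnorm f : \bar R := (\int[mu]_x (csqnorm (f x))%:E)%E.

Definition inL2 f : Prop :=
  [/\ measurable_fun setT (fun x => complex.Re (f x)),
      measurable_fun setT (fun x => complex.Im (f x))
    & (L2sqnorm f < +oo)%E].

Definition fourier_L1 f (xi : R) : R[i] :=
  cintegral (fun x => f x * (cos (x * xi) -i* sin (x * xi))).

(* The Fourier transform on L^2, as the continuous extension of the one on
   L^1 /\ L^2. A rational function such as 1 / (x - z) is in L^2 but not
   in L^1. *)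
Definition is_fourier f g : Prop :=
  [/\ inL2 f, inL2 g &
    exists fn : nat -> R -> R[i],
      [/\ forall n, cintegrable (fn n) /\ inL2 (fn n),
          L2sqnorm (fun x => fn n x - f x) @[n --> \oo] --> 0%E
        & L2sqnorm (fun xi => fourier_L1 (fn n) xi - g xi) @[n --> \oo]
            --> 0%E]].

(* By Plancherel the Fourier transform is unique up to a null set, so the
   infimum is taken over at most one value. It is +oo when f is not in L^2;
   a rational function vanishing at infinity whose H^(1/2) seminorm is finite
   has no real pole, hence is in L^2. *)
Definition Hhalf_sqnorm f : \bar R :=
  ereal_inf [set (\int[mu]_xi (`|xi| * csqnorm (g xi))%:E)%E
            | g in is_fourier f].

Definition Hhalf_norm p q (f : R -> 'M[R[i]]_(p, q)) : \bar R :=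
  ((\sum_(i < p) \sum_(j < q) Hhalf_sqnorm (fun x => f x i j)) `^ 2^-1)%E.

End Fourier.

Section HalfWaveMaps.
Context {R : realType}.

Local Notation mu := (@lebesgue_measure R).

Definition is_hilbert (f : R -> R) (x l : R) : Prop :=
  (forall e : R, 0 < e -> mu.-integrable [set y | e < `|x - y|]
     (EFin \o (fun y => f y / (x - y)))) /\
  pi^-1 * \int[mu]_(y in [set y | e < `|x - y|]) (f y / (x - y))
    @[e --> 0^'+] --> l.

Definition crossmul (u w : 'rV[R]_3) : 'rV[R]_3 :=
  \row_(i < 3) (u 0 (i + 1) * w 0 (i + 2) - u 0 (i + 2) * w 0 (i + 1)).

Definition on_sphere (u : 'rV[R]_3) : Prop := \sum_(i < 3) u 0 i ^+ 2 = 1.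

Definition is_absgrad (u : R -> 'rV[R]_3) (x : R) (w : 'rV[R]_3) : Prop :=
  forall i, is_hilbert (derive1 (fun y => u y 0 i)) x (w 0 i).

Definition half_wave_maps (m : R -> R -> 'rV[R]_3) : Prop :=
  (forall t x, on_sphere (m t x)) /\
  (forall t x, exists w, is_absgrad (m t) x w /\
     forall i, is_derive t 1 (fun u => m u x 0 i) (crossmul (m t x) w 0 i)).

Definition cderivable (z : R -> R[i]) (t : R) : Prop :=
  derivable (fun u => complex.Re (z u)) t 1 /\
  derivable (fun u => complex.Im (z u)) t 1.

Definition cderive (z : R -> R[i]) (t : R) : R[i] :=
  derive1 (fun u => complex.Re (z u)) t +i* derive1 (fun u => complex.Im (z u)) t.

Definition pole_sum N p q (c : 'I_N -> 'M[R[i]]_(p, q)) (z : 'I_N -> R[i])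
    (x : R) : 'M[R[i]]_(p, q) :=
  \sum_(j < N) (x%:C - z j)^-1 *: c j.

Record rational_solution N (m : R -> R -> 'rV[R]_3) (minf : 'rV[R]_3)
    (s : 'I_N -> R -> 'rV[R[i]]_3) (x : 'I_N -> R -> R[i]) : Prop := {
  rational_hwm : half_wave_maps m;
  rational_minf : on_sphere minf;
  rational_form : forall t y,
    map_mx (fun r => r%:C) (m t y) = map_mx (fun r => r%:C) minf
      + pole_sum (fun j => s j t) (fun j => x j t) y
      + pole_sum (fun j => map_mx conjc (s j t)) (fun j => conjc (x j t)) y;
  rational_residue : forall j t, s j t != 0;
  rational_pole : forall j t, 0 < complex.Im (x j t);
  rational_distinct : forall t, injective (fun j => x j t);
  rational_derivable_residue :
    forall j i t, cderivable (fun u => s j u 0 i) t;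
  rational_derivable_pole : forall j t, cderivable (x j) t }.

Definition mx22 (a b c d : R[i]) : 'M[R[i]]_2 :=
  \matrix_(i < 2, j < 2) nth 0 (nth [::] [:: [:: a; b]; [:: c; d]] i) j.

Definition pauli (i : 'I_3) : 'M[R[i]]_2 :=
  nth 0 [:: mx22 0 1 1 0; mx22 0 (0 -i* 1) (0 +i* 1) 0; mx22 1 0 0 (- 1)] i.

Definition spin_mx (u : 'rV[R[i]]_3) : 'M[R[i]]_2 :=
  \sum_(i < 3) u 0 i *: pauli i.

Definition Hmx : 'M[R[i]]_2 := const_mx 1.

Definition half_spins N (A E F : 'I_N -> 'M[R[i]]_2) : Prop :=
  forall j, [/\ is_diag_mx (E j), is_diag_mx (F j)
              & E j *m Hmx *m F j = A j].

Definition diag_dot (F E : 'M[R[i]]_2) : R[i] := \sum_(i < 2) F i i * E i i.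

(* Sign of the off-diagonal entries: with poles in the upper half plane and
   the Hilbert transform of kernel 1 / (pi (x - y)), one has
   |nabla| (1 / (x - z)) = - i / (x - z)^2, and m_t = m x |nabla| m gives
     d/dt A_j = - sum_(k != j) [A_j, A_k] / (x_j - x_k)^2.
   Since A_j A_k = (xi_j . e_k) E_j H F_k, matching this with the derivative
   of the sum over j, k of E_j H F_k [(x - X - t L)^-1]_jk, where
   X = diag (x_j), forces the denominator x_k - x_j. The denominator
   x_j - x_k belongs to the time-reversed equation, i.e. to poles in the lower
   half plane. *)
Definition lax0 N (x : 'I_N -> R -> R[i]) (E F : 'I_N -> 'M[R[i]]_2) :
    'M[R[i]]_N :=
  \matrix_(j, k) if j == k then cderive (x j) 0
                 else diag_dot (F j) (E k) / (x k 0 - x j 0).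

Definition doubled N (U : 'M[R[i]]_N) :=
  \mxblock_(i < N, j < N) ((U i j)%:M : 'M[R[i]]_2).

Definition Hdiag N := \mxdiag_(i < N) Hmx.

Definition block_row N (E : 'I_N -> 'M[R[i]]_2) := \mxrow_(j < N) E j.

Definition block_col N (F : 'I_N -> 'M[R[i]]_2) := \mxcol_(j < N) F j.

End HalfWaveMaps.

(* Main.v *)
(* Put $A_j$ for the residues, $p_k$ for all poles (the $x_j$ and their conjugates) and
   $B_k$ for the regular part of $M$ at $p_k$. Comparing principal parts in $M^2 = 1$ and
   in the evolution equation gives $A_k^2 = 0$, $A_k B_k + B_k A_k = 0$,
   $x_j' A_j = A_j B_j$ and $A_j' = - \sum_k [A_j, A_k] / (x_j - x_k)^2$. These say
   that the operator $v \mapsto v L$ on rows of matrices $v_k \in Mat \cdot A_k$ follows a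
   Lax equation, with $X' = L + [X, C]$ for the second matrix $C$ of the pair, so the moments of the residues evolve
   freely: $\sum_j x_j(t)^n A_j(t) = \mathcal E (X + t L)^n \Xi$, where
   $X, L$ are taken at $t = 0$ and $\mathcal E, \Xi$ collect the half spins. Hence the $x_j(t)$
   are the eigenvalues of $X + t L$ and $A_j(t)$ is cut out by the spectral projections.
   Writing $L = P J P^{-1}$ and localizing the left and right eigenvectors
   of $P^{-1} X P + t J$ for large $|t|$ yields $x(t) = v_j t + a_j + o(1)$ with
   $a_j = (P^{-1} X P)_{jj}$, and the limits of the residues, in both time directions.

   The shifts lie in the open upper half plane: the Cauchy-Gram matrix
   $G_{jk} = \xi_j \cdot \bar\xi_k / (x_j - \bar x_k)$ satisfies $L G = G L^*$ and
   $X G - G X^* = \Xi \Xi^*$, so that $P^{-1} G P^{-*}$ is diagonal, and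
   $\operatorname{Im} a_j = 0$ would force the $j$-th row of $P^{-1}$ to be an
   eigenvector of $X$ with the real eigenvalue $a_j$.

   Convergence in $\dot H^{1/2}$ then reduces to the continuity of
   $z \mapsto 1 / (x - z)$ there. Its Fourier transform is obtained from the integrable
   approximations $1 / ((x - z) (x - w)^2)$ with $w \to - i \infty$. *)

Require Import Defs.
From HB Require Import structures.
From mathcomp Require Import all_boot all_order all_algebra.
From mathcomp Require Import complex ring lra.
From mathcomp Require Import all_classical all_reals all_analysis.
From mathcomp Require Import measurable_realfun.

Set Implicit Arguments.
Unset Strict Implicit.
Unset Printing Implicit Defensive.

Import Order.TTheory GRing.Theory Num.Theory.
Import numFieldNormedType.Exports.

Local Open Scope classical_set_scope.
Local Open Scope ring_scope.
Local Open Scope complex_scope.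
Local Notation Re := complex.Re.
Local Notation Im := complex.Im.
Local Notation normc := ComplexField.Normc.normc.

(** * Complex-valued functions of a real variable *)

Section ComplexDerivative.
Context {R : realType}.
Implicit Types (f g : R -> R[i]) (t : R) (z w d : R[i]).

(** Half spins are given only at time 0, so the Lax pair is made to act on the residues themselves,
    and half spins enter when its iterates are evaluated at time 0. The upper residues obey a closed
    system, but the lower poles still occur in B_k; eliminating them from v_k B_k' is the core of
    the Lax equation. The moments determine poles and residues without any continuity in time: the
    Vandermonde system of distinct poles is injective, and the label matching a pole with a speed
    may jump with t, since a sum over poles does not see the labelling. All thresholds involve |t|
    only, which is why both time directions share one profile. The speeds are not assumed real:
    positivity of Im x_k(t) for large times of both signs forces it. The same positivity yields only
    Im a_j >= 0 in the limit, while the seminorm of a pole blows up at the real line; this is what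
    the Gram matrix argument is for. On the analytic side, the infimum in [Hhalf_sqnorm] is bounded
    above by exhibiting one explicit Fourier transform. *)

Lemma cReD z w : Re (z + w) = Re z + Re w. Proof. by case: z; case: w. Qed.
Lemma cImD z w : Im (z + w) = Im z + Im w. Proof. by case: z; case: w. Qed.
Lemma cReN z : Re (- z) = - Re z. Proof. by case: z. Qed.
Lemma cImN z : Im (- z) = - Im z. Proof. by case: z. Qed.
Lemma cReM z w : Re (z * w) = Re z * Re w - Im z * Im w.
Proof. by case: z; case: w. Qed.
Lemma cImM z w : Im (z * w) = Re z * Im w + Im z * Re w.
Proof. by case: z; case: w. Qed.
Lemma cReJ z : Re z^* = Re z. Proof. by case: z. Qed.
Lemma cImJ z : Im z^* = - Im z. Proof. by case: z. Qed.
Lemma cReC (a : R) : Re a%:C = a. Proof. by []. Qed.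
Lemma cImC (a : R) : Im a%:C = 0. Proof. by []. Qed.
Lemma cReV z : Re z^-1 = Re z / (Re z ^+ 2 + Im z ^+ 2). Proof. by case: z. Qed.
Lemma cImV z : Im z^-1 = - Im z / (Re z ^+ 2 + Im z ^+ 2).
Proof. by case: z => a b /=; rewrite mulNr. Qed.
Lemma eq_ReIm z w : Re z = Re w -> Im z = Im w -> z = w.
Proof. by case: z w => a b [c d] /= -> ->. Qed.

Lemma csqnorm_neq0 z : z != 0 -> Re z ^+ 2 + Im z ^+ 2 != 0.
Proof.
move=> z0; apply: contra z0; rewrite paddr_eq0 ?sqr_ge0// !sqrf_eq0.
by case: z => a b /= /andP[/eqP -> /eqP ->].
Qed.

(** Componentwise, so that the real rules for [is_derive] apply; [cderivableP] connects it with
    [cderivable]. *)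
Definition has_cderive f t d : Prop :=
  is_derive t 1 (fun u => Re (f u)) (Re d) /\
  is_derive t 1 (fun u => Im (f u)) (Im d).

Lemma has_cderive_eq f t d d' : has_cderive f t d -> d = d' -> has_cderive f t d'.
Proof. by move=> ? <-. Qed.

Lemma has_cderive_ext f g t d : f =1 g -> has_cderive f t d -> has_cderive g t d.
Proof. by move=> /funext ->. Qed.

Lemma has_cderive_unique f t d d' :
  has_cderive f t d -> has_cderive f t d' -> d = d'.
Proof.
move=> [h1 h2] [h3 h4]; apply: eq_ReIm.
  by rewrite -(@derive_val _ _ _ _ _ _ _ h1) -(@derive_val _ _ _ _ _ _ _ h3).
by rewrite -(@derive_val _ _ _ _ _ _ _ h2) -(@derive_val _ _ _ _ _ _ _ h4).
Qed.

Lemma has_cderive_cst z t : has_cderive (fun=> z) t 0.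
Proof. by split; apply: is_derive_cst. Qed.

Lemma has_cderive_real (f : R -> R) t (d : R) :
  is_derive t 1 f d -> has_cderive (fun u => (f u)%:C) t d%:C.
Proof. by split => //; apply: is_derive_cst. Qed.

Lemma has_cderive_id t : has_cderive (fun u => u%:C) t 1.
Proof. by apply: (@has_cderive_real id); apply: is_derive_id. Qed.

Lemma has_cderiveD f g t d d' : has_cderive f t d -> has_cderive g t d' ->
  has_cderive (fun u => f u + g u) t (d + d').
Proof.
move=> [h1 h2] [h3 h4]; split; rewrite ?cReD ?cImD.
  by under eq_fun do rewrite cReD; exact: is_deriveD.
by under eq_fun do rewrite cImD; exact: is_deriveD.
Qed.

Lemma has_cderiveN f t d : has_cderive f t d -> has_cderive (fun u => - f u) t (- d).
Proof.
move=> [h1 h2]; split; rewrite ?cReN ?cImN.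
  by under eq_fun do rewrite cReN; exact: is_deriveN.
by under eq_fun do rewrite cImN; exact: is_deriveN.
Qed.

Lemma has_cderiveB f g t d d' : has_cderive f t d -> has_cderive g t d' ->
  has_cderive (fun u => f u - g u) t (d - d').
Proof. by move=> hf /has_cderiveN; exact: has_cderiveD. Qed.

Lemma has_cderiveM f g t d d' : has_cderive f t d -> has_cderive g t d' ->
  has_cderive (fun u => f u * g u) t (d * g t + f t * d').
Proof.
move=> [h1 h2] [h3 h4]; split.
  under eq_fun do rewrite cReM.
  apply: (is_derive_eq (is_deriveB (is_deriveM h1 h3) (is_deriveM h2 h4))).
  by rewrite !(cReD, cReM) /GRing.scale/=; ring.
under eq_fun do rewrite cImM.
apply: (is_derive_eq (is_deriveD (is_deriveM h1 h4) (is_deriveM h2 h3))).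
by rewrite !(cImD, cImM) /GRing.scale/=; ring.
Qed.

Lemma has_cderiveV f t d : f t != 0 -> has_cderive f t d ->
  has_cderive (fun u => (f u)^-1) t (- d / f t ^+ 2).
Proof.
move=> f0 [h1 h2]; have n0 := csqnorm_neq0 f0.
pose n u := Re (f u) * Re (f u) + Im (f u) * Im (f u).
have nE u : Re (f u) ^+ 2 + Im (f u) ^+ 2 = n u by rewrite /n !expr2.
rewrite nE in n0.
have hn := is_deriveD (is_deriveM h1 h1) (is_deriveM h2 h2).
have hV := @is_deriveV _ n _ _ _ n0 hn.
have e : - d / f t ^+ 2 = - d * ((f t)^-1) ^+ 2 by rewrite exprVn.
split.
  under eq_fun do rewrite cReV nE.
  apply: (is_derive_eq (is_deriveM h1 hV)).
  rewrite e !(expr2, cReM, cReN, cImM, cReV, cImV, cImN) -!expr2 !nE /GRing.scale/=.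
  by rewrite /n in n0 *; field.
under eq_fun do rewrite cImV nE.
have h3 : is_derive t 1 (fun u => - Im (f u)) (- Im d) by exact: is_deriveN.
apply: (is_derive_eq (is_deriveM h3 hV)).
rewrite e !(expr2, cReM, cReN, cImM, cReV, cImV, cImN) -!expr2 !nE /GRing.scale/=.
by rewrite /n in n0 *; field.
Qed.

Lemma has_cderive_sum (I : Type) (r : seq I) (P : pred I) (f : I -> R -> R[i]) t
    (d : I -> R[i]) : (forall i, P i -> has_cderive (f i) t (d i)) ->
  has_cderive (fun u => \sum_(i <- r | P i) f i u) t (\sum_(i <- r | P i) d i).
Proof.
move=> h; elim: r => [|i r ih].
  under eq_fun do rewrite big_nil.
  by rewrite big_nil; exact: has_cderive_cst.
under eq_fun do rewrite big_cons.
rewrite big_cons; case: ifPn => // Pi.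
by apply: has_cderiveD => //; exact: h.
Qed.

Lemma has_cderiveX f t d n : has_cderive f t d ->
  has_cderive (fun u => f u ^+ n) t (n%:R * f t ^+ n.-1 * d).
Proof.
move=> h; elim: n => [|n ih].
  by rewrite !mul0r; exact: has_cderive_cst.
under eq_fun do rewrite exprS.
apply: has_cderive_eq (has_cderiveM h ih) _.
case: n {ih} => [|n]; first by rewrite !expr0 !mulr1 !mul0r mulr0 addr0 mul1r.
by rewrite /= exprS -[n.+2%:R]natr1; ring.
Qed.

Lemma has_cderiveJ f t d : has_cderive f t d ->
  has_cderive (fun u => (f u)^*) t d^*.
Proof.
move=> [h1 h2]; split.
  by under eq_fun do rewrite cReJ; rewrite cReJ.
by under eq_fun do rewrite cImJ; rewrite cImJ; exact: is_deriveN.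
Qed.

Lemma cderivableP f t : cderivable f t -> has_cderive f t (cderive f t).
Proof. by move=> [h1 h2]; split; rewrite /= derive1E; apply: derivableP. Qed.

Lemma has_cderive0_cst f : (forall t, has_cderive f t 0) -> forall s t, f s = f t.
Proof.
move=> h s t; apply: eq_ReIm.
  by apply: (@is_derive_0_is_cst _ (fun u => Re (f u))) => u; exact: (h u).1.
by apply: (@is_derive_0_is_cst _ (fun u => Im (f u))) => u; exact: (h u).2.
Qed.

Definition ccontinuous f : Prop :=
  continuous (fun u => Re (f u)) /\ continuous (fun u => Im (f u)).

Lemma has_cderive_continuous f (d : R -> R[i]) :
  (forall t, has_cderive f t (d t)) -> ccontinuous f.
Proof.
move=> h; split => t; apply: differentiable_continuous; apply/derivable1_diffP.
  exact: (@ex_derive _ _ _ _ _ _ _ (h t).1).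
exact: (@ex_derive _ _ _ _ _ _ _ (h t).2).
Qed.

Definition cexp z : R[i] := (expR (Re z))%:C * (cos (Im z) +i* sin (Im z)).

Lemma cexp0 : cexp 0 = 1.
Proof. by apply: eq_ReIm; rewrite /cexp /= expR0 cos0 sin0; ring. Qed.

Lemma cexpD z w : cexp (z + w) = cexp z * cexp w.
Proof.
rewrite /cexp cReD cImD expRD cosD sinD.
by apply: eq_ReIm; rewrite !(cReM, cImM) /=; ring.
Qed.

Lemma normc_cexp z : normc (cexp z) = expR (Re z).
Proof.
rewrite /cexp ComplexField.Normc.normcM /= expr0n addr0 sqrtr_sqr cos2Dsin2.
by rewrite sqrtr1 mulr1 ger0_norm ?expR_ge0.
Qed.

Lemma has_cderive_cexp f t d : has_cderive f t d ->
  has_cderive (fun u => cexp (f u)) t (d * cexp (f t)).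
Proof.
move=> [h1 h2].
have he := is_derive1_comp (is_derive_expR (Re (f t))) h1.
have hc := is_derive1_comp (is_derive_cos (Im (f t))) h2.
have hs := is_derive1_comp (is_derive_sin (Im (f t))) h2.
split.
  rewrite (_ : (fun u => _) = (expR \o (fun u => Re (f u))) *
      (cos \o (fun u => Im (f u)))); last first.
    by apply/funext => u; rewrite /cexp cReM /= mul0r subr0.
  apply: (is_derive_eq (is_deriveM he hc)).
  by rewrite /cexp !(cReM, cImM) /GRing.scale/=; ring.
rewrite (_ : (fun u => _) = (expR \o (fun u => Re (f u))) *
    (sin \o (fun u => Im (f u)))); last first.
  by apply/funext => u; rewrite /cexp cImM /= mul0r addr0.
apply: (is_derive_eq (is_deriveM he hs)).
by rewrite /cexp !(cReM, cImM) /GRing.scale/=; ring.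
Qed.

End ComplexDerivative.

(** * Improper integrals of derivatives *)

Section RealIntegrals.
Context {R : realType}.
Local Notation mu := (@lebesgue_measure R).
Implicit Types (f F : R -> R).

(** Dominated convergence for the restrictions of [f] to [D_ n]. It turns the fundamental theorem on
    bounded intervals into its improper versions. *)
Lemma cvg_Rintegral_exhaust f (D : set R) (D_ : nat -> set R) :
  measurable D -> (forall n, measurable (D_ n)) -> (forall n, D_ n `<=` D) ->
  (forall y, D y -> \forall n \near \oo, D_ n y) ->
  mu.-integrable D (EFin \o f) ->
  \int[mu]_(y in D_ n) f y @[n --> \oo] --> \int[mu]_(y in D) f y.
Proof.
move=> mD mD_ sD exD intf; pose g : R -> \bar R := EFin \o f.
have mg : measurable_fun D g by case/integrableP: intf.
pose g_ n : R -> \bar R := g \_ (D_ n).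
have mgn n : measurable_fun D (g_ n).
  by apply/measurable_restrict => //; apply: measurable_funS mg => // y [].
have gng y n : D y -> (`|g_ n y| <= (abse \o g) y)%E.
  by move=> Dy; rewrite /g_ patchE; case: ifP => // _; rewrite abse0 /=.
have gn_cvg y : D y -> g_ ^~ y @ \oo --> g y.
  move=> Dy; apply: cvg_near_cst.
  have := exD _ Dy; apply: filterS => n Dny.
  by rewrite /g_ patchE mem_set.
have [_ _ h] : [/\ mu.-integrable D g,
    [sequence \int[mu]_(y in D) `|g_ n y - g y|]_n @ \oo --> 0 &
    [sequence \int[mu]_(y in D) g_ n y]_n @ \oo --> \int[mu]_(y in D) g y]%E.
  apply: (@dominated_convergence _ _ _ mu D mD g_ g (abse \o g) mgn mg).
  - exact: aeW.
  - exact: integrable_abse.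
  - exact: aeW.
have fin : (\int[mu]_(x in D) g x)%E \is a fin_num by exact: integrable_fin_num.
rewrite /Rintegral; apply: fine_cvg; rewrite fineK//.
apply: cvg_trans h; apply: near_eq_cvg; apply: nearW => n.
by rewrite /= /g_ -integral_mkcondr setIidr.
Qed.

Lemma Rintegral_FTC f F (a b : R) : a <= b ->
  (forall y, a <= y <= b -> is_derive y 1 F (f y)) ->
  (forall y, a <= y <= b -> {for y, continuous f}) ->
  \int[mu]_(y in `[a, b]) f y = F b - F a.
Proof.
move=> ab dF cf.
have cF y : a <= y <= b -> {for y, continuous F}.
  by move=> /dF h; apply: differentiable_continuous; exact/derivable1_diffP/ex_derive.
move: ab; rewrite le_eqVlt => /predU1P[<-|ab].
  by rewrite set_itv1 Rintegral_set1 subrr.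
rewrite /Rintegral (@continuous_FTC2 _ f F)//.
- by apply: continuous_in_subspaceT => y; rewrite inE/= in_itv/=; exact: cf.
- split.
  + move=> y; rewrite in_itv/= => /andP[ay yb].
    by apply: (@ex_derive _ _ _ _ _ _ _ (dF _ _)); rewrite !ltW.
  + by apply: cvg_at_right_filter; apply: cF; rewrite lexx ltW.
  + by apply: cvg_at_left_filter; apply: cF; rewrite lexx ltW.
- move=> y; rewrite in_itv/= => /andP[ay yb].
  by rewrite derive1E; apply: (@derive_val _ _ _ _ _ _ _ (dF _ _)); rewrite !ltW.
Qed.

Lemma Rintegral_FTCy f F (a l : R) :
  (forall y, a <= y -> is_derive y 1 F (f y)) ->
  (forall y, a <= y -> {for y, continuous f}) ->
  mu.-integrable `]a, +oo[ (EFin \o f) ->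
  F y @[y --> +oo] --> l ->
  \int[mu]_(y in `]a, +oo[) f y = l - F a.
Proof.
move=> dF cf intf Fl.
have h := @cvg_Rintegral_exhaust f `]a, +oo[ (fun n => `]a, a + n%:R]%classic)
  (measurable_itv _) (fun n => measurable_itv _) _ _ intf.
have h2 : \int[mu]_(y in `]a, a + n%:R]) f y @[n --> \oo] --> l - F a.
  rewrite (_ : (fun n => _) = (fun n => F (a + n%:R) - F a)); last first.
    apply/funext => n; rewrite Rintegral_itv_obnd_cbnd; last first.
      by apply: integrableS intf => // y /=; rewrite !in_itv/= => /andP[->].
    apply: Rintegral_FTC; first by rewrite lerDl.
    - by move=> y /andP[+ _]; exact: dF.
    - by move=> y /andP[+ _]; exact: cf.
  apply: cvgB; last exact: cvg_cst.
  apply: cvg_comp Fl.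
  by apply: (cvg_comp _ _ cvgr_idn); exact: cvg_addrl.
apply: (cvg_unique _ (h _ _) h2) => //.
  by move=> n y /=; rewrite !in_itv/= => /andP[->].
move=> y /=; rewrite in_itv/= andbT => ay.
near=> n; rewrite /= in_itv/= ay/= -lerBlDl.
by near: n; exact: nbhs_infty_ger.
Unshelve. all: by end_near. Qed.

Lemma Rintegral_FTCNy f F (a l : R) :
  (forall y, y <= a -> is_derive y 1 F (f y)) ->
  (forall y, y <= a -> {for y, continuous f}) ->
  mu.-integrable `]-oo, a[ (EFin \o f) ->
  F y @[y --> -oo] --> l ->
  \int[mu]_(y in `]-oo, a[) f y = F a - l.
Proof.
move=> dF cf intf Fl.
have h := @cvg_Rintegral_exhaust f `]-oo, a[ (fun n => `[a - n%:R, a[%classic)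
  (measurable_itv _) (fun n => measurable_itv _) _ _ intf.
have h2 : \int[mu]_(y in `[a - n%:R, a[) f y @[n --> \oo] --> F a - l.
  rewrite (_ : (fun n => _) = (fun n => F a - F (a - n%:R))); last first.
    apply/funext => n; rewrite Rintegral_itv_bndo_bndc; last first.
      by apply: integrableS intf => // y /=; rewrite !in_itv/= => /andP[_ ->].
    apply: Rintegral_FTC; first by rewrite gerBl.
    - by move=> y /andP[_]; exact: dF.
    - by move=> y /andP[_]; exact: cf.
  apply: cvgB; first exact: cvg_cst.
  apply: cvg_comp Fl.
  apply/cvgrNyPle => A; near=> n; rewrite lerBlDr -lerBlDl.
  by near: n; exact: nbhs_infty_ger.
apply: (cvg_unique _ (h _ _) h2) => //.
  by move=> n y /=; rewrite !in_itv/= => /andP[_ ->].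
move=> y /=; rewrite in_itv/= => ay.
near=> n; rewrite /= in_itv/= ay/= andbT lerBlDr -lerBlDl.
by near: n; exact: nbhs_infty_ger.
Unshelve. all: by end_near. Qed.

Lemma Rintegral_FTCT f F (l l' : R) :
  (forall y : R, is_derive y 1 F (f y)) -> continuous f ->
  mu.-integrable setT (EFin \o f) ->
  F y @[y --> -oo] --> l' -> F y @[y --> +oo] --> l ->
  \int[mu]_y f y = l - l'.
Proof.
move=> dF cf intf Fl' Fl.
have mT : measurable (setT : set R) by [].
have TE : [set: R] = `]-oo, 0]%classic `|` `]0, +oo[%classic.
  by rewrite -setCitvl setUv.
rewrite TE Rintegral_setU//=; last 2 first.
- by rewrite -TE.
- by rewrite -setCitvl; apply/disj_setPCl.
have i1 : mu.-integrable `]-oo, 0[ (EFin \o f) by exact: integrableS intf.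
rewrite -Rintegral_itv_bndo_bndc// (@Rintegral_FTCNy f F 0 l')//; last first.
  by move=> y _; exact: cf.
rewrite (@Rintegral_FTCy f F 0 l)//; last 2 first.
- by move=> y _; exact: cf.
- exact: integrableS intf.
by ring.
Qed.

Lemma integrable_oneDsqrV : mu.-integrable setT (EFin \o (fun y : R => (1 + y ^+ 2)^-1)).
Proof.
have m : measurable_fun setT (EFin \o (fun y : R => (1 + y ^+ 2)^-1)).
  by apply/measurable_EFinP; apply: continuous_measurable_fun; exact: continuous_oneDsqrV.
apply/integrableP; split => //.
rewrite [X in (X < _)%E](_ : _ = (\int[mu]_y ((1 + y ^+ 2)^-1)%:E)%E); last first.
  apply: eq_integral => y _ /=.
  by rewrite ger0_norm// invr_ge0 addr_ge0// sqr_ge0.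
rewrite ge0_symfun_integralT//=; last 3 first.
- by move=> y; rewrite invr_ge0 addr_ge0// sqr_ge0.
- exact: continuous_oneDsqrV.
- by move=> y /=; rewrite sqrrN.
rewrite (_ : [set x | 0 <= x] = `[0, +oo[%classic); last first.
  by apply/seteqP; split => y /=; rewrite in_itv/= andbT.
by rewrite integral0y_oneDsqr -EFinM ltry.
Qed.

Lemma integrable_oneDsqrV_bound f C : measurable_fun setT f ->
  (forall y, `|f y| <= C / (1 + y ^+ 2)) -> mu.-integrable setT (EFin \o f).
Proof.
move=> mf fC; apply: (@le_integrable _ _ _ mu setT _ _
  (EFin \o (fun y : R => C * (1 + y ^+ 2)^-1))) => //.
- exact/measurable_EFinP.
- by move=> y _ /=; rewrite lee_fin (le_trans (fC y))// ler_norm.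
rewrite (_ : _ \o _ = (fun y => C%:E * ((1 + y ^+ 2)^-1)%:E)%E)//.
exact/integrableZl/integrable_oneDsqrV.
Qed.

End RealIntegrals.

(** * Limits at infinity of poles and logarithms *)

Section ComplexLimits.
Context {R : realType}.
Implicit Types (f g : R -> R[i]) (F : set_system R).

Definition ccvg F f (l : R[i]) : Prop :=
  (Re (f y) @[y --> F] --> Re l) /\ (Im (f y) @[y --> F] --> Im l).

Lemma ccvg_cst F {FF : Filter F} z : ccvg F (fun=> z) z.
Proof. by split; exact: cvg_cst. Qed.

Lemma ccvgD F {FF : Filter F} f g l l' : ccvg F f l -> ccvg F g l' ->
  ccvg F (fun y => f y + g y) (l + l').
Proof.
move=> [h1 h2] [h3 h4]; split.
  by under eq_fun do rewrite cReD; rewrite cReD; exact: cvgD.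
by under eq_fun do rewrite cImD; rewrite cImD; exact: cvgD.
Qed.

Lemma ccvgN F {FF : Filter F} f l : ccvg F f l -> ccvg F (fun y => - f y) (- l).
Proof.
move=> [h1 h2]; split.
  by under eq_fun do rewrite cReN; rewrite cReN; exact: cvgN.
by under eq_fun do rewrite cImN; rewrite cImN; exact: cvgN.
Qed.

Lemma ccvgB F {FF : Filter F} f g l l' : ccvg F f l -> ccvg F g l' ->
  ccvg F (fun y => f y - g y) (l - l').
Proof. by move=> h1 /ccvgN; exact: ccvgD. Qed.

Lemma ccvgM F {FF : Filter F} f g l l' : ccvg F f l -> ccvg F g l' ->
  ccvg F (fun y => f y * g y) (l * l').
Proof.
move=> [h1 h2] [h3 h4]; split.
  by under eq_fun do rewrite cReM; rewrite cReM; apply: cvgB; exact: cvgM.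
by under eq_fun do rewrite cImM; rewrite cImM; apply: cvgD; exact: cvgM.
Qed.

Lemma ccvg_sum F {FF : Filter F} (I : Type) (r : seq I) (P : pred I)
    (f : I -> R -> R[i]) (l : I -> R[i]) : (forall i, P i -> ccvg F (f i) (l i)) ->
  ccvg F (fun y => \sum_(i <- r | P i) f i y) (\sum_(i <- r | P i) l i).
Proof.
move=> h; elim: r => [|i r ih].
  by under eq_fun do rewrite big_nil; rewrite big_nil; exact: ccvg_cst.
under eq_fun do rewrite big_cons.
by rewrite big_cons; case: ifPn => // Pi; apply: ccvgD => //; exact: h.
Qed.

(** A limit at either infinity becomes continuity at 0 in the variable 1/y. The threshold [K] leaves
    room for identities valid only for large [|y|], such as splitting logarithms. *)
Lemma cvg_infty_inv (K : R) (f g : R -> R) : {for 0, continuous g} ->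
  (forall y, K < `|y| -> y != 0 -> f y = g y^-1) ->
  (f y @[y --> +oo] --> g 0) /\ (f y @[y --> -oo] --> g 0).
Proof.
move=> g0 fg; split.
  have p : \forall y \near +oo, (0 : R) < id y by exact: nbhs_pinfty_gt.
  have e : {near +oo, (fun y => g y^-1) =1 f}.
    have := nbhs_pinfty_gt (num_real K); apply: filterS2 p => y /= y0 Ky.
    by apply/esym/fg; [rewrite ltr_normr Ky|rewrite gt_eqF].
  have h : g y^-1 @[y --> +oo] --> g 0.
    apply: (@cvg_comp _ _ _ (fun y => y^-1) g _ (nbhs (0 : R)) _ _ g0).
    exact: ((gtr0_cvgV0 p).2 (@cvg_id _ _)).
  exact: (cvg_trans (near_eq_cvg e) h).
have p : \forall y \near -oo, (id y : R) < 0 by exact: nbhs_ninfty_lt.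
have e : {near -oo, (fun y => g y^-1) =1 f}.
  have := nbhs_ninfty_lt (num_real (- K)); apply: filterS2 p => y /= y0 Ky.
  by apply/esym/fg; [rewrite ltr_normr ltrNr Ky orbT|rewrite lt_eqF].
have h : g y^-1 @[y --> -oo] --> g 0.
  apply: (@cvg_comp _ _ _ (fun y => y^-1) g _ (nbhs (0 : R)) _ _ g0).
  exact: ((ltr0_cvgV0 p).2 (@cvg_id _ _)).
exact: (cvg_trans (near_eq_cvg e) h).
Qed.

Lemma has_cderive_for_continuous f t d : has_cderive f t d ->
  {for t, continuous (fun u => Re (f u))} /\ {for t, continuous (fun u => Im (f u))}.
Proof.
move=> [h1 h2]; split; apply: differentiable_continuous; apply/derivable1_diffP.
  exact: (@ex_derive _ _ _ _ _ _ _ h1).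
exact: (@ex_derive _ _ _ _ _ _ _ h2).
Qed.

Lemma ccvg_infty_inv f g d : has_cderive g 0 d ->
  (forall y, y != 0 -> f y = g y^-1) ->
  ccvg (+oo : set_system R) f (g 0) /\ ccvg (-oo : set_system R) f (g 0).
Proof.
move=> /has_cderive_for_continuous [c1 c2] fg.
have [h1 h2] := @cvg_infty_inv 0 (fun u => Re (f u)) _ c1
  (fun y _ y0 => congr1 (@complex.Re R) (fg y y0)).
have [h3 h4] := @cvg_infty_inv 0 (fun u => Im (f u)) _ c2
  (fun y _ y0 => congr1 (@complex.Im R) (fg y y0)).
by split; split.
Qed.

Lemma sub_nonreal_neq0 (z : R[i]) (y : R) : Im z != 0 -> y%:C - z != 0.
Proof.
apply: contra => /eqP h; have /eqP : Im (y%:C - z) = 0 by rewrite h.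
by rewrite cImD cImN cImC add0r oppr_eq0.
Qed.

Lemma ccvg_pole_infty (z : R[i]) : Im z != 0 ->
  ccvg (+oo : set_system R) (fun y => (y%:C - z)^-1) 0 /\
  ccvg (-oo : set_system R) (fun y => (y%:C - z)^-1) 0.
Proof.
move=> z0; pose g (u : R) := u%:C * (1 - z * u%:C)^-1.
have -> : (0 : R[i]) = g 0 by rewrite /g mul0r.
have hg : has_cderive (fun u : R => 1 - z * u%:C) 0 (0 - (0 * 0%:C + z * 1)).
  apply: has_cderiveB; first exact: has_cderive_cst.
  by apply: has_cderiveM; [exact: has_cderive_cst|exact: has_cderive_id].
apply: ccvg_infty_inv => [|y y0].
  apply: has_cderiveM; first exact: has_cderive_id.
  by apply: has_cderiveV hg; rewrite mulr0 subr0 oner_eq0.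
have yc : y%:C != 0 by rewrite -(inj_eq (@complexI _)) in y0 *.
have h : y%:C - z != 0 by exact: sub_nonreal_neq0.
rewrite /g fmorphV/=; field.
by rewrite h yc.
Qed.

(** A branch of log (y - z), up to a constant, that is smooth on the whole real line; [atan] makes
    its behaviour at both infinities explicit. *)
Definition clog (z : R[i]) (y : R) : R[i] :=
  (ln ((y - Re z) ^+ 2 + Im z ^+ 2) / 2) +i* atan ((y - Re z) / Im z).

Lemma has_cderive_clog z y : Im z != 0 -> has_cderive (clog z) y (y%:C - z)^-1.
Proof.
move=> z0.
have n0 : 0 < (y - Re z) ^+ 2 + Im z ^+ 2.
  by rewrite ltr_wpDl ?sqr_ge0// exprn_even_gt0.
have n0' : (y - Re z) ^+ 2 + Im z ^+ 2 != 0 by rewrite gt_eqF.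
have dB : is_derive y 1 (fun u : R => u - Re z) 1.
  by apply: is_derive_eq; rewrite subr0.
have dS : is_derive y 1 (fun u : R => (u - Re z) ^+ 2 + Im z ^+ 2) (2 * (y - Re z)).
  under eq_fun do rewrite expr2.
  apply: (is_derive_eq (is_deriveD (is_deriveM dB dB) (is_derive_cst (Im z ^+ 2) _ _))).
  by rewrite /GRing.scale/=; ring.
have dA : is_derive y 1 (fun u : R => (u - Re z) / Im z) (Im z)^-1.
  rewrite (_ : (fun u => _) = (Im z)^-1 \*: (fun u : R => u - Re z)); last first.
    by apply/funext => u; rewrite /GRing.scale /= mulrC.
  by apply: (is_derive_eq (is_deriveZ _ dB)); rewrite /GRing.scale/= mulr1.
have dL := @is_derive1_comp _ (@ln R) (fun u : R => (u - Re z) ^+ 2 + Im z ^+ 2)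
  y _ _ (is_derive1_ln n0) dS.
have dT := @is_derive1_comp _ atan (fun u : R => (u - Re z) / Im z)
  y _ _ (is_derive1_atan ((y - Re z) / Im z)) dA.
split.
  rewrite (_ : (fun u => _) = 2^-1 \*: (@ln R \o (fun u : R => (u - Re z) ^+ 2 + Im z ^+ 2))); last first.
    by apply/funext => u /=; rewrite /GRing.scale/= mulrC.
  apply: (is_derive_eq (is_deriveZ _ dL)).
  rewrite cReV !(cReD, cReN, cImD, cImN, cReC, cImC) /GRing.scale/= add0r sqrrN.
  by field.
apply: (is_derive_eq dT).
rewrite cImV !(cReD, cReN, cImD, cImN, cReC, cImC) add0r sqrrN opprK.
by field; rewrite n0' z0.
Qed.

(** Both logarithms contain [ln (y ^+ 2)], which cancels after factoring out [y ^+ 2]; the rest is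
    continuous at 1/y = 0. Since [b] or [b'] may vanish, [|y|] beyond [|a| + |a'|] keeps the
    remaining factors positive. *)
Lemma cvg_lnB_infty (a b a' b' : R) :
  let f y := ln ((y - a) ^+ 2 + b ^+ 2) - ln ((y - a') ^+ 2 + b' ^+ 2) in
  (f y @[y --> +oo] --> 0) /\ (f y @[y --> -oo] --> 0).
Proof.
move=> f; pose q a b u : R := (1 - a * u) ^+ 2 + (b * u) ^+ 2.
pose g (u : R) := ln (q a b u) - ln (q a' b' u).
have q0 a1 b1 : q a1 b1 0 = 1 by rewrite /q !mulr0 subr0 expr1n expr0n addr0.
have cq a1 b1 : {for 0, continuous (q a1 b1)}.
  by apply: cvgD; (under eq_fun do rewrite expr2); apply: cvgM;
     try (apply: cvgB; first exact: cvg_cst); apply: cvgM; try exact: cvg_cst; exact: cvg_id.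
have -> : (0 : R) = g 0 by rewrite /g !q0 subrr.
have c1 : {for (1 : R), continuous (@ln R)}.
  apply: differentiable_continuous; apply/derivable1_diffP.
  exact: (@ex_derive _ _ _ _ _ _ _ (is_derive1_ln ltr01)).
have cl a1 b1 : {for 0, continuous (fun u => ln (q a1 b1 u))}.
  apply: (@continuous_comp _ _ _ (q a1 b1) (@ln R)); first exact: cq.
  by rewrite q0.
apply: (@cvg_infty_inv (`|a| + `|a'|)) => [|y Ky y0].
  by apply: cvgB; exact: cl.
have y2 : 0 < y ^+ 2 by rewrite exprn_even_gt0.
have qE a1 b1 : (y - a1) ^+ 2 + b1 ^+ 2 = y ^+ 2 * q a1 b1 y^-1.
  by rewrite /q; field.
have q_gt0 a1 b1 : `|a1| <= `|a| + `|a'| -> 0 < q a1 b1 y^-1.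
  move=> h; rewrite /q ltr_wpDr ?sqr_ge0// exprn_even_gt0//= subr_eq0.
  apply/eqP => e; have /eqP : a1 = y by rewrite -[y]mul1r e mulfVK.
  by apply/negP; apply: contraTneq Ky => <-; rewrite -leNgt.
have p := q_gt0 a b; have p' := q_gt0 a' b'.
rewrite lerDl normr_ge0 in p; rewrite lerDr normr_ge0 in p'.
rewrite /f /g !qE; move: (y ^+ 2) y2 => Y Y0.
by rewrite !lnM ?posrE ?p ?p'//; ring.
Qed.

Lemma ccvg_atan_infty (a b : R) : 0 < b ->
  (atan ((y - a) / b) @[y --> +oo] --> pi / 2) /\
  (atan ((y - a) / b) @[y --> -oo] --> - (pi / 2)).
Proof.
move=> b0.
have h (c : R) : atan ((y - c) / b) @[y --> +oo] --> pi / 2.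
  apply: (@cvg_comp _ _ _ (fun y => (y - c) / b) atan _ _ _ _ (@cvgy_atan R)).
  by apply: gt0_cvgMly; [rewrite invr_gt0|exact: cvg_addrr].
split; first exact: h.
apply/cvgNy_compNP.
rewrite (_ : _ \o _ = (fun y => - atan ((y - - a) / b))); last first.
  apply/funext => y /=.
  by rewrite -atanN opprK; congr atan; field; rewrite gt_eqF.
by apply: cvgN; exact: h.
Qed.

End ComplexLimits.

(** * The Hilbert transform of a double pole *)

Section Hilbert.
Context {R : realType}.
Local Notation mu := (@lebesgue_measure R).

(** The summand [0 ^+ 2] keeps the shape of [clog] for a pole on the real line, so that
    [cvg_lnB_infty] applies with [b' = 0]. *)
Lemma has_cderive_lnsqr (x y : R) : y != x ->
  has_cderive (fun u : R => (ln ((u - x) ^+ 2 + 0 ^+ 2) / 2)%:C) y (y%:C - x%:C)^-1.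
Proof.
move=> yx; have yx0 : y - x != 0 by rewrite subr_eq0.
have n0 : 0 < (y - x) ^+ 2 + 0 ^+ 2 by rewrite expr0n addr0 exprn_even_gt0.
have -> : (y%:C - x%:C)^-1 = ((y - x)^-1)%:C by rewrite -rmorphB fmorphV.
apply: has_cderive_real.
have dB : is_derive y 1 (fun u : R => u - x) 1.
  by apply: is_derive_eq; rewrite subr0.
have dS : is_derive y 1 (fun u : R => (u - x) ^+ 2 + 0 ^+ 2) (2 * (y - x)).
  under eq_fun do rewrite expr2.
  apply: (is_derive_eq (is_deriveD (is_deriveM dB dB) (is_derive_cst ((0:R) ^+ 2) y 1))).
  by rewrite /GRing.scale/=; ring.
have dL := @is_derive1_comp _ (@ln R) (fun u : R => (u - x) ^+ 2 + 0 ^+ 2)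
  y _ _ (is_derive1_ln n0) dS.
rewrite (_ : (fun u => _) = 2^-1 \*: (@ln R \o (fun u : R => (u - x) ^+ 2 + 0 ^+ 2))); last first.
  by apply/funext => u /=; rewrite /GRing.scale/= mulrC.
apply: (is_derive_eq (is_deriveZ _ dL)).
by rewrite /GRing.scale/= expr0n addr0; field.
Qed.

Lemma ccvg_clog_lnsqr (z : R[i]) (x : R) : 0 < Im z ->
  ccvg (+oo : set_system R)
    (fun y => clog z y - (ln ((y - x) ^+ 2 + 0 ^+ 2) / 2)%:C) (0 +i* (pi / 2)) /\
  ccvg (-oo : set_system R)
    (fun y => clog z y - (ln ((y - x) ^+ 2 + 0 ^+ 2) / 2)%:C) (0 +i* - (pi / 2)).
Proof.
move=> z0; have [h1 h2] := cvg_lnB_infty (Re z) (Im z) x 0.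
have [h3 h4] := ccvg_atan_infty (Re z) z0.
split; split => /=.
- rewrite -[X in _ --> X](mul0r 2^-1); under eq_fun do rewrite -mulrBl.
  by apply: cvgM => //; exact: cvg_cst.
- by under eq_fun do rewrite subr0.
- rewrite -[X in _ --> X](mul0r 2^-1); under eq_fun do rewrite -mulrBl.
  by apply: cvgM => //; exact: cvg_cst.
- by under eq_fun do rewrite subr0.
Qed.

(** For poles in the upper half plane the Hilbert transform is multiplication by i. The integrand
    has an explicit primitive: between the two infinities its [atan] part contributes pi i, and its
    only singularity, ln |y - x|, is even about [x] and cancels between the two ends of the gap. *)
Lemma is_hilbert_double_pole (I : finType) (c z : I -> R[i]) (x l : R) :
  (forall i, 0 < Im (z i)) ->
  is_hilbert (fun y => Re (\sum_i c i / (y%:C - z i) ^+ 2)) x l ->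
  l = Re ((0 +i* 1) * \sum_i c i / (x%:C - z i) ^+ 2).
Proof.
move=> z0 [int_f lim_f].
have zn i : Im (z i) != 0 by rewrite gt_eqF.
have dn i (y : R) : y%:C - z i != 0 by exact: sub_nonreal_neq0.
pose d i := x%:C - z i.
pose lnx (y : R) := (ln ((y - x) ^+ 2 + 0 ^+ 2) / 2)%:C : R[i].
(* Obtained from the partial fractions of 1 / ((y - z)^2 (x - y)) in [y], with d = x - z. *)
pose G (y : R) := \sum_i c i * ((d i ^+ 2)^-1 * (clog (z i) y - lnx y)
                          - (d i)^-1 * (y%:C - z i)^-1).
pose f (y : R) := \sum_i c i / (y%:C - z i) ^+ 2.
have dYz y i : has_cderive (fun u : R => u%:C - z i) y 1.
  rewrite -[1](subr0 1).
  by apply: has_cderiveB; [exact: has_cderive_id | exact: has_cderive_cst].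
have df y : exists e, has_cderive (fun y => f y / (x%:C - y%:C)) y e \/ y = x.
  have [->|yx] := eqVneq y x; first by exists 0; right.
  eexists; left; apply: has_cderiveM.
    apply: has_cderive_sum => i _; apply: has_cderiveM; first exact: has_cderive_cst.
    apply: has_cderiveV; first by rewrite expf_neq0.
    exact: has_cderiveX (dYz y i).
  apply: has_cderiveV.
    by rewrite -rmorphB -(rmorph0 (real_complex R)) (inj_eq (@complexI _)) subr_eq0 eq_sym.
  by apply: has_cderiveB; [exact: has_cderive_cst|exact: has_cderive_id].
have dG y : y != x -> has_cderive G y (f y / (x%:C - y%:C)).
  move=> yx; have yxc : y%:C - x%:C != 0.
    by rewrite -rmorphB -(rmorph0 (real_complex R)) (inj_eq (@complexI _)) subr_eq0.
  rewrite /f mulr_suml; apply: has_cderive_sum => i _.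
  apply: has_cderive_eq.
    apply: has_cderiveM; first exact: has_cderive_cst.
    apply: has_cderiveB; apply: has_cderiveM; try exact: has_cderive_cst.
      by apply: has_cderiveB; [exact: has_cderive_clog|exact: has_cderive_lnsqr].
    by apply: has_cderiveV; [exact: dn|exact: dYz].
  have := dn i y; have := dn i x; rewrite -/(d i) => h1 h2.
  rewrite /d in h1 *; field.
  by rewrite h1 h2 yxc -opprB oppr_eq0 yxc.
pose Lp := \sum_i c i * ((d i ^+ 2)^-1 * (0 +i* (pi / 2)) - (d i)^-1 * 0).
pose Lm := \sum_i c i * ((d i ^+ 2)^-1 * (0 +i* - (pi / 2)) - (d i)^-1 * 0).
have GLp : ccvg (+oo : set_system R) G Lp.
  apply: ccvg_sum => i _; apply: ccvgM; first exact: ccvg_cst.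
  apply: ccvgB; apply: ccvgM; try exact: ccvg_cst.
    exact: (ccvg_clog_lnsqr x (z0 i)).1.
  exact: (ccvg_pole_infty (zn i)).1.
have GLm : ccvg (-oo : set_system R) G Lm.
  apply: ccvg_sum => i _; apply: ccvgM; first exact: ccvg_cst.
  apply: ccvgB; apply: ccvgM; try exact: ccvg_cst.
    exact: (ccvg_clog_lnsqr x (z0 i)).2.
  exact: (ccvg_pole_infty (zn i)).2.
(* The part of [G] that is continuous at [x]. *)
pose H (y : R) := \sum_i c i * ((d i ^+ 2)^-1 * clog (z i) y - (d i)^-1 * (y%:C - z i)^-1).
have reE (y : R) : Re (f y) / (x - y) = Re (f y / (x%:C - y%:C)).
  by rewrite -rmorphB -fmorphV cReM cReC cImC mulr0 subr0.
have cRe (y : R) : y != x -> {for y, continuous (fun y => Re (f y) / (x - y))}.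
  move=> yx; have [e [h|/eqP]] := df y; last by rewrite (negPf yx).
  rewrite (_ : (fun y => _) = (fun y => Re (f y / (x%:C - y%:C)))); last first.
    by apply/funext => u; exact: reE.
  exact: (has_cderive_for_continuous h).1.
have intE (e : R) : 0 < e -> \int[mu]_(y in [set y | e < `|x - y|]) (Re (f y) / (x - y)) =
    Re (Lp - Lm) + (Re (H (x - e)) - Re (H (x + e))).
  move=> e0.
  have SE : [set y | e < `|x - y|] = `]-oo, x - e[%classic `|` `]x + e, +oo[%classic.
    apply/seteqP; split => y /=; rewrite !in_itv/= andbT.
      by rewrite ltr_normr => /orP[h|h]; [left|right]; lra.
    by rewrite ltr_normr => -[h|h]; apply/orP; [left|right]; lra.
  have iS := int_f e e0.
  rewrite -/(f _) in iS.
  rewrite SE Rintegral_setU//=; last 2 first.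
  - by rewrite -SE.
  - by apply/disj_setPLR => y /=; rewrite !in_itv/= andbT; lra.
  have -> : \int[mu]_(y in `]x + e, +oo[) (Re (f y) / (x - y)) = Re Lp - Re (G (x + e)).
    apply: (@Rintegral_FTCy _ _ (fun y => Re (G y))).
    - move=> y xy; rewrite reE; apply: (dG y _).1.
      by apply/eqP => h; move: xy; rewrite h; lra.
    - move=> y xy; apply: cRe.
      by apply/eqP => h; move: xy; rewrite h; lra.
    - by apply: integrableS iS => //; rewrite SE; [exact: measurableU | exact: subsetUr].
    - exact: GLp.1.
  have -> : \int[mu]_(y in `]-oo, x - e[) (Re (f y) / (x - y)) = Re (G (x - e)) - Re Lm.
    apply: (@Rintegral_FTCNy _ _ (fun y => Re (G y))).
    - move=> y xy; rewrite reE; apply: (dG y _).1.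
      by apply/eqP => h; move: xy; rewrite h; lra.
    - move=> y xy; apply: cRe.
      by apply/eqP => h; move: xy; rewrite h; lra.
    - by apply: integrableS iS => //; rewrite SE; [exact: measurableU | exact: subsetUl].
    - exact: GLm.1.
  have GE y : G y = H y - (\sum_i c i * (d i ^+ 2)^-1) * lnx y.
    rewrite /G /H mulr_suml -sumrB; apply: eq_bigr => i _; ring.
  have lnE : lnx (x - e) = lnx (x + e).
    by rewrite /lnx; congr (ln (_ + _) / _)%:C; ring.
  have -> : Re (G (x - e)) = Re (G (x + e)) + (Re (H (x - e)) - Re (H (x + e))).
    by rewrite !GE lnE !(cReD, cReN); ring.
  by rewrite cReD cReN; ring.
have HC : {for x, continuous (fun y => Re (H y))}.
  suff [e he] : exists e, has_cderive H x e by exact: (has_cderive_for_continuous he).1.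
  eexists; apply: has_cderive_sum => i _; apply: has_cderiveM; first exact: has_cderive_cst.
  apply: has_cderiveB; apply: has_cderiveM; try exact: has_cderive_cst.
    exact: has_cderive_clog.
  by apply: has_cderiveV; [exact: dn|exact: dYz].
have lim2 : pi^-1 * \int[mu]_(y in [set y | e < `|x - y|]) (Re (f y) / (x - y))
    @[e --> 0^'+] --> pi^-1 * (Re (Lp - Lm) + (Re (H (x - 0)) - Re (H (x + 0)))).
  have h : pi^-1 * (Re (Lp - Lm) + (Re (H (x - e)) - Re (H (x + e)))) @[e --> 0^'+]
      --> pi^-1 * (Re (Lp - Lm) + (Re (H (x - 0)) - Re (H (x + 0)))).
    apply: cvg_at_right_filter.
    apply: cvgM; first exact: cvg_cst.
    apply: cvgD; first exact: cvg_cst.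
    apply: cvgB.
      apply: (@continuous_comp _ _ _ (fun e : R => x - e) (fun y => Re (H y))).
        by apply: cvgB; [exact: cvg_cst|exact: cvg_id].
      by rewrite subr0.
    apply: (@continuous_comp _ _ _ (fun e : R => x + e) (fun y => Re (H y))).
      by apply: cvgD; [exact: cvg_cst|exact: cvg_id].
    by rewrite addr0.
  apply: cvg_trans h; apply: near_eq_cvg.
  by near=> e; rewrite intE.
have -> : l = pi^-1 * (Re (Lp - Lm) + (Re (H (x - 0)) - Re (H (x + 0)))).
  exact: (cvg_unique _ lim_f lim2).
rewrite subr0 addr0 subrr addr0 /Lp /Lm -sumrB mulr_sumr !raddf_sum/= mulr_sumr.
apply: eq_bigr => i _; rewrite -/(d i).
have -> : c i * ((d i ^+ 2)^-1 * (0 +i* (pi / 2)) - (d i)^-1 * 0) -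
   c i * ((d i ^+ 2)^-1 * (0 +i* - (pi / 2)) - (d i)^-1 * 0) =
   pi%:C * ((0 +i* 1) * (c i / d i ^+ 2)).
  have -> : 0 +i* (pi / 2) = (pi / 2)%:C * (0 +i* 1) :> R[i].
    by apply: eq_ReIm; rewrite !(cReM, cImM) /=; ring.
  have -> : 0 +i* - (pi / 2) = - ((pi / 2)%:C * (0 +i* 1)) :> R[i].
    by apply: eq_ReIm; rewrite !(cReN, cImN, cReM, cImM) /=; ring.
  have -> : pi%:C = (pi / 2)%:C + (pi / 2)%:C :> R[i].
    by rewrite -rmorphD; congr (_%:C); field.
  by ring.
by rewrite cReM cReC cImC mul0r subr0 mulKf// gt_eqF// pi_gt0.
Unshelve. all: by end_near. Qed.

End Hilbert.

(** * Fourier transforms of rational functions *)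

Section Decay.
Context {R : realType}.
Implicit Types (f g : R -> R[i]).

Lemma normc_ge0 (z : R[i]) : 0 <= normc z.
Proof. by case: z => a b; exact: sqrtr_ge0. Qed.

Lemma normcD (z w : R[i]) : normc (z + w) <= normc z + normc w.
Proof. exact: le_normcD. Qed.

Lemma normcN' (z : R[i]) : normc (- z) = normc z.
Proof. exact: normcN. Qed.

Lemma normcM (z w : R[i]) : normc (z * w) = normc z * normc w.
Proof. exact: ComplexField.Normc.normcM. Qed.

Lemma Re_le_normc (z : R[i]) : `|Re z| <= normc z.
Proof.
by case: z => a b /=; rewrite -sqrtr_sqr ler_sqrt ?lerDl ?sqr_ge0// addr_ge0 ?sqr_ge0.
Qed.

Lemma Im_le_normc (z : R[i]) : `|Im z| <= normc z.
Proof.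
by case: z => a b /=; rewrite -sqrtr_sqr ler_sqrt ?lerDr ?sqr_ge0// addr_ge0 ?sqr_ge0.
Qed.

Lemma csqnormE (z : R[i]) : csqnorm z = normc z ^+ 2.
Proof. by case: z => a b; rewrite /csqnorm /= sqr_sqrtr// addr_ge0 ?sqr_ge0. Qed.

Lemma normc_le_ReIm (z : R[i]) : normc z <= `|Re z| + `|Im z|.
Proof.
rewrite -(ler_pXn2r (n:=2))// ?nnegrE ?normc_ge0 ?addr_ge0//.
rewrite -csqnormE /csqnorm sqrrD -!normrX !(ger0_norm (sqr_ge0 _)).
by rewrite [_ + _ *+ 2]addrC -addrA lerDr mulrn_wge0// mulr_ge0.
Qed.

Lemma normc_real (a : R) : normc a%:C = `|a|.
Proof. by rewrite /= expr0n addr0 sqrtr_sqr. Qed.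

(** The class of admissible integrands: a product of two poles lies in it, a single pole does not.
    The bound gives both integrability and vanishing boundary terms. *)
Definition decays f : Prop := ccontinuous f /\
  exists C, forall x, normc (f x) <= C / (1 + x ^+ 2).

Lemma decays_cintegrable f : decays f -> cintegrable f.
Proof.
move=> [[c1 c2] [C fC]]; split; apply: (@integrable_oneDsqrV_bound _ _ C).
- exact: continuous_measurable_fun.
- by move=> y; apply: le_trans (fC y); exact: Re_le_normc.
- exact: continuous_measurable_fun.
- by move=> y; apply: le_trans (fC y); exact: Im_le_normc.
Qed.

Lemma ccontinuousM f g : ccontinuous f -> ccontinuous g ->
  ccontinuous (fun x => f x * g x).
Proof.
move=> [c1 c2] [c3 c4]; split => x.
  under eq_fun do rewrite cReM.
  by apply: cvgB; apply: cvgM; [exact: c1|exact: c3|exact: c2|exact: c4].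
under eq_fun do rewrite cImM.
by apply: cvgD; apply: cvgM; [exact: c1|exact: c4|exact: c2|exact: c3].
Qed.

Lemma ccontinuousD f g : ccontinuous f -> ccontinuous g ->
  ccontinuous (fun x => f x + g x).
Proof.
move=> [c1 c2] [c3 c4]; split => x.
  by under eq_fun do rewrite cReD; apply: cvgD; [exact: c1|exact: c3].
by under eq_fun do rewrite cImD; apply: cvgD; [exact: c2|exact: c4].
Qed.

Lemma ccontinuous_cst (z : R[i]) : ccontinuous (fun=> z : R[i]).
Proof. by split => x; exact: cvg_cst. Qed.

Lemma decaysD f g : decays f -> decays g -> decays (fun x => f x + g x).
Proof.
move=> [cf [C fC]] [cg [D gD]]; split; first exact: ccontinuousD.
by exists (C + D) => x; rewrite mulrDl (le_trans (normcD _ _))// lerD.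
Qed.

Lemma decays_bounded f g K : decays f -> ccontinuous g -> (forall x, normc (g x) <= K) ->
  decays (fun x => g x * f x).
Proof.
move=> [cf [C fC]] cg gK; split; first exact: ccontinuousM.
by exists (K * C) => x; rewrite normcM -mulrA ler_pM ?normc_ge0.
Qed.

Lemma decaysZ f (z : R[i]) : decays f -> decays (fun x => z * f x).
Proof.
move=> df; apply: (@decays_bounded _ _ (normc z)) => //; exact: ccontinuous_cst.
Qed.

Lemma decays_sum (I : Type) (r : seq I) (P : pred I) (f : I -> R -> R[i]) :
  (forall i, P i -> decays (f i)) -> decays (fun x => \sum_(i <- r | P i) f i x).
Proof.
move=> h; elim: r => [|i r ih].
  under eq_fun do rewrite big_nil.
  split; first exact: ccontinuous_cst.
  by exists 0 => x; rewrite ComplexField.Normc.normc0 mul0r.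
under eq_fun do rewrite big_cons.
by case: (P i) (h i) => // hi; apply: decaysD => //; exact: hi.
Qed.

Definition pole (z : R[i]) (x : R) : R[i] := (x%:C - z)^-1.

Lemma has_cderive_pole z x : Im z != 0 -> has_cderive (pole z) x (- pole z x ^+ 2).
Proof.
move=> z0; apply: has_cderive_eq.
  apply: has_cderiveV; first exact: sub_nonreal_neq0.
  by apply: has_cderiveB; [exact: has_cderive_id | exact: has_cderive_cst].
by rewrite subr0 /pole exprVn mulN1r.
Qed.

Lemma ccontinuous_pole z : Im z != 0 -> ccontinuous (pole z).
Proof. by move=> z0; apply: has_cderive_continuous => x; exact: has_cderive_pole. Qed.

Lemma csqnorm_pole z x : normc (pole z x) ^+ 2 = ((x - Re z) ^+ 2 + Im z ^+ 2)^-1.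
Proof.
rewrite /pole ComplexField.Normc.normcV exprVn -csqnormE /csqnorm.
by rewrite !(cReD, cImD, cReN, cImN, cReC, cImC) add0r sqrrN.
Qed.

Lemma csqnorm_pole_le z : Im z != 0 ->
  exists C, forall x, normc (pole z x) ^+ 2 <= C / (1 + x ^+ 2).
Proof.
(* With z = a + i b one has 1 + x^2 <= (1 + 2 a^2) + 2 (x - a)^2, and each summand is at most a
   multiple of (x - a)^2 + b^2; [C] adds the two multiples. *)
move=> z0; pose C := (1 + 2 * Re z ^+ 2) / Im z ^+ 2 + 2; exists C => x.
have b0 : 0 < Im z ^+ 2 by rewrite exprn_even_gt0.
have d0 : 0 < (x - Re z) ^+ 2 + Im z ^+ 2 by rewrite ltr_wpDl ?sqr_ge0.
have x0 : 0 < 1 + x ^+ 2 by rewrite ltr_pwDl ?sqr_ge0.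
rewrite csqnorm_pole ler_pdivlMr// mulrC ler_pdivrMr//.
have E : C * ((x - Re z) ^+ 2 + Im z ^+ 2) = (1 + 2 * Re z ^+ 2) / Im z ^+ 2 *
  (x - Re z) ^+ 2 + (1 + 2 * Re z ^+ 2) + 2 * (x - Re z) ^+ 2 + 2 * Im z ^+ 2.
  by rewrite /C; field.
rewrite E.
have h1 : 0 <= (1 + 2 * Re z ^+ 2) / Im z ^+ 2 * (x - Re z) ^+ 2.
  apply: mulr_ge0; last exact: sqr_ge0.
  by apply: divr_ge0; rewrite ?sqr_ge0// addr_ge0// mulr_ge0// sqr_ge0.
have h2 := sqr_ge0 (x - 2 * Re z).
have h3 : (x - 2 * Re z) ^+ 2 = 2 * (x - Re z) ^+ 2 + 2 * Re z ^+ 2 - x ^+ 2 by ring.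
by lra.
Qed.

Lemma pole_bounded z x : Im z != 0 -> normc (pole z x) <= `|Im z|^-1.
Proof.
move=> z0; rewrite -(ler_pXn2r (n:=2))// ?nnegrE ?normc_ge0 ?invr_ge0//.
rewrite csqnorm_pole exprVn -normrX ger0_norm ?sqr_ge0// lef_pV2 ?posrE.
- by rewrite lerDr sqr_ge0.
- by rewrite ltr_wpDl ?sqr_ge0// exprn_even_gt0.
- by rewrite exprn_even_gt0.
Qed.

Lemma decays_poleM z w : Im z != 0 -> Im w != 0 -> decays (fun x => pole z x * pole w x).
Proof.
move=> z0 w0; split; first by apply: ccontinuousM; exact: ccontinuous_pole.
have [C hC] := csqnorm_pole_le z0; have [D hD] := csqnorm_pole_le w0.
exists (C + D) => x; rewrite normcM mulrDl.
apply: le_trans (lerD (hC x) (hD x)).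
have := sqr_ge0 (normc (pole z x) - normc (pole w x)).
have : 0 <= normc (pole z x) * normc (pole w x) by rewrite mulr_ge0 ?normc_ge0.
by rewrite sqrrB; lra.
Qed.

End Decay.

(** * The Fourier integral on decaying functions *)

Section FourierL1.
Context {R : realType}.
Local Notation mu := (@lebesgue_measure R).
Local Notation iC := (0 +i* 1 : R[i]).
Implicit Types (f g : R -> R[i]).

Lemma cintegralD f g : decays f -> decays g ->
  cintegral (fun x => f x + g x) = cintegral f + cintegral g.
Proof.
move=> /decays_cintegrable[f1 f2] /decays_cintegrable[g1 g2].
apply: eq_ReIm; rewrite ?cReD ?cImD /cintegral /=.
  by under eq_Rintegral do rewrite cReD; rewrite RintegralD.
by under eq_Rintegral do rewrite cImD; rewrite RintegralD.
Qed.

Lemma cintegralZ f (z : R[i]) : decays f ->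
  cintegral (fun x => z * f x) = z * cintegral f.
Proof.
move=> /decays_cintegrable[f1 f2].
have i1 (a : R) : mu.-integrable setT (EFin \o (fun x => a * Re (f x))).
  rewrite (_ : _ \o _ = (fun x => a%:E * (Re (f x))%:E)%E)//; exact: integrableZl.
have i2 (a : R) : mu.-integrable setT (EFin \o (fun x => a * Im (f x))).
  rewrite (_ : _ \o _ = (fun x => a%:E * (Im (f x))%:E)%E)//; exact: integrableZl.
apply: eq_ReIm; rewrite ?cReM ?cImM /cintegral /=.
  under eq_Rintegral do rewrite cReM.
  by rewrite RintegralB ?RintegralZl.
under eq_Rintegral do rewrite cImM.
by rewrite RintegralD ?RintegralZl.
Qed.

Definition fker (xi x : R) : R[i] := cexp (- iC * (x * xi)%:C).

Lemma fkerE xi x : fker xi x = cos (x * xi) -i* sin (x * xi).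
Proof.
have -> : fker xi x = cexp (0 +i* - (x * xi)).
  by congr cexp; apply: eq_ReIm; rewrite ?cReM ?cImM !(cReN, cImN) /=; ring.
by rewrite /cexp /= expR0 cosN sinN; apply: eq_ReIm => /=; ring.
Qed.

Lemma fourier_L1E f xi : fourier_L1 f xi = cintegral (fun x => f x * fker xi x).
Proof. by rewrite /fourier_L1; congr cintegral; apply/funext => x; rewrite fkerE. Qed.

Lemma normc_fker xi x : normc (fker xi x) = 1.
Proof.
by rewrite /fker normc_cexp cReM cReN cImN /= oppr0 !mul0r mulr0 subr0 expR0.
Qed.

Lemma has_cderive_fker xi x : has_cderive (fker xi) x (- iC * xi%:C * fker xi x).
Proof.
rewrite /fker; under eq_fun do rewrite rmorphM/=.
have h : has_cderive (fun x : R => - iC * (x%:C * xi%:C)) x (- iC * xi%:C).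
  apply: has_cderive_eq.
    apply: has_cderiveM; first exact: has_cderive_cst.
    by apply: has_cderiveM; [exact: has_cderive_id|exact: has_cderive_cst].
  by rewrite mul0r add0r mulr0 addr0 mul1r.
by rewrite rmorphM; exact: (has_cderive_cexp h).
Qed.

Lemma has_cderive_fker_l xi x :
  has_cderive (fker ^~ x) xi (- iC * x%:C * fker xi x).
Proof.
have E u v : fker u v = fker v u by rewrite /fker [v * u]mulrC.
have -> : fker ^~ x = fker x by apply/funext => u; exact: E.
by rewrite E; exact: has_cderive_fker.
Qed.

Lemma ccontinuous_fker xi : ccontinuous (fker xi).
Proof. by apply: has_cderive_continuous => x; exact: has_cderive_fker. Qed.

Lemma decays_fker f xi : decays f -> decays (fun x => f x * fker xi x).
Proof.
move=> df; under eq_fun do rewrite mulrC.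
by apply: (@decays_bounded _ _ _ 1) => //; [exact: ccontinuous_fker|move=> x; rewrite normc_fker].
Qed.

Lemma fourier_L1D f g xi : decays f -> decays g ->
  fourier_L1 (fun x => f x + g x) xi = fourier_L1 f xi + fourier_L1 g xi.
Proof.
move=> df dg; rewrite !fourier_L1E -cintegralD; try exact: decays_fker.
by congr cintegral; apply/funext => x; rewrite mulrDl.
Qed.

Lemma fourier_L1Z f (z : R[i]) xi : decays f ->
  fourier_L1 (fun x => z * f x) xi = z * fourier_L1 f xi.
Proof.
move=> df; rewrite !fourier_L1E -cintegralZ; try exact: decays_fker.
by congr cintegral; apply/funext => x; rewrite mulrA.
Qed.

Lemma fourier_L1_sum (I : Type) (r : seq I) (f : I -> R -> R[i]) xi :
  (forall i, decays (f i)) ->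
  fourier_L1 (fun x => \sum_(i <- r) f i x) xi = \sum_(i <- r) fourier_L1 (f i) xi.
Proof.
move=> h; elim: r => [|i r ih].
  under eq_fun do rewrite big_nil.
  have d0 : decays (fun=> 0 : R[i]).
    split; first exact: ccontinuous_cst.
    by exists 0 => x; rewrite ComplexField.Normc.normc0 mul0r.
  rewrite big_nil -[RHS](mul0r (fourier_L1 (fun=> 0 : R[i]) xi)) -fourier_L1Z//.
  by congr (fourier_L1 _ _); apply/funext => x; rewrite mul0r.
under eq_fun do rewrite big_cons.
by rewrite big_cons -ih fourier_L1D//; exact: decays_sum.
Qed.

Lemma fourier_L1_bounded f : decays f -> exists K, forall xi, normc (fourier_L1 f xi) <= K.
Proof.
move=> df; have [_ [C fC]] := df; pose K := \int[mu]_x (C * (1 + x ^+ 2)^-1).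
have iC2 : mu.-integrable setT (EFin \o (fun x : R => C * (1 + x ^+ 2)^-1)).
  rewrite (_ : _ \o _ = (fun x : R => C%:E * ((1 + x ^+ 2)^-1)%:E)%E)//.
  exact/integrableZl/integrable_oneDsqrV.
exists (K + K) => xi; apply: le_trans (normc_le_ReIm _) _.
have [i1 i2] := decays_cintegrable (decays_fker xi df).
have b x : normc (f x * fker xi x) <= C / (1 + x ^+ 2).
  by rewrite normcM normc_fker mulr1.
rewrite fourier_L1E /cintegral /=; apply: lerD.
  apply: le_trans (le_normr_Rintegral _ i1) _ => //.
  apply: le_Rintegral => //=; first exact: integrable_norm i1.
  by move=> x _; apply: le_trans (b x); exact: Re_le_normc.
apply: le_trans (le_normr_Rintegral _ i2) _ => //.
apply: le_Rintegral => //=; first exact: integrable_norm i2.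
by move=> x _; apply: le_trans (b x); exact: Im_le_normc.
Qed.

(** Differentiation under the integral sign; the decay of x f(x) supplies a majorant that is uniform
    in the frequency. *)
Lemma has_cderive_fourier_L1 f xi : decays f -> decays (fun x => x%:C * f x) ->
  has_cderive (fourier_L1 f) xi (fourier_L1 (fun x => - iC * (x%:C * f x)) xi).
Proof.
move=> df dxf; have [_ [C xfC]] := dxf.
pose G x := (`|C| * (1 + x ^+ 2)^-1 : R).
have G0 x : 0 <= G x by rewrite /G mulr_ge0// invr_ge0 addr_ge0// sqr_ge0.
have iG : mu.-integrable setT (EFin \o G).
  rewrite (_ : _ \o _ = (fun x : R => `|C|%:E * ((1 + x ^+ 2)^-1)%:E)%E)//.
  exact/integrableZl/integrable_oneDsqrV.
have dker y x : has_cderive (fun u => f x * fker u x) y (- iC * (x%:C * f x) * fker y x).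
  apply: has_cderive_eq.
    by apply: has_cderiveM; [exact: has_cderive_cst|exact: has_cderive_fker_l].
  rewrite mul0r add0r; ring.
have bound y x : normc (- iC * (x%:C * f x) * fker y x) <= G x.
  rewrite (normcM _ (fker y x)) normc_fker mulr1 mulNr normcN' (normcM iC).
  rewrite [normc iC]/= expr0n expr1n add0r sqrtr1 mul1r.
  apply: le_trans (xfC x) _; rewrite ler_wpM2r ?ler_norm// invr_ge0 addr_ge0// sqr_ge0//.
have int y : cintegrable (fun x => f x * fker y x).
  by apply: decays_cintegrable; exact: decays_fker.
have Ixi : (`]xi - 1, xi + 1[%classic : set R) xi by rewrite /= in_itv/=; apply/andP; split; lra.
have D1 x y : partial1of2 (fun y x => Re (f x * fker y x)) y x = Re (- iC * (x%:C * f x) * fker y x).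
  by rewrite partial1of2E; apply: (@derive_val _ _ _ _ _ _ _ (dker y x).1).
have D2 x y : partial1of2 (fun y x => Im (f x * fker y x)) y x = Im (- iC * (x%:C * f x) * fker y x).
  by rewrite partial1of2E; apply: (@derive_val _ _ _ _ _ _ _ (dker y x).2).
split.
  rewrite (_ : (fun u => _) = (fun u => \int[mu]_x Re (f x * fker u x))); last first.
    by apply/funext => u; rewrite fourier_L1E.
  have ab : forall y x, `]xi - 1, xi + 1[%classic y -> setT x ->
      `|partial1of2 (fun y x => Re (f x * fker y x)) y x| <= G x.
    by move=> y x _ _; rewrite D1; apply: le_trans (bound y x); exact: Re_le_normc.
  have h1 := @derivable_under_integral R _ _ mu (fun y x => Re (f x * fker y x)) setT
    measurableT xi _ _ Ixi (fun y _ => (int y).1)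
    (fun y x _ _ => @ex_derive _ _ _ _ _ _ _ (dker y x).1) G G0 iG ab.
  have h2 := @differentiation_under_integral R _ _ mu (fun y x => Re (f x * fker y x)) setT
    measurableT xi _ _ Ixi (fun y _ => (int y).1)
    (fun y x _ _ => @ex_derive _ _ _ _ _ _ _ (dker y x).1) G G0 iG ab.
  apply: (is_derive_eq (derivableP h1)).
  rewrite -derive1E h2 fourier_L1E /cintegral /=.
  by apply: eq_Rintegral => x _; rewrite D1.
rewrite (_ : (fun u => _) = (fun u => \int[mu]_x Im (f x * fker u x))); last first.
  by apply/funext => u; rewrite fourier_L1E.
have ab : forall y x, `]xi - 1, xi + 1[%classic y -> setT x ->
    `|partial1of2 (fun y x => Im (f x * fker y x)) y x| <= G x.
  by move=> y x _ _; rewrite D2; apply: le_trans (bound y x); exact: Im_le_normc.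
have h1 := @derivable_under_integral R _ _ mu (fun y x => Im (f x * fker y x)) setT
  measurableT xi _ _ Ixi (fun y _ => (int y).2)
  (fun y x _ _ => @ex_derive _ _ _ _ _ _ _ (dker y x).2) G G0 iG ab.
have h2 := @differentiation_under_integral R _ _ mu (fun y x => Im (f x * fker y x)) setT
  measurableT xi _ _ Ixi (fun y _ => (int y).2)
  (fun y x _ _ => @ex_derive _ _ _ _ _ _ _ (dker y x).2) G G0 iG ab.
apply: (is_derive_eq (derivableP h1)).
rewrite -derive1E h2 fourier_L1E /cintegral /=.
by apply: eq_Rintegral => x _; rewrite D2.
Qed.

Lemma cintegral_FTC F f (l l' : R[i]) :
  (forall x, has_cderive F x (f x)) -> decays f ->
  ccvg (-oo : set_system R) F l' -> ccvg (+oo : set_system R) F l ->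
  cintegral f = l - l'.
Proof.
move=> dF df [l1 l2] [l3 l4]; have [[c1 c2] _] := df.
have [i1 i2] := decays_cintegrable df.
apply: eq_ReIm; rewrite ?cReD ?cReN ?cImD ?cImN /=.
  by apply: (@Rintegral_FTCT _ _ (fun x => Re (F x))) => // x; exact: (dF x).1.
by apply: (@Rintegral_FTCT _ _ (fun x => Im (F x))) => // x; exact: (dF x).2.
Qed.

Lemma decays_cvg0 f : decays f ->
  ccvg (-oo : set_system R) f 0 /\ ccvg (+oo : set_system R) f 0.
Proof.
move=> [_ [C fC]].
have h : ((C / (1 + x ^+ 2) : R) @[x --> +oo] --> 0) /\
         ((C / (1 + x ^+ 2) : R) @[x --> -oo] --> 0).
  pose g (u : R) := C * u ^+ 2 / (1 + u ^+ 2).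
  have -> : (0 : R) = g 0 by rewrite /g expr0n mulr0 mul0r.
  apply: (@cvg_infty_inv _ 0) => [|y _ y0].
    have c : {for (0:R), continuous (fun u : R => u ^+ 2)}.
      exact: exprn_continuous.
    apply: cvgM; first by apply: cvgM => //; exact: cvg_cst.
    apply: cvgV; first by rewrite expr0n addr0 oner_eq0.
    by apply: cvgD => //; exact: cvg_cst.
  have n1 : 1 + y ^+ 2 != 0 by rewrite gt_eqF// ltr_pwDl ?sqr_ge0.
  have n2 : y ^+ 2 + 1 != 0 by rewrite addrC.
  by rewrite /g; field; rewrite y0 ?n1 ?n2.
have sq (F : set_system R) : Filter F ->
    (C / (1 + x ^+ 2) : R) @[x --> F] --> 0 -> ccvg F f 0.
  move=> FF hF; split.
    apply/norm_cvg0P; apply: (squeeze_cvgr _ (cvg_cst 0) hF).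
    by apply: nearW => x; rewrite normr_ge0 (le_trans (Re_le_normc _)).
  apply/norm_cvg0P; apply: (squeeze_cvgr _ (cvg_cst 0) hF).
  by apply: nearW => x; rewrite normr_ge0 (le_trans (Im_le_normc _)).
by case: h => h1 h2; split; exact: sq.
Qed.

Lemma fourier_L1_derive f f' xi : decays f -> decays f' ->
  (forall x, has_cderive f x (f' x)) ->
  fourier_L1 f' xi = iC * xi%:C * fourier_L1 f xi.
Proof.
move=> df df' h.
have d1 := decays_fker xi df; have d2 := decays_fker xi df'.
have : cintegral (fun x => f' x * fker xi x + (- iC * xi%:C) * (f x * fker xi x)) = 0 - 0.
  apply: (@cintegral_FTC (fun x => f x * fker xi x)).
  - move=> x; apply: has_cderive_eq.
      by apply: has_cderiveM; [exact: h|exact: has_cderive_fker].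
    by ring.
  - by apply: decaysD => //; exact: decaysZ.
  - exact: (decays_cvg0 d1).1.
  - exact: (decays_cvg0 d1).2.
rewrite cintegralD// ?cintegralZ//; last exact: decaysZ.
rewrite -!fourier_L1E subr0 => /eqP; rewrite addr_eq0 => /eqP ->.
by ring.
Qed.

End FourierL1.

(** * The transform of 1 / ((x - z) (x - w)^2) by differential equations *)

Section PoleTransform.
Context {R : realType}.
Local Notation iC := (0 +i* 1 : R[i]).

Lemma iC2 : iC * iC = -1.
Proof. by apply: eq_ReIm; rewrite ?cReM ?cImM ?cReN ?cImN /=; ring. Qed.

Lemma Re_iM (u : R[i]) : Re (iC * u) = - Im u.
Proof. by case: u => a b /=; ring. Qed.

Lemma Re_Mreal (u : R[i]) (a : R) : Re (u * a%:C) = Re u * a.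
Proof. by case: u => b c /=; ring. Qed.

Lemma iC_neq0 : iC != 0.
Proof. by rewrite eq_complex /= eqxx oner_eq0. Qed.

Lemma has_cderive_comp (f : R -> R[i]) (g : R -> R) (t b : R) d :
  has_cderive f (g t) d -> is_derive t 1 g b ->
  has_cderive (fun u => f (g u)) t (d * b%:C).
Proof.
move=> [h1 h2] hg; split.
  rewrite cReM cReC cImC mulr0 subr0.
  exact: (@is_derive1_comp _ (fun u => Re (f u)) g t _ _ h1 hg).
rewrite cImM cReC cImC mulr0 add0r.
exact: (@is_derive1_comp _ (fun u => Im (f u)) g t _ _ h2 hg).
Qed.

(** Used to discard growing solutions: a bounded transform has coefficient 0 in front of a growing
    exponential. The quadratic minorant of the exponential already beats the linear bound. *)
Lemma exp_growth_eq0 (a b K D : R) : 0 <= a -> 0 < b ->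
  (forall x, 0 <= x -> a * expR (b * x) <= K + D * x) -> a = 0.
Proof.
move=> a0 b0 h; apply/eqP; rewrite eq_le a0 andbT leNgt; apply/negP => ap.
have q x : 0 <= x -> a * (1 + b * x / 2) ^+ 2 <= K + D * x.
  move=> x0; apply: le_trans (h x x0); rewrite ler_wpM2l//.
  have -> : expR (b * x) = expR (b * x / 2 + b * x / 2) by congr expR; field.
  have p : 0 <= 1 + b * x / 2 by rewrite addr_ge0// divr_ge0// mulr_ge0// ltW.
  by rewrite expRD -expr2; apply: lerXn2r; [|rewrite nnegrE expR_ge0|exact: expR_ge1Dx].
pose m := a * b ^+ 2 / 4.
have m0 : 0 < m by rewrite /m divr_gt0// mulr_gt0// exprn_gt0.
have {}q x : 0 <= x -> m * x ^+ 2 <= K + D * x.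
  move=> x0; apply: le_trans (q x x0).
  have -> : a * (1 + b * x / 2) ^+ 2 = m * x ^+ 2 + a * (1 + b * x) by rewrite /m; field.
  by rewrite lerDl mulr_ge0// addr_ge0// mulr_ge0// ltW.
(* Chosen so that [m * x = |K| + |D| + m]; together with x >= 1 this makes [m * x ^+ 2] exceed
   [K + D * x]. *)
pose x := (`|K| + `|D|) / m + 1.
have x1 : 1 <= x by rewrite lerDr divr_ge0 ?addr_ge0// ltW.
have x0 : 0 <= x by exact: le_trans x1.
have := q x x0.
have -> : m * x ^+ 2 = (`|K| + `|D| + m) * x by rewrite /x; field; rewrite gt_eqF.
rewrite leNgt => /negP; apply.
have h1 := ler_norm K; have h2 := ler_norm D.
have h3 : D * x <= `|D| * x by rewrite ler_wpM2r.
have h4 : `|K| <= `|K| * x by rewrite ler_peMr.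
have h5 : 0 < m * x by rewrite mulr_gt0// (lt_le_trans ltr01).
by rewrite !mulrDl; lra.
Qed.

Variables (z w : R[i]).
Hypotheses (z0 : 0 < Im z) (w0 : Im w < 0).

Let zn : Im z != 0. Proof. by rewrite gt_eqF. Qed.
Let wn : Im w != 0. Proof. by rewrite lt_eqF. Qed.
Let zw : z - w != 0.
Proof.
rewrite subr_eq0; apply/eqP => e; have := lt_trans w0 z0.
by rewrite e ltxx.
Qed.

Let q2 x := pole w x ^+ 2.
Let q3 x := pole w x ^+ 3.
Definition pole_prod x := pole z x * pole w x ^+ 2.
Let F2 := fourier_L1 q2.
Let F3 := fourier_L1 q3.
Let F := fourier_L1 pole_prod.

Let dq2 : decays q2.
Proof. by rewrite /q2; under eq_fun do rewrite expr2; exact: decays_poleM. Qed.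
Let dq3 : decays q3.
Proof.
rewrite /q3; under eq_fun do rewrite exprS.
apply: (decays_bounded dq2 (ccontinuous_pole wn)) => x; exact: pole_bounded.
Qed.
Lemma decays_pole_prod : decays pole_prod.
Proof. by apply: (decays_bounded dq2 (ccontinuous_pole zn)) => x; exact: pole_bounded. Qed.
Let dp := decays_pole_prod.

Let poleK (u : R[i]) x : Im u != 0 -> x%:C * pole u x = 1 + u * pole u x.
Proof.
move=> u0; have h := sub_nonreal_neq0 x u0.
by rewrite /pole; field.
Qed.

Let xq3 x : x%:C * q3 x = q2 x + w * q3 x.
Proof. by rewrite /q3 /q2 exprS mulrA poleK//; ring. Qed.
Let xp x : x%:C * pole_prod x = q2 x + z * pole_prod x.
Proof. by rewrite /pole_prod /q2 mulrA poleK//; ring. Qed.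

Let dF3 xi : has_cderive F3 xi (- iC * (F2 xi + w * F3 xi)).
Proof.
apply: has_cderive_eq.
  apply: has_cderive_fourier_L1 => //.
  by under eq_fun do rewrite xq3; apply: decaysD => //; exact: decaysZ.
rewrite fourier_L1Z; last first.
  by under eq_fun do rewrite xq3; apply: decaysD => //; exact: decaysZ.
under [X in fourier_L1 X _]eq_fun do rewrite xq3.
by rewrite fourier_L1D ?fourier_L1Z//; exact: decaysZ.
Qed.

Let dF xi : has_cderive F xi (- iC * (F2 xi + z * F xi)).
Proof.
apply: has_cderive_eq.
  apply: has_cderive_fourier_L1 => //.
  by under eq_fun do rewrite xp; apply: decaysD => //; exact: decaysZ.
rewrite fourier_L1Z; last first.
  by under eq_fun do rewrite xp; apply: decaysD => //; exact: decaysZ.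
under [X in fourier_L1 X _]eq_fun do rewrite xp.
by rewrite fourier_L1D ?fourier_L1Z//; exact: decaysZ.
Qed.

Lemma ccontinuous_fourier_pole_prod : ccontinuous (fourier_L1 pole_prod).
Proof. exact: has_cderive_continuous dF. Qed.

(** With [dF3] this gives a first-order equation for [F3] alone. Orders 2 and 3 are the lowest
    possible pair: orders 1 and 2 would involve the simple pole, which is not integrable. *)
Let F3E xi : - 2 * F3 xi = iC * xi%:C * F2 xi.
Proof.
rewrite /F3 -fourier_L1Z//; apply: fourier_L1_derive => //; first exact: decaysZ.
move=> x; apply: has_cderive_eq; first exact: has_cderiveX (has_cderive_pole x wn).
by rewrite /q3 /= expr1; ring.
Qed.

Let F2E xi : xi != 0 -> F2 xi = 2 * iC * F3 xi / xi%:C.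
Proof.
move=> x0; have xc : xi%:C != 0 by rewrite -(rmorph0 (real_complex R)) (inj_eq (@complexI _)).
apply: (mulfI xc); apply: (mulfI iC_neq0); rewrite mulrA -F3E.
have -> : iC * (xi%:C * (2 * iC * F3 xi / xi%:C)) = (iC * iC) * 2 * F3 xi by field.
by rewrite iC2; ring.
Qed.

Let normc_wexp xi : normc (cexp (- iC * w * xi%:C)) = expR (Im w * xi).
Proof.
rewrite normc_cexp; congr expR.
by rewrite Re_Mreal mulNr cReN Re_iM opprK.
Qed.

(* Along xi = e * exp s the equation xi F3' = (2 - iC w xi) F3 has constant coefficients. *)
Let F3_half (e : R) : e != 0 -> exists c, forall s,
  F3 (e * expR s) = c * (expR s ^+ 2)%:C * cexp (- iC * w * (e * expR s)%:C).
Proof.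
move=> e0.
pose W s := cexp (iC * w * (e * expR s)%:C) * F3 (e * expR s) * cexp ((- 2 * s)%:C).
have dW s : has_cderive W s 0.
  have de : is_derive s 1 (fun s => e * expR s) (e * expR s).
    exact: (is_deriveZ e (is_derive_expR s)).
  have d2 : is_derive s 1 (fun s : R => - 2 * s) (- 2).
    by apply: (is_derive_eq (is_deriveZ (- 2 : R) (is_derive_id s 1))); rewrite /GRing.scale/= mulr1.
  have h1 : has_cderive (fun s => iC * w * (e * expR s)%:C) s (iC * w * (e * expR s)%:C).
    apply: has_cderive_eq.
      by apply: has_cderiveM; [exact: has_cderive_cst|exact: has_cderive_real de].
    by rewrite mul0r add0r.
  have x0 : e * expR s != 0 by rewrite mulf_neq0// gt_eqF// expR_gt0.
  have xc : (e * expR s)%:C != 0 by rewrite -(rmorph0 (real_complex R)) (inj_eq (@complexI _)).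
  apply: has_cderive_eq.
    apply: has_cderiveM; last exact: has_cderive_cexp (has_cderive_real d2).
    apply: has_cderiveM; first exact: has_cderive_cexp h1.
    exact: has_cderive_comp (dF3 _) de.
  rewrite F2E// rmorphN/= (_ : 2%:C = 2)//; last by rewrite -[2]/(2%:R) rmorph_nat.
  move: (e * expR s)%:C (F3 _) (cexp ((-2 * s)%:C)) xc => X b c xc; move: (cexp _) => a.
  have -> : - iC * (2 * iC * b / X + w * b) * X = - (iC * iC) * 2 * b - iC * w * b * X.
    by field.
  by rewrite iC2; ring.
exists (W 0) => s; rewrite (has_cderive0_cst dW 0 s) /W.
have h1 : cexp ((-2 * s)%:C) * (expR s ^+ 2)%:C = 1.
  apply: eq_ReIm; rewrite ?cReM ?cImM /cexp /= cos0 sin0; last by ring.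
  rewrite !mulr1 !mulr0 !subr0 expr2 -!expRD.
  by rewrite (_ : _ + _ = 0) ?expR0//; ring.
have h2 : cexp (iC * w * (e * expR s)%:C) * cexp (- iC * w * (e * expR s)%:C) = 1.
  by rewrite -cexpD (_ : _ + _ = 0) ?cexp0//; ring.
set A := cexp _ in h2 *; set B := cexp _ in h2 *; set C := cexp _ in h1 *.
set D := (_ ^+ 2)%:C in h1 *.
have -> : A * F3 (e * expR s) * C * D * B = (A * B) * (C * D) * F3 (e * expR s) by ring.
by rewrite h1 h2; ring.
Qed.

(** For negative [xi] the exponential in [F3_half] has modulus at least 1 because Im w < 0, so the
    factor [expR s ^+ 2] contradicts the boundedness of [F3] unless [c = 0]. *)
Let F3_neg xi : xi < 0 -> F3 xi = 0.
Proof.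
have [|c hc] := @F3_half (-1); first by rewrite oppr_eq0 oner_eq0.
have [K hK] := fourier_L1_bounded dq3.
have c0 : normc c = 0.
  apply: (@exp_growth_eq0 _ 2 K 0) => // [|s s0]; first exact: normc_ge0.
  rewrite mul0r addr0; apply: le_trans (hK (-1 * expR s)).
  rewrite -/(F3 _) hc (normcM (c * _)) normc_wexp (normcM c) -mulrA ler_wpM2l ?normc_ge0//.
  rewrite normc_real ger0_norm ?exprn_ge0 ?expR_ge0//.
  rewrite -[leLHS]mulr1 (_ : expR (2 * s) = expR s ^+ 2); last first.
    by rewrite expr2 -expRD; congr expR; ring.
  rewrite ler_wpM2l ?exprn_ge0 ?expR_ge0// -[leLHS]expR0 ler_expR mulN1r mulrN -mulNr.
  by rewrite mulr_ge0 ?expR_ge0// oppr_ge0 ltW.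
move=> xi0; have := hc (ln (- xi)).
rewrite lnK ?posrE ?oppr_gt0// mulN1r opprK => ->.
by rewrite (ComplexField.Normc.eq0_normc c0) !mul0r.
Qed.

Let F2_neg xi : xi < 0 -> F2 xi = 0.
Proof. by move=> x0; rewrite F2E ?lt_eqF// F3_neg// mulr0 mul0r. Qed.

Let F2_pos : exists c, forall xi, 0 < xi -> F2 xi = c * xi%:C * cexp (- iC * w * xi%:C).
Proof.
have [|c hc] := @F3_half 1; first by rewrite oner_eq0.
exists (2 * iC * c) => xi xi0; have := hc (ln xi); rewrite lnK ?posrE// mul1r => h.
rewrite F2E ?gt_eqF// h rmorphXn/=.
have xc : xi%:C != 0 by rewrite -(rmorph0 (real_complex R)) (inj_eq (@complexI _)) gt_eqF.
by field.
Qed.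

(** Integrating factor for [dF]: the derivative of [h] involves [F2] only, which is known on each
    open half line. *)
Let h xi := cexp (iC * z * xi%:C) * F xi.
Let dh xi : has_cderive h xi (- iC * cexp (iC * z * xi%:C) * F2 xi).
Proof.
apply: has_cderive_eq.
  apply: has_cderiveM; last exact: dF.
  apply: has_cderive_cexp; apply: has_cderiveM; first exact: has_cderive_cst.
  exact: has_cderive_id.
by rewrite mul0r add0r mulr1; ring.
Qed.

Let dsq (e t : R) : is_derive t 1 (fun u : R => e * u ^+ 2) (e * (2 * t)).
Proof.
under eq_fun do rewrite expr2.
apply: (is_derive_eq (is_deriveZ e (is_deriveM (is_derive_id t 1) (is_derive_id t 1)))).
by rewrite /GRing.scale/=; ring.
Qed.

Let hK xi : F xi = cexp (- iC * z * xi%:C) * h xi.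
Proof.
rewrite /h mulrA -cexpD (_ : _ + _ = 0) ?cexp0 ?mul1r//; ring.
Qed.

Lemma fourier_pole_prod_neg xi : xi <= 0 ->
  fourier_L1 pole_prod xi = cexp (- iC * z * xi%:C) * fourier_L1 pole_prod 0.
Proof.
move=> xi0; rewrite -/F hK; congr (_ * _).
(* The substitution xi = - u^2 covers the closed half line by the whole line, where
   [has_cderive0_cst] applies; at u = 0 the inner derivative vanishes. *)
pose k (u : R) := h (-1 * u ^+ 2).
have dk u : has_cderive k u 0.
  apply: has_cderive_eq; first exact: has_cderive_comp (dh _) (dsq (-1) u).
  have [->|u0] := eqVneq u 0; first by rewrite !mulr0.
  by rewrite F2_neg ?mulr0 ?mul0r// mulN1r oppr_lt0 exprn_even_gt0.
have := has_cderive0_cst dk (Num.sqrt (- xi)) 0.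
rewrite /k sqr_sqrtr ?oppr_ge0// mulrNN mul1r expr0n mulr0 => ->.
by rewrite /h mulr0 cexp0 mul1r.
Qed.

Let kap := iC * (z - w).
Let kap0 : kap != 0. Proof. by rewrite mulf_neq0// iC_neq0. Qed.

(** Integrating [dF] from 0 leaves a multiple [C0] of exp (- i z xi), which grows for positive [xi]
    since Im z > 0. Boundedness of the transform forces [C0 = 0], and this expresses the remaining
    constant by the value at 0. *)
Lemma fourier_pole_prod_pos xi : 0 <= xi ->
  fourier_L1 pole_prod xi =
  (1 - iC * (z - w) * xi%:C) * cexp (- iC * w * xi%:C) * fourier_L1 pole_prod 0.
Proof.
move=> xi0; have [c hc] := F2_pos.
pose c' := - iC * c.
(* A primitive of c' u exp (kap u), the derivative of [h] at positive arguments. *)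
pose g (u : R) := c' * (u%:C / kap - (kap ^+ 2)^-1) * cexp (kap * u%:C).
have dg u : has_cderive g u (c' * u%:C * cexp (kap * u%:C)).
  apply: has_cderive_eq.
    apply: has_cderiveM.
      apply: has_cderiveM; first exact: has_cderive_cst.
      apply: has_cderiveB; last exact: has_cderive_cst.
      by apply: has_cderiveM; [exact: has_cderive_id|exact: has_cderive_cst].
    apply: has_cderive_cexp; apply: has_cderiveM; first exact: has_cderive_cst.
    exact: has_cderive_id.
  by rewrite !mul0r !add0r mulr0 addr0 subr0 mul1r mulr1; field; rewrite kap0.
pose k (u : R) := h (1 * u ^+ 2) - g (1 * u ^+ 2).
have dk : forall u, has_cderive k u 0.
  move=> u; apply: has_cderive_eq.
    apply: has_cderiveB.
      exact: has_cderive_comp (dh _) (dsq 1 u).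
    exact: has_cderive_comp (dg _) (dsq 1 u).
  have [->|u0] := eqVneq u 0; first by rewrite !mulr0 subr0.
  have p : 0 < 1 * u ^+ 2 by rewrite mul1r exprn_even_gt0.
  rewrite hc// /c' -mulrBl; apply/eqP; rewrite mulf_eq0; apply/orP; left; apply/eqP.
  have -> : kap * (1 * u ^+ 2)%:C = iC * z * (1 * u ^+ 2)%:C + - iC * w * (1 * u ^+ 2)%:C.
    by rewrite /kap; ring.
  by rewrite cexpD; ring.
have kE u : 0 <= u -> h u = g u + (F 0 + c' / kap ^+ 2).
  move=> u0; have := has_cderive0_cst dk (Num.sqrt u) 0.
  rewrite /k sqr_sqrtr// mul1r expr0n mulr0 => /eqP; rewrite subr_eq => /eqP ->.
  by rewrite /h /g !mulr0 cexp0 !mul1r mul0r sub0r; ring.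
pose C0 := F 0 + c' / kap ^+ 2.
have [K hK'] := fourier_L1_bounded dp.
have FE u : 0 <= u -> F u = cexp (- iC * z * u%:C) * C0 +
    c' * (u%:C / kap - (kap ^+ 2)^-1) * cexp (- iC * w * u%:C).
  move=> u0; rewrite hK kE// -/C0 mulrDr addrC; congr (_ + _).
  have -> : cexp (- iC * w * u%:C) = cexp (- iC * z * u%:C) * cexp (kap * u%:C).
    by rewrite -cexpD; congr cexp; rewrite /kap; ring.
  by rewrite /g; ring.
have C00 : C0 = 0.
  apply: ComplexField.Normc.eq0_normc.
  apply: (@exp_growth_eq0 _ (Im z) (K + normc c' * normc (kap ^+ 2)^-1)
    (normc c' * normc kap^-1)) => //; first exact: normc_ge0.
  move=> u u0.
  have -> : normc C0 * expR (Im z * u) = normc (cexp (- iC * z * u%:C) * C0).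
    rewrite normcM normc_cexp mulrC; congr (expR _ * _).
    by rewrite Re_Mreal mulNr cReN Re_iM opprK.
  have -> : cexp (- iC * z * u%:C) * C0 =
     F u - c' * (u%:C / kap - (kap ^+ 2)^-1) * cexp (- iC * w * u%:C).
    by rewrite FE//; ring.
  apply: le_trans (normcD _ _) _; rewrite normcN' -addrA; apply: lerD; first exact: hK'.
  rewrite (normcM (c' * _)) normc_wexp (normcM c').
  have e1 : expR (Im w * u) <= 1.
    by rewrite -expR0 ler_expR mulr_le0_ge0// ltW.
  apply: (@le_trans _ _ (normc c' * normc (u%:C / kap - (kap ^+ 2)^-1))).
    by rewrite ler_piMr// mulr_ge0 ?normc_ge0.
  rewrite -mulrA -mulrDr ler_wpM2l ?normc_ge0//.
  apply: le_trans (normcD _ _) _; rewrite normcN' addrC lerD2l normcM normc_real.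
  by rewrite ger0_norm// mulrC.
rewrite -/F FE// C00 mulr0 add0r.
have -> : F 0 = - c' / kap ^+ 2.
  by move/eqP: C00; rewrite addr_eq0 mulNr => /eqP.
by rewrite -/kap; field; rewrite kap0.
Qed.

(** In the primitive [P] the arguments of y - z and y - w turn in opposite senses along the real
    line, and their difference contributes 2 pi i. *)
Lemma fourier_pole_prod0 :
  fourier_L1 pole_prod 0 = (pi *+ 2)%:C * iC / (z - w) ^+ 2.
Proof.
rewrite fourier_L1E.
have -> : (fun x => pole_prod x * fker 0 x) = pole_prod.
  by apply/funext => x; rewrite /fker mulr0 mulr0 cexp0 mulr1.
pose P x := ((z - w) ^+ 2)^-1 * (clog z x - clog w x) + (z - w)^-1 * pole w x.
have lim (s : R) (Fi : set_system R) (FF : Filter Fi) : 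
    ((ln ((y - Re z) ^+ 2 + Im z ^+ 2) - ln ((y - Re w) ^+ 2 + Im w ^+ 2)) @[y --> Fi] --> 0) ->
    (atan ((y - Re z) / Im z) @[y --> Fi] --> s) ->
    (atan ((y - Re w) / - Im w) @[y --> Fi] --> s) ->
    ccvg Fi (pole w) 0 ->
    ccvg Fi P (((z - w) ^+ 2)^-1 * (0 +i* (s + s)) + (z - w)^-1 * 0).
  move=> h1 h2 h3 h4; apply: ccvgD; last by apply: ccvgM => //; exact: ccvg_cst.
  apply: ccvgM; first exact: ccvg_cst.
  split => /=.
    rewrite -[X in _ --> X](mul0r 2^-1); under eq_fun do rewrite -mulrBl.
    by apply: cvgM => //; exact: cvg_cst.
  rewrite -[s in X in _ --> _ + X]opprK; apply: cvgB => //.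
  under eq_fun => y do rewrite -[_ / _]opprK -mulrN -invrN atanN.
  exact: cvgN.
have w0' : 0 < - Im w by rewrite oppr_gt0.
have [l1 l2] := cvg_lnB_infty (Re z) (Im z) (Re w) (Im w).
have [a1 a2] := ccvg_atan_infty (Re z) z0.
have [b1 b2] := ccvg_atan_infty (Re w) w0'.
have [p1 p2] := ccvg_pole_infty wn.
rewrite (@cintegral_FTC _ P pole_prod _ _ _ dp (lim _ _ _ l2 a2 b2 p2) (lim _ _ _ l1 a1 b1 p1)).
  rewrite !mulr0 !addr0 -mulrBr mulrC; congr (_ / _).
  by apply: eq_ReIm; rewrite ?cReM ?cImM !(cReD, cImD, cReN, cImN) /= ?mulr2n; field.
move=> x; apply: has_cderive_eq.
  apply: has_cderiveD; apply: has_cderiveM; try exact: has_cderive_cst.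
    by apply: has_cderiveB; exact: has_cderive_clog.
  exact: has_cderive_pole.
have := sub_nonreal_neq0 x zn; have := sub_nonreal_neq0 x wn => xw xz.
by rewrite /pole_prod /pole; field; rewrite xw xz zw.
Qed.

End PoleTransform.

(** * The homogeneous Sobolev seminorm of sums of poles *)

Section HalfSobolev.
Context {R : realType}.
Local Notation mu := (@lebesgue_measure R).
Local Notation iC := (0 +i* 1 : R[i]).

Definition cmeasurable (f : R -> R[i]) : Prop :=
  measurable_fun setT (fun x => Re (f x)) /\ measurable_fun setT (fun x => Im (f x)).

Lemma ccontinuous_measurable f : ccontinuous f -> cmeasurable f.
Proof. by move=> [c1 c2]; split; exact: continuous_measurable_fun. Qed.

Lemma cmeasurableB f g : cmeasurable f -> cmeasurable g -> cmeasurable (fun x => f x - g x).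
Proof.
move=> [f1 f2] [g1 g2]; split.
  by under eq_fun do rewrite cReD cReN; exact: measurable_funB.
by under eq_fun do rewrite cImD cImN; exact: measurable_funB.
Qed.

Lemma measurable_csqnorm f : cmeasurable f -> measurable_fun setT (fun x => csqnorm (f x)).
Proof.
by move=> [f1 f2]; rewrite /csqnorm; apply: measurable_funD; exact: measurable_funX.
Qed.

Lemma csqnorm_ge0 (z : R[i]) : 0 <= csqnorm z.
Proof. by rewrite csqnormE sqr_ge0. Qed.

Lemma inL2_bound f C : cmeasurable f ->
  (forall x, csqnorm (f x) <= C / (1 + x ^+ 2)) -> inL2 f.
Proof.
move=> mf fC; have [m1 m2] := mf; split => //.
have mc := measurable_csqnorm mf.
have : mu.-integrable setT (EFin \o (fun x => csqnorm (f x))).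
  apply: (@integrable_oneDsqrV_bound _ _ C) => // y.
  by rewrite ger0_norm ?csqnorm_ge0.
move=> /integrableP[_]; apply: le_lt_trans.
rewrite le_eqVlt; apply/orP; left; apply/eqP; apply: eq_integral => x _ /=.
by rewrite ger0_norm ?csqnorm_ge0.
Qed.

(** Dominated convergence: the majorant is uniform in [n], while the constant in the pointwise rate
    may depend on the point. *)
Lemma L2sqnorm_cvg0 (h : nat -> R -> R[i]) C : (forall n, cmeasurable (h n)) ->
  (forall n x, csqnorm (h n x) <= C / (1 + x ^+ 2)) ->
  (forall x, exists K, forall n, csqnorm (h n x) <= K / n.+1%:R) ->
  L2sqnorm (h n) @[n --> \oo] --> 0%E.
Proof.
move=> mh hC hK.
pose f n : R -> \bar R := EFin \o (fun x => csqnorm (h n x)).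
have mf n : measurable_fun setT (f n) by apply/measurable_EFinP; exact: measurable_csqnorm.
pose G : R -> \bar R := EFin \o (fun x : R => `|C| / (1 + x ^+ 2)).
have iG : mu.-integrable setT G.
  rewrite (_ : G = (fun x : R => `|C|%:E * ((1 + x ^+ 2)^-1)%:E)%E)//.
  exact/integrableZl/integrable_oneDsqrV.
have hG n x : (`|f n x| <= G x)%E.
  rewrite /f /G /= lee_fin ger0_norm ?csqnorm_ge0//; apply: le_trans (hC n x) _.
  by rewrite ler_wpM2r ?ler_norm// invr_ge0 addr_ge0// sqr_ge0.
have f0 x : f n x @[n --> \oo] --> 0%E.
  have [K hKx] := hK x.
  apply: cvg_EFin; first exact: nearW.
  have h0 : K / n.+1%:R @[n --> \oo] --> (0 : R).
    by rewrite -[X in _ --> X](mulr0 K); apply: cvgM; [exact: cvg_cst|exact: cvg_harmonic].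
  apply: (squeeze_cvgr _ (cvg_cst 0) h0).
  by apply: nearW => n; rewrite csqnorm_ge0 hKx.
have [_ _] : [/\ mu.-integrable setT (cst 0 : R -> \bar R),
    [sequence \int[mu]_(y in setT) `|f n y - 0|]_n @ \oo --> 0 &
    [sequence \int[mu]_(y in setT) f n y]_n @ \oo --> \int[mu]_(y in setT) (cst 0 y : \bar R)]%E.
  apply: (@dominated_convergence _ _ _ mu setT measurableT f (cst 0%E) G mf).
  - exact: measurable_cst.
  - by apply: aeW => x _; exact: f0.
  - exact: iG.
  - by apply: aeW => x n _; exact: hG.
by rewrite integral0.
Qed.

(** The auxiliary pole w: the factor ((z - w) / (x - w))^2 tends to 1 pointwise and makes a simple
    pole at z integrable. *)
Definition lowpole n : R[i] := 0 -i* n.+1%:R.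

Lemma Im_lowpole n : Im (lowpole n) = - n.+1%:R. Proof. by []. Qed.

Lemma Im_lowpole_lt0 n : Im (lowpole n) < 0. Proof. by rewrite /= oppr_lt0. Qed.

Lemma normc_lowpole_sub z n : normc (z - lowpole n) <= (normc z + 1) * n.+1%:R.
Proof.
apply: le_trans (normcD _ _) _; rewrite normcN' mulrDl mul1r.
have -> : normc (lowpole n) = n.+1%:R.
  by rewrite /= expr0n add0r sqrtr_sqr normrN ger0_norm.
by rewrite lerD2r ler_peMr ?normc_ge0// ler1n.
Qed.

(** The error has no pole at [z], so it is controlled by the distant pole [w] alone. *)
Lemma pole_prod_sub (z w : R[i]) x : Im z != 0 -> Im w != 0 ->
  (z - w) ^+ 2 * pole_prod z w x - pole z x = - (pole w x + (z - w) * pole w x ^+ 2).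
Proof.
move=> z0 w0; have h1 := sub_nonreal_neq0 x z0; have h2 := sub_nonreal_neq0 x w0.
by rewrite /pole_prod /pole; field; rewrite h1 h2.
Qed.

Lemma normc_sum_le (I : finType) (f : I -> R[i]) (g : I -> R) :
  (forall i, normc (f i) <= g i) -> normc (\sum_i f i) <= \sum_i g i.
Proof.
move=> fg; elim/big_ind2: _ => //; first by rewrite ComplexField.Normc.normc0.
by move=> a b c d h1 h2; apply: le_trans (normcD _ _) _; exact: lerD.
Qed.

Lemma expR_bound4 (u : R) : 0 <= u -> expR (- u) <= 4 / (1 + u ^+ 2).
Proof.
move=> u0; rewrite ler_pdivlMr ?ltr_pwDl ?sqr_ge0// mulrC expRN ler_pdivrMr ?expR_gt0//.
have h : (1 + u / 2) ^+ 2 <= expR u.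
  have -> : expR u = expR (u / 2) ^+ 2 by rewrite expr2 -expRD; congr expR; field.
  have p : 0 <= 1 + u / 2 by rewrite addr_ge0// divr_ge0.
  by apply: lerXn2r; [|rewrite nnegrE expR_ge0|exact: expR_ge1Dx].
apply: le_trans (_ : 4 * (1 + u / 2) ^+ 2 <= _); last by rewrite ler_wpM2l.
by have -> : 4 * (1 + u / 2) ^+ 2 = 4 + 4 * u + u ^+ 2 by [field]; lra.
Qed.

Lemma pi2_ge0 : 0 <= pi *+ 2 :> R.
Proof. exact/mulrn_wge0/pi_ge0. Qed.

Section PoleSum.
Variables (I : finType) (c z : I -> R[i]).
Hypothesis z0 : forall i, 0 < Im (z i).
Let zn i : Im (z i) != 0. Proof. by rewrite gt_eqF. Qed.

(** The value predicted by the residue theorem: for negative [xi] the kernel exp (- i x xi) decays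
    in the upper half plane, where all the poles lie, and for positive [xi] in the lower one, where
    there are none. *)
Definition pole_sum_hat (xi : R) : R[i] :=
  if xi <= 0 then \sum_i c i * ((pi *+ 2)%:C * iC) * cexp (- iC * z i * xi%:C) else 0.

Let fn n x := \sum_i (c i * (z i - lowpole n) ^+ 2) * pole_prod (z i) (lowpole n) x.

Let wn n : Im (lowpole n) != 0. Proof. by rewrite lt_eqF// Im_lowpole_lt0. Qed.

Let decays_fn n : decays (fn n).
Proof.
apply: decays_sum => i _; apply: decaysZ.
exact: (decays_pole_prod (z0 i) (Im_lowpole_lt0 n)).
Qed.

Let fn_hat n xi : fourier_L1 (fn n) xi = \sum_i (c i * (z i - lowpole n) ^+ 2) *
  fourier_L1 (pole_prod (z i) (lowpole n)) xi.
Proof.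
rewrite fourier_L1_sum => [|i].
  apply: eq_bigr => i _; rewrite fourier_L1Z//.
  exact: (decays_pole_prod (z0 i) (Im_lowpole_lt0 n)).
by apply: decaysZ; exact: (decays_pole_prod (z0 i) (Im_lowpole_lt0 n)).
Qed.

Lemma ccontinuous_sum (J : Type) (r : seq J) (f : J -> R -> R[i]) :
  (forall j, ccontinuous (f j)) -> ccontinuous (fun x => \sum_(j <- r) f j x).
Proof.
move=> h; elim: r => [|i r ih].
  by under eq_fun do rewrite big_nil; exact: ccontinuous_cst.
by under eq_fun do rewrite big_cons; exact: ccontinuousD.
Qed.

Let ccontinuous_fn_hat n : ccontinuous (fourier_L1 (fn n)).
Proof.
rewrite (funext (fn_hat n)); apply: ccontinuous_sum => i.
apply: ccontinuousM; first exact: ccontinuous_cst.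
exact: (ccontinuous_fourier_pole_prod (z0 i) (Im_lowpole_lt0 n)).
Qed.

Lemma cmeasurable_pole_sum_hat : cmeasurable pole_sum_hat.
Proof.
pose g (xi : R) := \sum_i c i * ((pi *+ 2)%:C * iC) * cexp (- iC * z i * xi%:C).
have [g1 g2] : cmeasurable g.
  apply: ccontinuous_measurable; apply: ccontinuous_sum => i.
  apply: ccontinuousM; first exact: ccontinuous_cst.
  apply: has_cderive_continuous => x; apply: has_cderive_cexp.
  by apply: has_cderiveM; [exact: has_cderive_cst|exact: has_cderive_id].
have ml : measurable_fun setT (fun x : R => x <= 0) by exact: measurable_fun_ler.
split.
  rewrite (_ : (fun x => _) = (fun x => if x <= 0 then Re (g x) else 0)); last first.
    by apply/funext => x; rewrite /pole_sum_hat; case: ifP.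
  exact: measurable_fun_ifT.
rewrite (_ : (fun x => _) = (fun x => if x <= 0 then Im (g x) else 0)); last first.
  by apply/funext => x; rewrite /pole_sum_hat; case: ifP.
exact: measurable_fun_ifT.
Qed.

Let normc_zexp i (xi : R) : normc (cexp (- iC * z i * xi%:C)) = expR (Im (z i) * xi).
Proof.
rewrite normc_cexp; congr expR.
by rewrite Re_Mreal mulNr cReN Re_iM opprK.
Qed.

Let normc_2pi : normc ((pi *+ 2)%:C * iC : R[i]) = pi *+ 2.
Proof.
rewrite normcM normc_real ger0_norm ?pi2_ge0//.
by rewrite [normc iC]/= expr0n expr1n add0r sqrtr1 mulr1.
Qed.

Lemma ccontinuous_poles : ccontinuous (fun x => \sum_i c i * pole (z i) x).
Proof.
apply: ccontinuous_sum => i.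
by apply: ccontinuousM; [exact: ccontinuous_cst|exact: ccontinuous_pole].
Qed.

Lemma inL2_poles : inL2 (fun x => \sum_i c i * pole (z i) x).
Proof.
have [C hC] := choice (fun i => csqnorm_pole_le (zn i)).
have C0 i : 0 <= C i.
  by have := le_trans (sqr_ge0 _) (hC i 0); rewrite expr0n addr0 divr1.
pose D := \sum_i normc (c i) * Num.sqrt (C i).
apply: (@inL2_bound _ (D ^+ 2)); first exact: ccontinuous_measurable ccontinuous_poles.
move=> x; have x0 : 0 <= (1 + x ^+ 2)^-1 by rewrite invr_ge0 addr_ge0// sqr_ge0.
rewrite csqnormE -[X in _ / X]sqr_sqrtr ?addr_ge0 ?sqr_ge0// -expr_div_n.
apply: lerXn2r; rewrite ?nnegrE ?normc_ge0//.
  by rewrite divr_ge0 ?sqrtr_ge0// sumr_ge0// => i _; rewrite mulr_ge0 ?normc_ge0 ?sqrtr_ge0.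
rewrite mulr_suml; apply: normc_sum_le => i.
rewrite normcM -mulrA ler_wpM2l ?normc_ge0//.
rewrite -sqrtrV ?addr_ge0 ?sqr_ge0// -sqrtrM// -[leLHS]ger0_norm ?normc_ge0// -sqrtr_sqr.
by rewrite ler_sqrt ?hC// mulr_ge0.
Qed.

Lemma inL2_pole_sum_hat : inL2 pole_sum_hat.
Proof.
pose D := \sum_i normc (c i) * (pi *+ 2).
have [b b0 hb] : exists2 b, 0 < b & forall i, b <= Im (z i).
  pose b := \big[Num.min/1]_i Im (z i).
  exists b; first by rewrite /b; elim/big_ind: _ => // u v; rewrite lt_min => -> ->.
  by move=> i; rewrite /b (bigD1 i)//= ge_min lexx.
have D0 : 0 <= D.
  by rewrite /D sumr_ge0// => i _; rewrite mulr_ge0 ?normc_ge0 ?pi2_ge0.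
(* Then m^2 (1 + x^2) <= 1 + (2 b x)^2, which converts [expR_bound4] at 2 b |x| into a bound by 1 /
   (1 + x^2). *)
pose m := Num.min 1 (2 * b).
have m0 : 0 < m by rewrite /m lt_min ltr01 mulr_gt0.
apply: (@inL2_bound _ (4 * D ^+ 2 / m ^+ 2)); first exact: cmeasurable_pole_sum_hat.
move=> x; rewrite /pole_sum_hat; case: ifPn => [x0|_]; last first.
  rewrite csqnormE ComplexField.Normc.normc0 expr0n mulr_ge0// ?invr_ge0 ?addr_ge0 ?sqr_ge0//.
  by rewrite divr_ge0 ?sqr_ge0// mulr_ge0// sqr_ge0.
have h1 : normc (\sum_i c i * ((pi *+ 2)%:C * iC) * cexp (- iC * z i * x%:C)) <= D * expR (b * x).
  rewrite mulr_suml; apply: normc_sum_le => i.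
  rewrite (normcM (c i * _)) normc_zexp (normcM (c i)) normc_2pi.
  rewrite ler_wpM2l// ?mulr_ge0 ?normc_ge0 ?pi2_ge0//.
  by rewrite ler_expR ler_wnM2r.
rewrite csqnormE; apply: le_trans (_ : (D * expR (b * x)) ^+ 2 <= _).
  by apply: lerXn2r; rewrite ?nnegrE ?normc_ge0// mulr_ge0 ?expR_ge0.
rewrite exprMn (_ : expR (b * x) ^+ 2 = expR (- (2 * b * - x))); last first.
  by rewrite expr2 -expRD; congr expR; ring.
have u0 : 0 <= 2 * b * - x by rewrite mulr_ge0 ?oppr_ge0// mulr_ge0// ltW.
have q0 : 0 < 1 + x ^+ 2 by rewrite ltr_pwDl ?sqr_ge0.
rewrite (_ : 4 * D ^+ 2 / m ^+ 2 / (1 + x ^+ 2) = D ^+ 2 * (4 / (m ^+ 2 * (1 + x ^+ 2)))); last first.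
  by field; rewrite gt_eqF//= gt_eqF.
rewrite ler_wpM2l ?sqr_ge0//; apply: le_trans (expR_bound4 u0) _.
rewrite ler_wpM2l// lef_pV2 ?posrE ?mulr_gt0 ?exprn_gt0 ?ltr_pwDl ?sqr_ge0//.
rewrite mulrDr mulr1 lerD//.
  by rewrite expr_le1 ?(ltW m0)// /m ge_min lexx.
rewrite exprMn sqrrN ler_wpM2r ?sqr_ge0//; apply: lerXn2r; rewrite ?nnegrE ?(ltW m0)//.
  by rewrite mulr_ge0// ltW.
by rewrite /m ge_min lexx orbT.
Qed.

(** The transforms of the approximants [fn n] agree exactly with [pole_sum_hat] for xi <= 0. For xi
    > 0 they are bounded by a constant times (1 + k xi) exp (- k xi) with k = n + 1, which tends to
    0 in L^2. *)
Lemma is_fourier_poles : is_fourier (fun x => \sum_i c i * pole (z i) x) pole_sum_hat.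
Proof.
split; [exact: inL2_poles|exact: inL2_pole_sum_hat|exists fn].
pose D := \sum_i normc (c i) * (normc (z i) + 2).
have D0 : 0 <= D.
  by rewrite /D sumr_ge0// => i _; rewrite mulr_ge0 ?addr_ge0 ?normc_ge0.
split=> [n||].
- split; first exact: decays_cintegrable.
  have [cf [C fC]] := decays_fn n.
  apply: (@inL2_bound _ (C ^+ 2)); first exact: ccontinuous_measurable.
  move=> x; rewrite csqnormE; apply: le_trans (_ : (C / (1 + x ^+ 2)) ^+ 2 <= _).
    apply: lerXn2r; rewrite ?nnegrE ?normc_ge0//.
    exact: le_trans (normc_ge0 _) (fC x).
  have q : 1 <= 1 + x ^+ 2 by rewrite lerDl sqr_ge0.
  rewrite expr_div_n ler_wpM2l ?sqr_ge0// lef_pV2 ?posrE ?exprn_gt0 ?(lt_le_trans ltr01)//.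
  by rewrite expr2 ler_peMr// (le_trans ler01).
- have diff n x : normc (fn n x - \sum_i c i * pole (z i) x) <= D * normc (pole (lowpole n) x).
    rewrite /fn -sumrB mulr_suml; apply: normc_sum_le => i.
    rewrite -mulrA -mulrBr pole_prod_sub// normcM normcN' -mulrA ler_wpM2l ?normc_ge0//.
    apply: le_trans (normcD _ _) _.
    have -> : (normc (z i) + 2) * normc (pole (lowpole n) x) =
      normc (pole (lowpole n) x) + (normc (z i) + 1) * normc (pole (lowpole n) x) by ring.
    rewrite lerD2l expr2 mulrA normcM ler_wpM2r ?normc_ge0// normcM.
    apply: le_trans (_ : ((normc (z i) + 1) * n.+1%:R) * n.+1%:R^-1 <= _); last by rewrite mulfK.
    rewrite ler_pM ?normc_ge0 ?normc_lowpole_sub//.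
    by apply: le_trans (pole_bounded x (wn n)) _; rewrite Im_lowpole normrN ger0_norm.
  have diff2 n x : csqnorm (fn n x - \sum_i c i * pole (z i) x) <= D ^+ 2 / (n.+1%:R ^+ 2 + x ^+ 2).
    rewrite csqnormE; apply: le_trans (_ : (D * normc (pole (lowpole n) x)) ^+ 2 <= _).
      by apply: lerXn2r; rewrite ?nnegrE ?normc_ge0 ?mulr_ge0 ?normc_ge0.
    by rewrite exprMn csqnorm_pole Im_lowpole sqrrN subr0 addrC.
  have n1 n : 1 <= n.+1%:R :> R by rewrite ler1n.
  have n2 n : 1 <= n.+1%:R ^+ 2 :> R by rewrite exprn_ege1.
  apply: (@L2sqnorm_cvg0 _ (D ^+ 2)) => [n|n x|x].
  + apply: ccontinuous_measurable; apply: ccontinuousD; first by case: (decays_fn n).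
    have [k1 k2] := ccontinuous_poles.
    split => x.
      by under eq_fun do rewrite cReN; apply: cvgN; exact: k1.
    by under eq_fun do rewrite cImN; apply: cvgN; exact: k2.
  + apply: le_trans (diff2 n x) _; rewrite ler_wpM2l ?sqr_ge0// lef_pV2 ?posrE ?lerD2r//.
      by rewrite ltr_pwDl ?sqr_ge0// exprn_gt0.
    by rewrite ltr_pwDl ?sqr_ge0.
  + exists (D ^+ 2) => n; apply: le_trans (diff2 n x) _.
    rewrite ler_wpM2l ?sqr_ge0// lef_pV2 ?posrE//; last first.
      by rewrite ltr_pwDl ?sqr_ge0// exprn_gt0.
    by rewrite ler_wpDr ?sqr_ge0// expr2 ler_peMr.
- pose D2 := \sum_i normc (c i) * (pi *+ 2) * (normc (z i) + 1).
  have D20 : 0 <= D2.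
    rewrite /D2 sumr_ge0// => i _.
    apply: mulr_ge0; last by rewrite addr_ge0 ?normc_ge0.
    by rewrite mulr_ge0 ?normc_ge0 ?pi2_ge0.
  have zw n i : z i - lowpole n != 0.
    rewrite subr_eq0; apply/eqP => e; have := z0 i; rewrite e Im_lowpole.
    by rewrite oppr_gt0 ltNge ler0n.
  have diff0 n xi : xi <= 0 -> fourier_L1 (fn n) xi - pole_sum_hat xi = 0.
    move=> x0; rewrite fn_hat /pole_sum_hat x0 -sumrB big1// => i _.
    rewrite (fourier_pole_prod_neg (z0 i) (Im_lowpole_lt0 n) x0).
    rewrite (fourier_pole_prod0 (z0 i) (Im_lowpole_lt0 n)).
    by have := zw n i => h; field.
  have diff n xi : 0 < xi -> normc (fourier_L1 (fn n) xi - pole_sum_hat xi) <=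
      D2 * ((1 + n.+1%:R * xi) * expR (- (n.+1%:R * xi))).
    move=> x0; rewrite fn_hat /pole_sum_hat (lt_geF x0) subr0 mulr_suml.
    apply: normc_sum_le => i.
    rewrite (fourier_pole_prod_pos (z0 i) (Im_lowpole_lt0 n) (ltW x0)).
    rewrite (fourier_pole_prod0 (z0 i) (Im_lowpole_lt0 n)).
    set w := lowpole n; set e := cexp _.
    have -> : c i * (z i - w) ^+ 2 * ((1 - iC * (z i - w) * xi%:C) * e *
        ((pi *+ 2)%:C * iC / (z i - w) ^+ 2)) =
        c i * ((pi *+ 2)%:C * iC) * ((1 - iC * (z i - w) * xi%:C) * e).
      by have := zw n i => h; rewrite -/w in h; field.
    rewrite (normcM (c i * _)) (normcM (c i)) normc_2pi -[leRHS]mulrA.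
    rewrite ler_wpM2l// ?mulr_ge0 ?normc_ge0 ?pi2_ge0//.
    rewrite (normcM _ e) mulrA; apply: ler_pM; rewrite ?normc_ge0//; last first.
      rewrite /e normc_cexp ler_expR Re_Mreal mulNr cReN Re_iM opprK Im_lowpole.
      by rewrite mulNr.
    apply: le_trans (normcD _ _) _; rewrite normcN' ComplexField.Normc.normc1.
    rewrite (normcM _ xi%:C) normc_real (gtr0_norm x0) (normcM iC).
    rewrite [normc iC]/= expr0n expr1n add0r sqrtr1 mul1r.
    rewrite mulrDr mulr1 lerD//; first by rewrite lerDr normc_ge0.
    by rewrite mulrA ler_wpM2r ?(ltW x0)// normc_lowpole_sub.
  have u1 (u : R) : 0 <= u -> ((1 + u) * expR (- u)) ^+ 2 <= 4 * expR (- u).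
    move=> u0; rewrite exprMn.
    have -> : expR (- u) ^+ 2 = expR (- u) * expR (- u) by rewrite expr2.
    rewrite mulrA ler_wpM2r ?expR_ge0// expRN ler_pdivrMr ?expR_gt0//.
    have h : (1 + u / 2) ^+ 2 <= expR u.
      have -> : expR u = expR (u / 2) ^+ 2 by rewrite expr2 -expRD; congr expR; field.
      have p : 0 <= 1 + u / 2 by rewrite addr_ge0// divr_ge0.
      by apply: lerXn2r; [|rewrite nnegrE expR_ge0|exact: expR_ge1Dx].
    apply: le_trans (_ : 4 * (1 + u / 2) ^+ 2 <= _); last by rewrite ler_wpM2l.
    have -> : 4 * (1 + u / 2) ^+ 2 = 4 + 4 * u + u ^+ 2 by field.
    by rewrite sqrrD; lra.
  have diff2 n xi : csqnorm (fourier_L1 (fn n) xi - pole_sum_hat xi) <=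
      if xi <= 0 then 0 else 4 * D2 ^+ 2 * expR (- (n.+1%:R * xi)).
    case: ifPn => [x0|]; first by rewrite diff0// csqnormE ComplexField.Normc.normc0 expr0n.
    rewrite -ltNge => x0; rewrite csqnormE.
    have p : 0 <= n.+1%:R * xi by rewrite mulr_ge0// ltW.
    apply: le_trans (_ : (D2 * ((1 + n.+1%:R * xi) * expR (- (n.+1%:R * xi)))) ^+ 2 <= _).
      apply: lerXn2r; rewrite ?nnegrE ?normc_ge0 ?diff//.
      by rewrite !mulr_ge0 ?expR_ge0// addr_ge0.
    by rewrite exprMn [4 * _]mulrC -[leRHS]mulrA ler_wpM2l ?sqr_ge0// u1.
  apply: (@L2sqnorm_cvg0 _ (16 * D2 ^+ 2)) => [n|n xi|xi].
  + apply: cmeasurableB; last exact: cmeasurable_pole_sum_hat.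
    exact: ccontinuous_measurable (ccontinuous_fn_hat n).
  + apply: le_trans (diff2 n xi) _; case: ifPn => [x0|].
      by rewrite mulr_ge0 ?invr_ge0 ?addr_ge0 ?sqr_ge0// mulr_ge0 ?sqr_ge0.
    rewrite -ltNge => x0.
    have -> : 16 * D2 ^+ 2 / (1 + xi ^+ 2) = 4 * D2 ^+ 2 * (4 / (1 + xi ^+ 2)).
      by field; rewrite gt_eqF// ltr_pwDl ?sqr_ge0.
    rewrite ler_wpM2l ?mulr_ge0 ?sqr_ge0//; apply: le_trans (expR_bound4 (ltW x0)).
    by rewrite ler_expR lerN2 ler_peMl ?(ltW x0)// ler1n.
  (* At a fixed positive [xi], exp (k xi) >= k xi with k = n + 1 gives the required rate; the
     constant degenerates as [xi] tends to 0. *)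
  + exists (4 * D2 ^+ 2 / `|xi|) => n; apply: le_trans (diff2 n xi) _; case: ifPn => [x0|].
      by rewrite !mulr_ge0 ?invr_ge0 ?sqr_ge0.
    rewrite -ltNge => x0; rewrite (gtr0_norm x0) -[leRHS]mulrA ler_wpM2l ?mulr_ge0 ?sqr_ge0//.
    rewrite -invfM mulrC expRN lef_pV2 ?posrE ?expR_gt0 ?mulr_gt0//.
    by apply: le_trans (expR_ge1Dx _); rewrite mulrC lerDr.
Qed.

End PoleSum.
End HalfSobolev.

(** * Continuity of the seminorm in poles and coefficients *)

Section HhalfBound.
Context {R : realType}.
Local Notation mu := (@lebesgue_measure R).
Local Notation iC := (0 +i* 1 : R[i]).

(** Mean value theorem along the segment from [v] to [u], on which the real part stays below [b].
    The factor 2 comes from treating real and imaginary parts separately. *)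
Lemma normc_cexpB (u v : R[i]) (b : R) : Re u <= b -> Re v <= b ->
  normc (cexp u - cexp v) <= 2 * normc (u - v) * expR b.
Proof.
move=> ub vb; pose phi (s : R) := cexp (v + s%:C * (u - v)).
have dphi s : has_cderive phi s ((u - v) * phi s).
  apply: has_cderive_cexp; apply: has_cderive_eq.
    apply: has_cderiveD; first exact: has_cderive_cst.
    by apply: has_cderiveM; [exact: has_cderive_id|exact: has_cderive_cst].
  by rewrite add0r mulr0 addr0 mul1r.
have bound s : s \in `[0 : R, 1] -> normc ((u - v) * phi s) <= normc (u - v) * expR b.
  rewrite in_itv/= => /andP[s0 s1]; rewrite normcM ler_wpM2l ?normc_ge0//.
  rewrite normc_cexp ler_expR cReD cReM cReC cImC mul0r subr0 cReD cReN.
  have -> : Re v + s * (Re u - Re v) = (1 - s) * Re v + s * Re u by ring.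
  have -> : b = (1 - s) * b + s * b by ring.
  by rewrite lerD// ler_wpM2l// subr_ge0.
have [c1 c2] := has_cderive_continuous dphi.
have [s1 is1 e1] := @MVT_segment R (fun s => Re (phi s)) _ 0 1 ler01
  (fun s _ => (dphi s).1) (continuous_subspaceT c1).
have [s2 is2 e2] := @MVT_segment R (fun s => Im (phi s)) _ 0 1 ler01
  (fun s _ => (dphi s).2) (continuous_subspaceT c2).
have p1 : phi 1 = cexp u by congr cexp; ring.
have p0 : phi 0 = cexp v by congr cexp; ring.
rewrite p1 p0 subr0 mulr1 in e1; rewrite p1 p0 subr0 mulr1 in e2.
apply: le_trans (normc_le_ReIm _) _.
rewrite cReD cReN cImD cImN e1 e2 -mulrA mulr_natl mulr2n lerD//.
  by apply: le_trans (bound _ is1); exact: Re_le_normc.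
by apply: le_trans (bound _ is2); exact: Im_le_normc.
Qed.

Lemma poly_exp_bound (b : R) : 0 < b -> exists2 K, 0 <= K & forall u, 0 <= u ->
  u * ((1 + u) * expR (- (b * u))) ^+ 2 <= K / (1 + u ^+ 2).
Proof.
(* Since u (1 + u)^2 (1 + u^2) <= (1 + u)^5, the factor exp (- 2 b u) is split into five equal ones,
   each set against a single [m * (1 + u) <= expR (c * u)]. *)
move=> b0; pose c := 2 * b / 5; have c0 : 0 < c by rewrite divr_gt0// mulr_gt0.
pose m := Num.min 1 c.
have m0 : 0 < m by rewrite /m lt_min ltr01.
exists ((m ^+ 5)^-1) => [|u u0]; first by rewrite invr_ge0 exprn_ge0// ltW.
have d0 : 0 < 1 + u ^+ 2 by rewrite ltr_pwDl ?sqr_ge0.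
rewrite ler_pdivlMr//.
have e5 : expR (- (b * u)) ^+ 2 = (expR (c * u) ^+ 5)^-1.
  by rewrite -exprVn -expRN !exprS !expr0 !mulr1 -!expRD; congr expR; rewrite /c; field.
rewrite exprMn e5.
have p : (m * (1 + u)) ^+ 5 <= expR (c * u) ^+ 5.
  apply: lerXn2r; rewrite ?nnegrE ?expR_ge0 ?mulr_ge0 ?addr_ge0 ?(ltW m0)//.
  apply: le_trans (expR_ge1Dx _); rewrite mulrDr mulr1 lerD//.
    by rewrite /m ge_min lexx.
  by rewrite ler_wpM2r// /m ge_min lexx orbT.
have u1 : u * (1 + u) ^+ 2 * (1 + u ^+ 2) <= (1 + u) ^+ 5.
  have -> : (1 + u) ^+ 5 = u * (1 + u) ^+ 2 * (1 + u ^+ 2) +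
    (1 + u) ^+ 2 * (1 + 2 * u + 3 * u ^+ 2) by ring.
  rewrite lerDl mulr_ge0 ?sqr_ge0// addr_ge0 ?mulr_ge0 ?sqr_ge0// addr_ge0// mulr_ge0//.
have e0 : 0 < expR (c * u) ^+ 5 by rewrite exprn_gt0// expR_gt0.
move: (expR (c * u)) p e0 {e5} => Q p e0.
rewrite [leLHS](_ : _ = u * (1 + u) ^+ 2 * (1 + u ^+ 2) / Q ^+ 5); last first.
  by field; apply/eqP => Q0; move: e0; rewrite Q0 expr0n ltxx.
rewrite ler_pdivrMr// ler_pdivlMl ?exprn_gt0//.
apply: le_trans p; rewrite exprMn ler_wpM2l ?exprn_ge0 ?(ltW m0)//.
Qed.

Lemma Hhalf_sqnorm_ge0 (f : R -> R[i]) : (0 <= Hhalf_sqnorm f)%E.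
Proof.
apply/ereal_infP => _ [g _ <-]; apply: integral_ge0 => x _.
by rewrite lee_fin mulr_ge0// csqnorm_ge0.
Qed.

(** A Lipschitz estimate at height at least [b], with [K] depending only on [#|I|], [b] and [M]. The
    weight and the factor lost by varying the exponent in exp (- i z xi) are absorbed by the decay
    exp (- b |xi|). *)
Lemma Hhalf_sqnorm_pole_diff (I : finType) (b M : R) : 0 < b -> 0 <= M ->
  exists2 K : R, 0 <= K & forall (c z r y : I -> R[i]) (d : R),
  (forall i, [/\ b <= Im (z i), b <= Im (y i), normc (r i) <= M,
     normc (c i - r i) <= d & normc (z i - y i) <= d]) ->
  (Hhalf_sqnorm (fun x : R => \sum_i c i * pole (z i) x - \sum_i r i * pole (y i) x)%R
     <= (K * d ^+ 2)%:E)%E.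
Proof.
move=> b0 M0; have [C C0 hC] := poly_exp_bound b0.
have [K1 K1E K10] : exists2 K1 : R, K1 = (pi *+ 2 * #|I|%:R * (1 + 2 * M)) ^+ 2 & 0 <= K1.
  by eexists; [reflexivity|exact: sqr_ge0].
pose S := fine (\int[mu]_x ((1 + x ^+ 2)^-1)%:E)%E.
have SE : (\int[mu]_x ((1 + x ^+ 2)^-1)%:E)%E = S%:E.
  by rewrite /S fineK//; apply: (integrable_fin_num measurableT (@integrable_oneDsqrV R)).
exists (K1 * C * `|S|); first by rewrite !mulr_ge0.
move=> c z r y d h.
(* A difference of pole sums is one pole sum over [I + I], so its transform is explicit. *)
pose c2 (k : I + I) := match k with inl i => c i | inr i => - r i end.
pose z2 (k : I + I) := match k with inl i => z i | inr i => y i end.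
have z20 k : 0 < Im (z2 k).
  by case: k => i; have [h1 h2 _ _ _] := h i; apply: (lt_le_trans b0).
have -> : (fun x : R => \sum_i c i * pole (z i) x - \sum_i r i * pole (y i) x) =
    (fun x => \sum_k c2 k * pole (z2 k) x).
  apply/funext => x; rewrite big_sumType/= -sumrN; congr (_ + _).
  by apply: eq_bigr => i _; rewrite mulNr.
apply: (@le_trans _ _ (\int[mu]_xi (`|xi| * csqnorm (pole_sum_hat c2 z2 xi))%:E)%E).
  apply: ereal_inf_lbound; exists (pole_sum_hat c2 z2) => //.
  exact: is_fourier_poles.
have mg : measurable_fun setT (fun xi : R => `|xi| * csqnorm (pole_sum_hat c2 z2 xi)).
  apply: measurable_funM; first exact: normr_measurable.
  by apply: measurable_csqnorm; exact: cmeasurable_pole_sum_hat.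
apply: (@le_trans _ _ (\int[mu]_xi ((K1 * C * d ^+ 2)%:E * ((1 + xi ^+ 2)^-1)%:E))%E); last first.
  rewrite integralZl//; last exact: integrable_oneDsqrV.
  rewrite SE -EFinM lee_fin mulrAC ler_wpM2r ?sqr_ge0// ler_wpM2l ?ler_norm//.
  by rewrite mulr_ge0.
apply: ge0_le_integral => //.
- by move=> x _; rewrite lee_fin mulr_ge0// csqnorm_ge0.
- exact/measurable_EFinP.
- have [mi _] := integrableP _ _ _ (@integrable_oneDsqrV R).
  rewrite (_ : (fun x : R => _) = EFin \o (fun x : R => (K1 * C * d ^+ 2) * (1 + x ^+ 2)^-1))//.
  apply/measurable_EFinP; apply: measurable_funM => //; exact/measurable_EFinP.
move=> x _; rewrite -EFinM lee_fin /pole_sum_hat; case: ifPn => [x0|_]; last first.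
  rewrite csqnormE ComplexField.Normc.normc0 expr0n mulr0.
  by rewrite mulr_ge0 ?invr_ge0 ?addr_ge0 ?sqr_ge0// mulr_ge0 ?sqr_ge0// mulr_ge0.
have nx : 0 <= - x by rewrite oppr_ge0.
have re k : Re (- iC * z2 k * x%:C) = - (Im (z2 k) * - x).
  by rewrite Re_Mreal mulNr cReN Re_iM opprK mulrN opprK.
have reb k : b <= Im (z2 k) -> Re (- iC * z2 k * x%:C) <= - (b * - x).
  by move=> hb; rewrite re lerN2 ler_wpM2r.
have n2 : normc ((pi *+ 2)%:C * iC : R[i]) = pi *+ 2.
  rewrite (normcM _ iC) normc_real ger0_norm ?pi2_ge0//.
  by rewrite [normc iC]/= expr0n expr1n add0r sqrtr1 mulr1.
pose B := pi *+ 2 * (d * (1 + 2 * M)) * ((1 + - x) * expR (- (b * - x))) : R.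
have termB i : normc (c i * ((pi *+ 2)%:C * iC) * cexp (- iC * z i * x%:C) -
    r i * ((pi *+ 2)%:C * iC) * cexp (- iC * y i * x%:C)) <= B.
  have [h1 h2 h3 h4 h5] := h i.
  set u := - iC * z i * x%:C; set v := - iC * y i * x%:C.
  have -> : c i * ((pi *+ 2)%:C * iC) * cexp u - r i * ((pi *+ 2)%:C * iC) * cexp v =
    ((pi *+ 2)%:C * iC) * ((c i - r i) * cexp u + r i * (cexp u - cexp v)) by ring.
  rewrite (normcM _ (_ + _)) n2 /B -mulrA ler_wpM2l ?pi2_ge0//.
  have d0 : 0 <= d by apply: le_trans h4; exact: normc_ge0.
  have e1 := normc_cexpB (reb (inl i) h1) (reb (inr i) h2).
  rewrite -/u -/v /= in e1.
  have uv : normc (u - v) <= d * - x.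
    have -> : u - v = (- iC * (z i - y i)) * x%:C by rewrite /u /v; ring.
    rewrite (normcM _ x%:C) normc_real ler0_norm// mulNr normcN' (normcM iC).
    by rewrite [normc iC]/= expr0n expr1n add0r sqrtr1 mul1r ler_wpM2r.
  apply: le_trans (normcD _ _) _.
  rewrite (normcM _ (cexp u)) (normcM (r i)).
  have E0 := expR_ge0 (- (b * - x)).
  apply: le_trans (_ : d * expR (- (b * - x)) + M * (2 * (d * - x) * expR (- (b * - x))) <= _).
    rewrite lerD// ler_pM ?normc_ge0//.
      by rewrite normc_cexp ler_expR; exact: (reb (inl i) h1).
    by apply: le_trans e1 _; rewrite ler_wpM2r// ler_wpM2l.
  move: (expR _) E0 => E E0.
  have -> : d * (1 + 2 * M) * ((1 + - x) * E) =
    d * E + M * (2 * (d * - x) * E) + (d * - x * E + d * 2 * M * E) by ring.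
  by rewrite lerDl addr_ge0// !mulr_ge0.
have sumB : normc (\sum_k c2 k * ((pi *+ 2)%:C * iC) * cexp (- iC * z2 k * x%:C)) <= #|I|%:R * B.
  rewrite big_sumType/=.
  have -> : \sum_i - r i * ((pi *+ 2)%:C * iC) * cexp (- iC * y i * x%:C) =
     - \sum_i r i * ((pi *+ 2)%:C * iC) * cexp (- iC * y i * x%:C).
    by rewrite -sumrN; apply: eq_bigr => i _; rewrite !mulNr.
  rewrite -sumrB; apply: le_trans (normc_sum_le termB) _.
  by rewrite sumr_const mulr_natl.
rewrite csqnormE ler0_norm//.
apply: le_trans (_ : - x * (#|I|%:R * B) ^+ 2 <= _).
  rewrite ler_wpM2l//; apply: lerXn2r; rewrite ?nnegrE ?normc_ge0//.
  exact: (le_trans (normc_ge0 _) sumB).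
have -> : - x * (#|I|%:R * B) ^+ 2 =
    K1 * d ^+ 2 * (- x * ((1 + - x) * expR (- (b * - x))) ^+ 2) by rewrite /B K1E; ring.
rewrite (_ : K1 * C * d ^+ 2 * (1 + x ^+ 2)^-1 = K1 * d ^+ 2 * (C / (1 + (- x) ^+ 2))); last first.
  by rewrite sqrrN; ring.
by rewrite ler_wpM2l ?hC// mulr_ge0 ?sqr_ge0.
Qed.

End HhalfBound.

(** * Residue equations *)

Section PartialFractions.
Context {R : realType}.
Local Notation C := R[i].

Lemma poly_real_roots_eq0 (P : {poly C}) : (forall y : R, P.[y%:C] = 0) -> P = 0.
Proof.
move=> h; apply/eqP; apply/negPn/negP => P0.
have := @max_poly_roots _ P [seq (n%:R : R)%:C | n <- iota 0 (size P)] P0.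
rewrite size_map size_iota ltnn => H; suff: false by [].
apply: H; first by apply/allP => _ /mapP[n _ ->]; apply/rootP; exact: h.
rewrite map_inj_uniq ?iota_uniq// => m n /complexI /eqP.
by rewrite eqr_nat => /eqP.
Qed.

Variables (K : finType) (p : K -> C).
Hypotheses (p_inj : injective p) (p_nonreal : forall k, Im (p k) != 0).

Let yp (y : R) k : y%:C - p k != 0.
Proof.
apply: contra (p_nonreal k) => /eqP h; have /eqP : Im (y%:C - p k) = 0 by rewrite h.
by rewrite cImD cImN cImC add0r oppr_eq0.
Qed.

Lemma partial_fraction_simple_eq0 (a : K -> C) (g : C) :
  (forall y : R, g + \sum_k (y%:C - p k)^-1 * a k = 0) -> forall k, a k = 0.
Proof.
move=> h k.
pose Q : {poly C} := g *: \prod_l ('X - (p l)%:P) +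
  \sum_k a k *: \prod_(l | l != k) ('X - (p l)%:P).
have Q0 : Q = 0.
  apply: poly_real_roots_eq0 => y; rewrite hornerD hornerZ horner_prod horner_sum.
  under [X in _ + X]eq_bigr do rewrite hornerZ horner_prod.
  have e l : ('X - (p l)%:P).[y%:C] = y%:C - p l by rewrite hornerXsubC.
  have E : g * \prod_l (y%:C - p l) + \sum_k0 a k0 * \prod_(l | l != k0) (y%:C - p l) =
    \prod_l (y%:C - p l) * (g + \sum_k (y%:C - p k)^-1 * a k).
    rewrite mulrDr mulrC; congr (_ + _); rewrite mulr_sumr; apply: eq_bigr => i _.
    rewrite [in RHS](bigD1 i)//=; have := yp y i => yi.
    by move: (\prod_(l | l != i) _) => W; field.
  rewrite h mulr0 in E; rewrite -[RHS]E; congr (_ * _ + _).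
    by apply: eq_bigr => l _; rewrite e.
  by apply: eq_bigr => l _; congr (_ * _); apply: eq_bigr => l' _; rewrite e.
have := congr1 (fun q : {poly C} => q.[p k]) Q0.
rewrite horner0 hornerD hornerZ horner_sum horner_prod (bigD1 k)//= hornerXsubC subrr mul0r mulr0 add0r.
rewrite [X in X = _ -> _](bigD1 k)//= [X in _ + X]big1 ?addr0 => [|i ik]; last first.
  rewrite hornerZ horner_prod (bigD1 k) 1?eq_sym//= hornerXsubC subrr mul0r mulr0//.
rewrite hornerZ horner_prod => /eqP; rewrite mulf_eq0 => /orP[/eqP//|].
rewrite prodf_seq_eq0 => /hasP[l _] /andP[lk].
rewrite hornerXsubC subr_eq0 => /eqP /p_inj e; by rewrite e eqxx in lk.
Qed.

Lemma partial_fraction_eq0 (a b : K -> C) (g : C) :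
  (forall y : R, g + \sum_k ((y%:C - p k)^-1 * a k + ((y%:C - p k) ^+ 2)^-1 * b k) = 0) ->
  forall k, a k = 0 /\ b k = 0.
Proof.
move=> h.
(* The double coefficients come first: after clearing the squared denominators only [b k] survives
   at [p k]. Without them the simple case applies. *)
suff b0 k : b k = 0.
  move=> k; split=> //; move: k; apply: (@partial_fraction_simple_eq0 a g) => y.
  rewrite -[RHS](h y); congr (_ + _); apply: eq_bigr => k _.
  by rewrite b0 mulr0 addr0.
pose Q : {poly C} := g *: \prod_l ('X - (p l)%:P) ^+ 2 +
  \sum_k (a k *: ('X - (p k)%:P) + (b k)%:P) * \prod_(l | l != k) ('X - (p l)%:P) ^+ 2.
have Q0 : Q = 0.
  apply: poly_real_roots_eq0 => y; rewrite hornerD hornerZ horner_prod horner_sum.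
  have e l : (('X - (p l)%:P) ^+ 2).[y%:C] = (y%:C - p l) ^+ 2 by rewrite !hornerE.
  under [X in _ + X]eq_bigr do
    rewrite hornerM horner_prod hornerD hornerC hornerZ hornerXsubC.
  have E : g * \prod_l (y%:C - p l) ^+ 2 + \sum_k (a k * (y%:C - p k) + b k) *
      \prod_(l | l != k) (y%:C - p l) ^+ 2 = \prod_l (y%:C - p l) ^+ 2 *
      (g + \sum_k ((y%:C - p k)^-1 * a k + ((y%:C - p k) ^+ 2)^-1 * b k)).
    rewrite mulrDr mulrC; congr (_ + _); rewrite mulr_sumr; apply: eq_bigr => i _.
    rewrite [in RHS](bigD1 i)//=; have := yp y i => yi.
    by move: (\prod_(l | l != i) _) => W; field.
  rewrite h mulr0 in E; rewrite -[RHS]E; congr (_ * _ + _).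
    by apply: eq_bigr => l _; rewrite e.
  by apply: eq_bigr => l _; congr (_ * _); apply: eq_bigr => l' _; rewrite e.
have := congr1 (fun q : {poly C} => q.[p k]) Q0.
rewrite horner0 hornerD hornerZ horner_sum horner_prod (bigD1 k)//= horner_exp hornerXsubC subrr expr0n mul0r mulr0 add0r.
rewrite [X in X = _ -> _](bigD1 k)//= [X in _ + X]big1 ?addr0 => [|i ik]; last first.
  rewrite hornerM horner_prod (bigD1 k) 1?eq_sym//= horner_exp hornerXsubC subrr expr0n mul0r mulr0//.
rewrite hornerM horner_prod hornerD hornerC hornerZ hornerXsubC subrr mulr0 add0r => /eqP.
rewrite mulf_eq0 => /orP[/eqP//|].
rewrite prodf_seq_eq0 => /hasP[l _] /andP[lk].
rewrite horner_exp hornerXsubC expf_eq0/= subr_eq0 => /eqP /p_inj e; by rewrite e eqxx in lk.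
Qed.

End PartialFractions.

(** * Principal parts of the sphere constraint and of the evolution equation *)

Section SpinAlgebra.
Context {R : realType}.
Local Notation C := R[i].
Local Notation M2 := 'M[R[i]]_2.
Variables (K : finType) (p : K -> C) (pos : pred K).
Hypotheses (p_inj : injective p) (p_nonreal : forall k, Im (p k) != 0).

Lemma matrix_partial_fraction_eq0 (a b : K -> M2) :
  (forall y : R, \sum_k ((y%:C - p k)^-1 *: a k + ((y%:C - p k) ^+ 2)^-1 *: b k) = 0) ->
  forall k, a k = 0 /\ b k = 0.
Proof.
move=> h.
have H i j k : a k i j = 0 /\ b k i j = 0.
  apply: (@partial_fraction_eq0 _ _ _ p_inj p_nonreal (fun k => a k i j)
    (fun k => b k i j) 0) => y.
  rewrite add0r; have := congr1 (fun X : M2 => X i j) (h y).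
  rewrite summxE mxE => e; rewrite -[RHS]e.
  by apply: eq_bigr => l _; rewrite !mxE.
by move=> k; split; apply/matrixP => i j; have [h1 h2] := H i j k; rewrite mxE.
Qed.

Variables (M0 : M2) (A A' : K -> M2) (p' : K -> C).

(* Since [0^-1 = 0], [ipole k k = 0] and the sums below need not exclude the diagonal. *)
Definition ipole (k l : K) : C := (p k - p l)^-1.
Definition regular (k : K) : M2 := M0 + \sum_l ipole k l *: A l.
(** The sign in |nabla| (1 / (x - p)) = - i eps / (x - p)^2. *)
Definition eps (k : K) : C := if pos k then 1 else -1.
Local Notation d := ipole.
Local Notation B := regular.

Lemma ipoleN k l : d k l = - d l k.
Proof. by rewrite /d -[p k - p l]opprB invrN. Qed.

Lemma ipolekk k : d k k = 0.
Proof. by rewrite /d subrr invr0. Qed.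

Lemma ipole_neq0 k l : k != l -> p k - p l != 0.
Proof. by move=> kl; rewrite subr_eq0; apply: contra kl => /eqP /p_inj ->. Qed.

Definition comm (X Y : M2) : M2 := X * Y - Y * X.

Lemma sum_flip (f : K -> K -> M2) : \sum_k \sum_l f k l = \sum_k \sum_l f l k.
Proof. exact: exchange_big. Qed.

Lemma mul_pole_sum (r : K -> C) (a b : K -> M2) :
  (\sum_k r k *: a k) * (\sum_l b l) = \sum_k \sum_l r k *: (a k * b l).
Proof.
rewrite mulr_suml; apply: eq_bigr => k _; rewrite mulr_sumr.
by apply: eq_bigr => l _; rewrite scalerAl.
Qed.

Lemma sphere_residues : M0 * M0 = 1 ->
  (forall y : R, (M0 + \sum_k (y%:C - p k)^-1 *: A k) *
                 (M0 + \sum_k (y%:C - p k)^-1 *: A k) = 1) ->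
  forall k, A k * B k + B k * A k = 0 /\ A k * A k = 0.
Proof.
move=> M00 h; apply: matrix_partial_fraction_eq0 => y.
set r := fun k => (y%:C - p k)^-1.
have yp k : y%:C - p k != 0.
  apply: contra (p_nonreal k) => /eqP e; have /eqP : Im (y%:C - p k) = 0 by rewrite e.
  by rewrite cImD cImN cImC add0r oppr_eq0.
set S := \sum_k r k *: A k.
have e : M0 * S + (S * M0 + S * S) = 0.
  by apply: (addrI 1); rewrite addr0 -[RHS](h y) mulrDl !mulrDr M00 addrA.
rewrite -[RHS]e addrA /S mul_pole_sum mulr_suml mulr_sumr -big_split/=.
(* Partial fractions; on the diagonal [ipolekk] leaves the double pole alone. *)
have rr k l : r k * r l = (if k == l then r k ^+ 2 else 0) + (d k l * r k + d l k * r l).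
  case: eqVneq => [->|kl]; first by rewrite ipolekk !mul0r !addr0 expr2.
  rewrite (ipoleN l) add0r /r /d; have := ipole_neq0 kl => h1.
  by field; rewrite h1 !yp.
transitivity (\sum_i (r i *: (A i * M0 + M0 * A i)) +
  \sum_k \sum_l (if k == l then r k ^+ 2 else 0) *: (A k * A l) +
  (\sum_k \sum_l (d k l * r k) *: (A k * A l) +
   \sum_k \sum_l (d l k * r l) *: (A k * A l))); last first.
  rewrite -addrA; congr (_ + _).
    by apply: eq_bigr => k _; rewrite scalerDr scalerAl scalerAr addrC.
  rewrite -!big_split/=; apply: eq_bigr => k _.
  rewrite -!big_split/=; apply: eq_bigr => l _.
  by rewrite -!scalerDl -rr -scalerAr scalerA.
rewrite (sum_flip (fun k l => (d l k * r l) *: (A k * A l))) -!big_split/=.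
apply: eq_bigr => k _; rewrite (bigD1 k)//= eqxx big1 ?addr0; last first.
  by move=> l lk; rewrite eq_sym (negPf lk) scale0r.
have e1 : A k * B k = A k * M0 + \sum_l d k l *: (A k * A l).
  by rewrite /B mulrDr mulr_sumr; congr (_ + _); apply: eq_bigr => l _; rewrite scalerAr.
have e2 : B k * A k = M0 * A k + \sum_l d k l *: (A l * A k).
  by rewrite /B mulrDl mulr_suml; congr (_ + _); apply: eq_bigr => l _; rewrite scalerAl.
rewrite -exprVn -/(r k) e1 e2.
have sE (T : K -> M2) : \sum_l (d k l * r k) *: T l = r k *: \sum_l d k l *: T l.
  by rewrite scaler_sumr; apply: eq_bigr => l _; rewrite scalerA mulrC.
by rewrite !sE addrACA !(scalerDr (r k)) addrAC.
Qed.

(* The cubic poles cancel because [A k] commutes with itself. *)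
Lemma evolution_residues :
  (forall y : R, \sum_k ((y%:C - p k)^-1 *: A' k + ((y%:C - p k) ^+ 2)^-1 *: (p' k *: A k)) =
    (- 2^-1) *: comm (M0 + \sum_k (y%:C - p k)^-1 *: A k)
                   (\sum_k ((y%:C - p k) ^+ 2)^-1 *: (eps k *: A k))) ->
  forall k, A' k = (- 2^-1) *: \sum_l ((eps k + eps l) * d k l ^+ 2) *: comm (A k) (A l) /\
    p' k *: A k = (- (2^-1 * eps k)) *: comm (B k) (A k).
Proof.
move=> h.
suff H : forall k, A' k - (- 2^-1) *: (\sum_l ((eps k + eps l) * d k l ^+ 2) *: comm (A k) (A l)) = 0 /\
    p' k *: A k - (- (2^-1 * eps k)) *: comm (B k) (A k) = 0.
  by move=> k; have [/subr0_eq h1 /subr0_eq h2] := H k.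
apply: matrix_partial_fraction_eq0 => y.
set r := fun k => (y%:C - p k)^-1.
have yp k : y%:C - p k != 0.
  apply: contra (p_nonreal k) => /eqP e; have /eqP : Im (y%:C - p k) = 0 by rewrite e.
  by rewrite cImD cImN cImC add0r oppr_eq0.
transitivity (\sum_k ((y%:C - p k)^-1 *: A' k + ((y%:C - p k) ^+ 2)^-1 *: (p' k *: A k)) -
  (- 2^-1) *: (\sum_k (r k *: \sum_l ((eps k + eps l) * d k l ^+ 2) *: comm (A k) (A l) +
     (r k) ^+ 2 *: (eps k *: comm (B k) (A k))))).
  rewrite scaler_sumr -sumrB; apply: eq_bigr => k _.
  have gen (a b c e : C) (X Y Z W : M2) : a *: (X - c *: Y) + b *: (Z - (c * e) *: W) =
      (a *: X + b *: Z) - c *: (a *: Y + b *: (e *: W)).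
    rewrite !scalerBr scalerDr opprD !scalerA addrACA; congr (_ + (- (_ *: _) - (_ *: _))); ring.
  by rewrite -[- (2^-1 * eps k)]mulNr gen /r exprVn.
rewrite h -scalerBr; apply/eqP; rewrite scaler_eq0; apply/orP; right; rewrite subr_eq0.
apply/eqP.
have -> : comm (M0 + \sum_k (y%:C - p k)^-1 *: A k)
   (\sum_k ((y%:C - p k) ^+ 2)^-1 *: (eps k *: A k)) =
   \sum_k (eps k * r k ^+ 2) *: comm M0 (A k) +
   \sum_k \sum_l (eps l * (r k * r l ^+ 2)) *: comm (A k) (A l).
  rewrite /comm mulrDl mulrDr opprD addrACA; congr (_ + _).
    rewrite mulr_sumr mulr_suml -sumrB; apply: eq_bigr => k _.
    by rewrite -exprVn -!scalerAl -!scalerAr !scalerA -scalerBr mulrC.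
  rewrite mul_pole_sum [X in _ - X](_ : _ = \sum_k \sum_l ((r k * (r l ^+ 2 * eps l)) *: (A l * A k))).
    rewrite -sumrB; apply: eq_bigr => k _; rewrite -sumrB; apply: eq_bigr => l _.
    rewrite -exprVn -/(r l) -!scalerAr !scalerA -scalerBr; congr (_ *: _); rewrite /r; ring.
  rewrite mulr_suml sum_flip; apply: eq_bigr => k _; rewrite mulr_sumr.
  apply: eq_bigr => l _.
  by rewrite -exprVn scalerA -scalerAl -scalerAr scalerA; congr (_ *: _); rewrite /r; ring.
(* Partial fractions of [r k * r l ^+ 2]. The minus sign of the second simple pole is spent on
   reversing the commutator, so that exchanging indices turns all terms into principal parts at
   [p k]. *)
have rr k l : (eps l * (r k * r l ^+ 2)) *: comm (A k) (A l) =
    (eps l * d k l ^+ 2 * r k) *: comm (A k) (A l) +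
    (eps l * d l k ^+ 2 * r l) *: comm (A l) (A k) +
    (eps l * d l k * r l ^+ 2) *: comm (A k) (A l).
  have [->|kl] := eqVneq k l; first by rewrite /comm subrr !scaler0 !addr0.
  have cN : comm (A l) (A k) = - comm (A k) (A l) by rewrite /comm opprB.
  rewrite cN scalerN -scaleNr -!scalerDl.
  congr (_ *: _); rewrite (ipoleN l) /r /d; have := ipole_neq0 kl => h1.
  by field; rewrite h1 !yp.
have -> : \sum_k \sum_l (eps l * (r k * r l ^+ 2)) *: comm (A k) (A l) =
   \sum_k \sum_l (eps l * d k l ^+ 2 * r k) *: comm (A k) (A l) +
   \sum_k \sum_l (eps k * d k l ^+ 2 * r k) *: comm (A k) (A l) +
   \sum_k \sum_l (eps k * d k l * r k ^+ 2) *: comm (A l) (A k).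
  rewrite [X in _ + X + _]sum_flip [X in _ + X]sum_flip -!big_split/=.
  by apply: eq_bigr => k _; rewrite -!big_split/=; apply: eq_bigr => l _; exact: rr.
have -> : \sum_k (r k *: (\sum_l ((eps k + eps l) * d k l ^+ 2) *: comm (A k) (A l)) +
     r k ^+ 2 *: (eps k *: comm (B k) (A k))) =
   \sum_k ((r k *: \sum_l ((eps k + eps l) * d k l ^+ 2) *: comm (A k) (A l)) +
     ((eps k * r k ^+ 2) *: comm M0 (A k) +
      \sum_l (eps k * d k l * r k ^+ 2) *: comm (A l) (A k))).
  apply: eq_bigr => k _; congr (_ + _).
  have -> : comm (B k) (A k) = comm M0 (A k) + \sum_l d k l *: comm (A l) (A k).
    rewrite /comm /B mulrDl mulrDr opprD addrACA; congr (_ + _).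
    rewrite mulr_sumr mulr_suml -sumrB; apply: eq_bigr => l _.
    by rewrite -scalerAl -scalerAr scalerBr.
  rewrite scalerA scalerDr [r k ^+ 2 * _]mulrC; congr (_ + _).
  by rewrite scaler_sumr; apply: eq_bigr => l _; rewrite scalerA; congr (_ *: _); ring.
rewrite addrCA !big_split/=; congr (_ + _).
rewrite -big_split/=; apply: eq_bigr => k _.
rewrite -big_split/= scaler_sumr; apply: eq_bigr => l _.
by rewrite -scalerDl scalerA; congr (_ *: _); ring.
Qed.

End SpinAlgebra.

(** * The Lax pair *)

Section Lax.
Context {R : realType}.
Local Notation C := R[i].
Local Notation M2 := 'M[R[i]]_2.
Variables (K : finType) (p : K -> C) (pos : pred K).
Hypothesis p_inj : injective p.
Variables (M0 : M2) (A A' : K -> M2) (p' : K -> C).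
Local Notation d := (ipole p).
Local Notation B := (regular p M0 A).
Local Notation eps := (eps pos).
Definition posC (k : K) : C := (pos k)%:R.
Local Notation pi := posC.

(* The Lax pair acts on rows [v] indexed by all poles, but only the poles in the
   upper half plane (the predicate [pos]) enter the sums. *)
Definition lax_mul (v : K -> M2) (k : K) : M2 :=
  v k * B k + \sum_j (pi j * d k j) *: (v j * A k).

Definition lax_conn (v : K -> M2) (k : K) : M2 :=
  \sum_j (pi j * d k j ^+ 2) *: (v j * A k - v k * A j).

(** Primes are time derivatives: [regular'] is that of [regular], and [lax_mul'] differentiates the
    coefficients of [lax_mul] with [v] frozen. *)
Definition ipole' k l : C := - d k l ^+ 2 * (p' k - p' l).

Definition regular' k : M2 := \sum_l (ipole' k l *: A l + d k l *: A' l).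

Definition lax_mul' (v : K -> M2) (k : K) : M2 :=
  v k * regular' k + \sum_j pi j *: (d k j *: (v j * A' k) + ipole' k j *: (v j * A k)).

Hypotheses (AA : forall k, A k * A k = 0)
  (AB : forall k, A k * B k + B k * A k = 0)
  (pA : forall k, p' k *: A k = (- (2^-1 * eps k)) *: comm (B k) (A k))
  (A'E : forall k, A' k = (- 2^-1) *: \sum_l ((eps k + eps l) * d k l ^+ 2) *: comm (A k) (A l)).

Let dN k l : d k l = - d l k. Proof. exact: ipoleN. Qed.
Let dkk k : d k k = 0. Proof. exact: ipolekk. Qed.

(** By anticommutation the commutator in [pA] collapses to a single product; the sign [eps] decides
    its order, so a lower pole gets [B k * A k] instead. *)
Lemma pole_velocity_pos k : pos k -> p' k *: A k = A k * B k.
Proof.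
move=> pk; rewrite pA /comm /eps pk (_ : B k * A k = - (A k * B k)); last first.
  by apply/eqP; rewrite -addr_eq0 addrC AB.
by rewrite -opprD scalerN scaleNr opprK mulr1 scalerDr -scalerDl -[RHS]scale1r; congr (_ *: _); field.
Qed.

Lemma pole_velocity_neg k : ~~ pos k -> p' k *: A k = B k * A k.
Proof.
move=> pk; rewrite pA /comm /eps (negPf pk) (_ : A k * B k = - (B k * A k)); last first.
  by apply/eqP; rewrite -addr_eq0 AB.
by rewrite opprK scalerDr -scalerDl -[RHS]scale1r; congr (_ *: _); field.
Qed.

(** [eps k + eps l] is 2 for an upper [l] and 0 for a lower one, so the lower residues drop out and
    [A] itself is a row transported by the connection. *)
Lemma residue_velocity k : pos k -> A' k = lax_conn A k.
Proof.
move=> pk; rewrite A'E scaler_sumr; apply: eq_bigr => l _.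
rewrite /comm -[A l * A k - _]opprB scalerN -scaleNr scalerA; congr (_ *: _).
by rewrite /pi /eps pk; case: (pos l); rewrite ?mulr1n ?mulr0n; field.
Qed.

(** The summand is antisymmetric in its two indices. This is the conservation law behind the
    moments. *)
Lemma sum_lax_conn v : \sum_k pi k *: lax_conn v k = 0.
Proof.
have E : \sum_k pi k *: lax_conn v k =
    \sum_k \sum_j (pi k * (pi j * d k j ^+ 2)) *: (v j * A k) -
    \sum_k \sum_j (pi k * (pi j * d k j ^+ 2)) *: (v k * A j).
  rewrite -sumrB; apply: eq_bigr => k _; rewrite scaler_sumr -sumrB.
  by apply: eq_bigr => j _; rewrite scalerA scalerBr.
rewrite E [X in _ - X]sum_flip; apply/eqP; rewrite subr_eq0; apply/eqP.
apply: eq_bigr => k _; apply: eq_bigr => j _.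
by rewrite (dN k) sqrrN; congr (_ *: _); ring.
Qed.

Variable v : K -> M2.
Hypotheses (vA : forall k, pos k -> v k * A k = 0)
  (vB : forall k, pos k -> v k * B k = p' k *: v k).

(** The relation X' = L + [X, C] applied to a row. As [vB] removes the diagonal part, it amounts to
    [d k j * (p j - p k) = -1] for j != k. *)
Lemma lax_pole k : pos k ->
  p' k *: v k - lax_mul v k = lax_conn (fun j => p j *: v j) k - p k *: lax_conn v k.
Proof.
move=> pk; rewrite /lax_mul vB// opprD addrA subrr add0r -sumrN scaler_sumr -sumrB.
apply: eq_bigr => j _; rewrite -(scalerAl (p j)) -(scalerAl (p k)) scalerA.
have gen (a b x y : C) (X Y : M2) : - a = b * (x - y) ->
    - (a *: X) = b *: (x *: X - y *: Y) - (y * b) *: (X - Y).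
  rewrite -scaleNr => ->; rewrite !scalerBr !scalerA [y * b]mulrC opprB addrA subrK.
  by rewrite -scalerBl mulrBr.
apply: gen.
have [->|jk] := eqVneq j k; first by rewrite dkk expr0n !(mulr0, oppr0, mul0r).
have h : p j - p k != 0 by exact: ipole_neq0.
by rewrite (dN k) /ipole; field.
Qed.

(** The coefficient of the word [v k * A q * A r] in [cqr_sum]. It is 0 unless q = k or r = q, and
    in these cases the word itself is 0. *)
Let cqr k q r : C := pi q * d k q ^+ 2 * (d q r - d k r)
  + (1 - pi r) * d k r ^+ 2 * (d r q - d k q)
  - 2^-1 * (eps q + eps r) * (d q r ^+ 2 * d k q - d r q ^+ 2 * d k r)
  + (r == k)%:R * (2 * (pi q * d k q ^+ 3)).

Let cqr_eq0 k q r : pos k -> cqr k q r *: (v k * A q * A r) = 0.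
Proof.
move=> pk; have [->|qk] := eqVneq q k; first by rewrite vA// mul0r scaler0.
have [->|rq] := eqVneq r q; first by rewrite -mulrA AA mulr0 scaler0.
suff -> : cqr k q r = 0 by rewrite scale0r.
have h1 : p k - p q != 0 by rewrite ipole_neq0// eq_sym.
have h2 : p q - p r != 0 by rewrite ipole_neq0// eq_sym.
rewrite /cqr (dN r) /posC /eps; have [->|rk] := eqVneq r k.
  rewrite pk dkk (dN q) /ipole; case: (pos q); rewrite ?mulr1n ?mulr0n; field; exact: h1.
have h3 : p k - p r != 0 by rewrite ipole_neq0// eq_sym.
by case: (pos q); case: (pos r); rewrite ?mulr1n ?mulr0n /ipole; field; rewrite h1 h2 h3.
Qed.

Let regularB q k : B q - B k = \sum_r (d q r - d k r) *: A r.
Proof.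
rewrite /regular opprD addrACA subrr add0r -sumrB.
by apply: eq_bigr => r _; rewrite scalerBl.
Qed.

Let cqr_sum k : pos k ->
  \sum_q (((pi q * d k q ^+ 2) *: (v k * A q * (B q - B k)) +
     ((1 - pi q) * d k q ^+ 2) *: (v k * (B q - B k) * A q)) +
     (d k q *: (v k * A' q) + (2 * (pi q * d k q ^+ 3)) *: (v k * A q * A k))) = 0.
Proof.
move=> pk; pose m q r := v k * A q * A r.
have e1 q : (pi q * d k q ^+ 2) *: (v k * A q * (B q - B k)) =
    \sum_r (pi q * d k q ^+ 2 * (d q r - d k r)) *: m q r.
  rewrite regularB mulr_sumr scaler_sumr; apply: eq_bigr => r _.
  by rewrite -(scalerAr (d q r - d k r)) scalerA.
have e2 q : ((1 - pi q) * d k q ^+ 2) *: (v k * (B q - B k) * A q) =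
    \sum_r ((1 - pi q) * d k q ^+ 2 * (d q r - d k r)) *: m r q.
  rewrite regularB mulr_sumr mulr_suml scaler_sumr; apply: eq_bigr => r _.
  by rewrite -(scalerAr (d q r - d k r)) -(scalerAl (d q r - d k r)) scalerA.
have e3 q : d k q *: (v k * A' q) =
    \sum_r (- 2^-1 * (eps q + eps r) * (d q r ^+ 2 * d k q)) *: (m q r - m r q).
  rewrite A'E -(scalerAr (- 2^-1)) mulr_sumr !scaler_sumr; apply: eq_bigr => r _.
  rewrite -(scalerAr ((eps q + eps r) * d q r ^+ 2)) !scalerA /comm mulrBr !mulrA.
  by congr (_ *: _); ring.
have e4 q : (2 * (pi q * d k q ^+ 3)) *: (v k * A q * A k) =
    \sum_r ((r == k)%:R * (2 * (pi q * d k q ^+ 3))) *: m q r.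
  rewrite (bigD1 k)//= eqxx mul1r big1 ?addr0// => r rk.
  by rewrite (negPf rk) mul0r scale0r.
under eq_bigr do rewrite e1 e2 e3 e4.
rewrite !big_split/=.
have e3' : \sum_q \sum_r (- 2^-1 * (eps q + eps r) * (d q r ^+ 2 * d k q)) *: (m q r - m r q) =
    \sum_q \sum_r (- 2^-1 * (eps q + eps r) * (d q r ^+ 2 * d k q - d r q ^+ 2 * d k r)) *: m q r.
  transitivity (\sum_q \sum_r (- 2^-1 * (eps q + eps r) * (d q r ^+ 2 * d k q)) *: m q r +
     \sum_q \sum_r (2^-1 * (eps q + eps r) * (d q r ^+ 2 * d k q)) *: m r q).
    rewrite -big_split; apply: eq_bigr => q _; rewrite -big_split; apply: eq_bigr => r _ /=.
    by rewrite scalerBr -scaleNr; congr (_ + _ *: _); ring.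
  rewrite [X in _ + X]sum_flip -big_split; apply: eq_bigr => q _.
  rewrite -big_split; apply: eq_bigr => r _ /=.
  by rewrite -scalerDl; congr (_ *: _); ring.
rewrite e3' [X in _ + X + _]sum_flip -!big_split big1// => q _.
rewrite -!big_split big1//= => r _; rewrite -!scalerDl.
rewrite -[RHS](cqr_eq0 q r pk) /m; congr (_ *: _); rewrite /cqr; ring.
Qed.

(** [regular'] runs over all poles. Their velocities are traded for [A q * B q] at upper and
    [B q * A q] at lower poles, and subtracting [cqr_sum] then removes the lower poles, except for
    those inside [B k]. *)
Let acc k : pos k -> v k * regular' k =
  - \sum_j (pi j * d k j ^+ 2) *: (p' k *: (v k * A j)) +
  \sum_j (pi j * d k j ^+ 2) *: (v k * A j * B k) -
  \sum_i (2 * (pi i * d k i ^+ 3)) *: (v k * A i * A k).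
Proof.
move=> pk; have vpA q : p' k *: (v k * A q) = v k * B k * A q.
  by rewrite (scalerAl (p' k)) vB.
have := cqr_sum pk; set S := \sum_q _ => S0.
transitivity (v k * regular' k - S); first by rewrite S0 subr0.
rewrite /S mulr_sumr -sumrB -[X in _ = X + _ - _]sumrN -big_split -sumrB /=.
apply: eq_bigr => q _; rewrite mulrDr -(scalerAr (d k q)) -(scalerAr (ipole' k q)).
have gen (a b c x y : M2) : a + x - (b + c + (x + y)) = a - b - c - y.
  by rewrite [b + c + _]addrCA [- (x + _)]opprD addrA addrK !opprD !addrA.
rewrite gen; set Y := (2 * _) *: _.
congr (_ - Y); set D := d k q ^+ 2; rewrite /posC; case: (boolP (pos q)) => pq /=.
  have XB : v k * A q * B q = p' q *: (v k * A q).
    by rewrite -mulrA -pole_velocity_pos// -(scalerAr (p' q)).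
  rewrite mulr1n subrr !mul0r scale0r subr0 !mul1r mulrBr XB scalerBr opprB addrCA.
  rewrite [RHS]addrC; congr (_ + _); move: (v k * A q) => X.
  rewrite !(scalerA _ _ X) -!(scaleNr _ X) -(scalerDl X); congr (_ *: X).
  by rewrite /ipole' -/D; ring.
have BX : v k * B q * A q = p' q *: (v k * A q).
  by rewrite -mulrA -pole_velocity_neg// -(scalerAr (p' q)).
rewrite mulr0n subr0 !mul0r !scale0r oppr0 !addr0 !mul1r mulrBr mulrBl BX -vpA.
move: (v k * A q) => X; apply/eqP; rewrite subr_eq0; apply/eqP.
rewrite -(scalerBl _ _ X) (scalerA _ _ X); congr (_ *: X).
by rewrite /ipole' -/D; ring.
Qed.

(** Both sides are expanded in the words [v j * A i * A k] and [v j * A k * A i]. Once [acc] has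
    rewritten the derivative of [B k], the velocity terms match directly and the scalar identity [Q]
    remains. *)
Lemma lax_equation k : pos k ->
  lax_mul' v k = lax_conn (lax_mul v) k - lax_mul (lax_conn v) k.
Proof.
move=> pk; pose m j i := v j * A i * A k; pose n j i := v j * A k * A i.
have vBA j i : pos j -> v j * B j * A i = p' j *: (v j * A i).
  by move=> pj; rewrite vB// (scalerAl (p' j)).
have vAB j : v j * A k * B k = p' k *: (v j * A k).
  by rewrite -mulrA -pole_velocity_pos// (scalerAr (p' k)).
have R1 : lax_conn (lax_mul v) k =
    (\sum_j (pi j * d k j ^+ 2) *: (p' j *: (v j * A k)) +
     \sum_j \sum_i (pi j * pi i * d k i ^+ 2 * d i j) *: m j i) -
    (\sum_j (pi j * d k j ^+ 2) *: (p' k *: (v k * A j)) +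
     \sum_j \sum_i (pi j * pi i * d k i ^+ 2 * d k j) *: n j i).
  rewrite (sum_flip (fun j i => (pi j * pi i * d k i ^+ 2 * d i j) *: m j i)).
  rewrite (sum_flip (fun j i => (pi j * pi i * d k i ^+ 2 * d k j) *: n j i)).
  rewrite -!big_split -sumrB; apply: eq_bigr => j _ /=.
  rewrite scalerBr; congr (_ - _).
    rewrite /lax_mul mulrDl scalerDr; congr (_ + _).
      by rewrite /posC; case: (boolP (pos j)) => pj /=; rewrite ?mulr0n ?mul0r ?scale0r// vBA.
    rewrite mulr_suml scaler_sumr; apply: eq_bigr => i _.
    by rewrite -(scalerAl (pi i * d j i)) scalerA; congr (_ *: _); ring.
  rewrite /lax_mul mulrDl scalerDr vBA//; congr (_ + _).
  rewrite mulr_suml scaler_sumr; apply: eq_bigr => i _.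
  by rewrite -(scalerAl (pi i * d k i)) scalerA; congr (_ *: _); ring.
have R2 : lax_mul (lax_conn v) k =
    \sum_j (pi j * d k j ^+ 2) *: (p' k *: (v j * A k)) -
    \sum_j (pi j * d k j ^+ 2) *: (v k * A j * B k) +
    (\sum_j \sum_i (pi j * pi i * d k i * d i j ^+ 2) *: m j i -
     \sum_j \sum_i (pi j * pi i * d k j * d j i ^+ 2) *: m j i).
  rewrite (sum_flip (fun j i => (pi j * pi i * d k i * d i j ^+ 2) *: m j i)).
  rewrite /lax_mul -!sumrB; congr (_ + _).
    rewrite /lax_conn mulr_suml; apply: eq_bigr => j _.
    by rewrite -(scalerAl (pi j * d k j ^+ 2)) mulrBl vAB scalerBr.
  apply: eq_bigr => j _; rewrite /lax_conn mulr_suml scaler_sumr -sumrB.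
  apply: eq_bigr => i _; rewrite -(scalerAl (pi i * d j i ^+ 2)) mulrBl scalerA scalerBr.
  by congr (_ *: _ - _ *: _); ring.
have L2 : \sum_j pi j *: (d k j *: (v j * A' k) + ipole' k j *: (v j * A k)) =
    (\sum_j \sum_i (pi j * pi i * d k j * d k i ^+ 2) *: m j i -
     \sum_j \sum_i (pi j * pi i * d k i ^+ 2 * d k j) *: n j i) +
    (\sum_j (pi j * d k j ^+ 2) *: (p' j *: (v j * A k)) -
     \sum_j (pi j * d k j ^+ 2) *: (p' k *: (v j * A k))).
  rewrite -!sumrB -big_split; apply: eq_bigr => j _ /=; rewrite scalerDr; congr (_ + _).
    rewrite residue_velocity// /lax_conn mulr_sumr !scaler_sumr -sumrB.
    apply: eq_bigr => i _; rewrite -(scalerAr (pi i * d k i ^+ 2)) mulrBr !mulrA !scalerA scalerBr.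
    by congr (_ *: _ - _ *: _); ring.
  by rewrite !scalerA -scalerBl; congr (_ *: _); rewrite /ipole'; ring.
(* A relation between the inverse differences of three poles; the degenerate case j = k produces the
   cubic sum that cancels the one in [acc]. *)
have Q : \sum_j \sum_i (pi j * pi i * d k j * d k i ^+ 2) *: m j i =
    \sum_j \sum_i (pi j * pi i * d k i ^+ 2 * d i j) *: m j i -
    (\sum_j \sum_i (pi j * pi i * d k i * d i j ^+ 2) *: m j i -
     \sum_j \sum_i (pi j * pi i * d k j * d j i ^+ 2) *: m j i) +
    \sum_i (2 * (pi i * d k i ^+ 3)) *: (v k * A i * A k).
  have -> : \sum_i (2 * (pi i * d k i ^+ 3)) *: (v k * A i * A k) =
      \sum_j \sum_i ((j == k)%:R * (2 * (pi i * d k i ^+ 3))) *: m j i.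
    rewrite [RHS](bigD1 k)//= [X in _ = _ + X]big1 ?addr0 => [|j jk].
      by apply: eq_bigr => i _; rewrite eqxx mul1r.
    by apply: big1 => i _; rewrite (negPf jk) mul0r scale0r.
  rewrite -!sumrB -big_split; apply: eq_bigr => j _ /=.
  rewrite -!sumrB -big_split; apply: eq_bigr => i _ /=.
  rewrite -!scalerBl -scalerDl.
  case: (boolP (pos j)) => pj; last first.
    rewrite /pi (negPf pj) (_ : (j == k) = false) ?mulr0n ?mul0r ?subr0 ?addr0 ?subrr//.
    by apply: contraNF pj => /eqP ->.
  have [->|ik] := eqVneq i k; first by rewrite /m -(mulrA (v j)) AA mulr0 !scaler0.
  have [->|ij] := eqVneq i j; first by rewrite /m vA// mul0r !scaler0.
  congr (_ *: _); have h1 : p k - p i != 0 by rewrite ipole_neq0// eq_sym.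
  have h2 : p i - p j != 0 by rewrite ipole_neq0.
  rewrite (dN j i) /pi pj; have [->|jk] := eqVneq j k.
    by rewrite dkk (dN i k) /ipole; field.
  have h3 : p k - p j != 0 by rewrite ipole_neq0// eq_sym.
  by rewrite /= mulr0n mulr1n /ipole; field; rewrite h1 h2 h3.
have gen (a1 a2 a3 x2 x7 x8 nn t1 t5 : M2) :
    - a1 + a2 - a3 + (x2 - (x7 - x8) + a3 - nn + (t1 - t5)) =
    t1 + x2 - (a1 + nn) - (t5 - a2 + (x7 - x8)).
  by apply/matrixP => r s; rewrite !mxE; ring.
by rewrite /lax_mul' acc// R1 R2 L2 Q; exact: gen.
Qed.

End Lax.

(** * Entrywise derivatives of matrix functions *)

Section MatrixDerivative.
Context {R : realType}.
Local Notation C := R[i].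
Local Notation M2 := 'M[R[i]]_2.
Implicit Types (f g : R -> M2).

Definition has_mderive f (t : R) (D : M2) : Prop :=
  forall i j, has_cderive (fun s => f s i j) t (D i j).

Lemma has_mderive_eq f t D D' : has_mderive f t D -> D = D' -> has_mderive f t D'.
Proof. by move=> h <-. Qed.

Lemma has_mderive_cst D t : has_mderive (fun=> D) t 0.
Proof. by move=> i j; rewrite mxE; exact: has_cderive_cst. Qed.

Lemma has_mderiveD f g t D E : has_mderive f t D -> has_mderive g t E ->
  has_mderive (fun s => f s + g s) t (D + E).
Proof.
move=> hf hg i j; rewrite mxE.
apply: has_cderive_ext (has_cderiveD (hf i j) (hg i j)) => s; by rewrite mxE.
Qed.

Lemma has_mderiveZ (c : R -> C) f t c' D : has_cderive c t c' -> has_mderive f t D ->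
  has_mderive (fun s => c s *: f s) t (c' *: f t + c t *: D).
Proof.
move=> hc hf i j; rewrite !mxE.
apply: has_cderive_ext (has_cderiveM hc (hf i j)) => s; by rewrite mxE.
Qed.

Lemma has_mderiveM f g t D E : has_mderive f t D -> has_mderive g t E ->
  has_mderive (fun s => f s * g s) t (D * g t + f t * E).
Proof.
move=> hf hg i j; rewrite !mxE -big_split/=.
apply: (@has_cderive_ext _ (fun s => \sum_k f s i k * g s k j)) => [s|].
  by rewrite mxE.
by apply: has_cderive_sum => k _; exact: has_cderiveM.
Qed.

Lemma has_mderive_sum (I : Type) (r : seq I) (f : I -> R -> M2) t (D : I -> M2) :
  (forall i, has_mderive (f i) t (D i)) ->
  has_mderive (fun s => \sum_(i <- r) f i s) t (\sum_(i <- r) D i).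
Proof.
move=> h i j; rewrite summxE.
apply: (@has_cderive_ext _ (fun s => \sum_(k <- r) f k s i j)) => [s|].
  by rewrite summxE.
by apply: has_cderive_sum => k _; exact: h.
Qed.

Lemma has_mderive0_cst f : (forall t, has_mderive f t 0) -> forall s t, f s = f t.
Proof.
move=> h s t; apply/matrixP => i j.
apply: (@has_cderive0_cst _ (fun u => f u i j)) => u.
by have := h u i j; rewrite mxE.
Qed.

End MatrixDerivative.

(** * Free evolution of the moments *)

Section Moments.
Context {R : realType}.
Local Notation C := R[i].
Local Notation M2 := 'M[R[i]]_2.
Variables (K : finType) (pos : pred K) (M0 : M2).
Variables (p p' : K -> R -> C) (A A' : K -> R -> M2).
Hypothesis p_inj : forall t, injective (p^~ t).
Hypotheses (dp : forall k t, has_cderive (p k) t (p' k t))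
  (dA : forall k t, has_mderive (A k) t (A' k t)).
Local Notation B k t := (regular (p^~ t) M0 (A^~ t) k).
Local Notation d k l t := (ipole (p^~ t) k l).
Local Notation pi := (posC (R:=R) pos).
Hypotheses (AA : forall k t, A k t * A k t = 0)
  (AB : forall k t, A k t * B k t + B k t * A k t = 0)
  (pA : forall k t, p' k t *: A k t = (- (2^-1 * eps pos k)) *: comm (B k t) (A k t))
  (A'E : forall k t, A' k t =
    (- 2^-1) *: \sum_l ((eps pos k + eps pos l) * d k l t ^+ 2) *: comm (A k t) (A l t)).
Local Notation lmul t := (lax_mul (p^~ t) pos M0 (A^~ t)).
Local Notation lconn t := (lax_conn (p^~ t) pos (A^~ t)).

(* The rows [A (X + (T - t) L)^n] at time [t]: constant total sum in [t], and
   equal to [p_k^n A_k] at [t = T]. *)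
Fixpoint lax_orbit (T : R) n k t : M2 :=
  if n is n'.+1 then p k t *: lax_orbit T n' k t +
     (T - t)%:C *: lmul t (fun j => lax_orbit T n' j t) k
  else A k t.

(** The form [W * A k] survives the recursion because [A k * B k] is a multiple of [A k]. It
    provides the hypotheses [vA] and [vB] of the Lax equation. *)
Lemma lax_orbit_range T n k t : pos k -> exists W, lax_orbit T n k t = W * A k t.
Proof.
move=> pk; elim: n => [|n [W hW]]; first by exists 1; rewrite mul1r.
rewrite /= /lax_mul hW.
exists (p k t *: W + (T - t)%:C *: (p' k t *: W +
   \sum_j (pi j * d k j t) *: lax_orbit T n j t)).
rewrite mulrDl -scalerAl; congr (_ + _); rewrite -scalerAl mulrDl; congr (_ *: (_ + _)).
  rewrite -mulrA -(pole_velocity_pos (AB^~ t) (pA^~ t) pk).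
  by rewrite -scalerAr scalerAl.
by rewrite mulr_suml; apply: eq_bigr => j _; rewrite -scalerAl.
Qed.

Lemma lax_orbit_vA T n k t : pos k -> lax_orbit T n k t * A k t = 0.
Proof. by move=> /(lax_orbit_range T n t)[W ->]; rewrite -mulrA AA mulr0. Qed.

Lemma lax_orbit_vB T n k t : pos k ->
  lax_orbit T n k t * B k t = p' k t *: lax_orbit T n k t.
Proof.
move=> pk; have [W ->] := lax_orbit_range T n t pk.
by rewrite -mulrA -(pole_velocity_pos (AB^~ t) (pA^~ t) pk) -scalerAr.
Qed.

Lemma has_cderive_ipole k l t : has_cderive (fun s => d k l s) t
  (ipole' (p^~ t) (p'^~ t) k l).
Proof.
rewrite /ipole'; have [->|kl] := eqVneq k l.
  rewrite subrr mulr0; apply: (@has_cderive_ext _ (fun=> 0)) => [s|]; last exact: has_cderive_cst.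
  by rewrite ipolekk.
have h : p k t - p l t != 0 by exact: (ipole_neq0 (@p_inj t)).
apply: has_cderive_eq; first by apply: has_cderiveV => //; apply: has_cderiveB; exact: dp.
by rewrite /ipole; field.
Qed.

Lemma has_mderive_regular k t : has_mderive (fun s => B k s) t
  (regular' (p^~ t) (A^~ t) (A'^~ t) (p'^~ t) k).
Proof.
rewrite /regular' -[X in has_mderive _ _ X]add0r.
apply: has_mderiveD; first exact: has_mderive_cst.
by apply: has_mderive_sum => l; apply: has_mderiveZ; [exact: has_cderive_ipole|exact: dA].
Qed.

(** Every orbit row solves v' = C v: differentiating the factor [T - t] produces - L v, which
    cancels the L in X' = L + [X, C]. *)
Lemma has_mderive_lax_orbit T n k t : pos k ->
  has_mderive (lax_orbit T n k) t (lconn t (fun j => lax_orbit T n j t) k).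
Proof.
move=> pk; elim: n k pk => [|n ih] k pk.
  apply: has_mderive_eq; first exact: dA.
  exact: (residue_velocity (A'E^~ t) pk).
pose v j := lax_orbit T n j t.
have dmul : has_mderive (fun s => lmul s (fun j => lax_orbit T n j s) k) t
    (lmul t (lconn t v) k + lax_mul' (p^~ t) pos (A^~ t) (A'^~ t) (p'^~ t) v k).
  have term j : has_mderive (fun s => (pi j * d k j s) *: (lax_orbit T n j s * A k s)) t
    ((pi j * d k j t) *: (lconn t v j * A k t) +
      pi j *: (d k j t *: (v j * A' k t) +
        ipole' (p^~ t) (p'^~ t) k j *: (v j * A k t))).
    rewrite /posC; case: (boolP (pos j)) => pj /=.
      rewrite mulr1n scale1r; under eq_fun do rewrite mul1r.
      apply: has_mderive_eq.
        apply: has_mderiveZ; first exact: has_cderive_ipole.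
        by apply: has_mderiveM; [exact: ih|exact: dA].
      by rewrite mul1r scalerDr addrC addrA.
    rewrite mulr0n mul0r !scale0r addr0; under eq_fun do rewrite mul0r scale0r.
    exact: has_mderive_cst.
  apply: has_mderive_eq.
    apply: has_mderiveD; last by apply: has_mderive_sum => j; exact: term.
    by apply: has_mderiveM; [exact: ih|exact: has_mderive_regular].
  by rewrite /lax_mul /lax_mul' big_split/= addrACA.
have dT : has_cderive (fun s => (T - s)%:C) t (-1).
  have -> : (-1 : C) = (-1 : R)%:C by rewrite rmorphN.
  apply: has_cderive_real.
  by apply: (is_derive_eq (is_deriveB (is_derive_cst T t 1) (is_derive_id t 1))); rewrite sub0r.
apply: has_mderive_eq.
  apply: has_mderiveD; first by apply: has_mderiveZ; [exact: dp|exact: ih].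
  by apply: has_mderiveZ; [exact: dT|exact: dmul].
rewrite -/(v k) (lax_equation (@p_inj t) (AA^~ t) (AB^~ t) (pA^~ t) (A'E^~ t)
  (fun k => @lax_orbit_vA T n k t) (fun k => @lax_orbit_vB T n k t) pk).
have hp := lax_pole (@p_inj t) (fun k => @lax_orbit_vB T n k t) pk.
have -> : lconn t (fun j => lax_orbit T n.+1 j t) k =
   lconn t (fun j => p j t *: v j) k + (T - t)%:C *: lconn t (lmul t v) k.
  rewrite /lax_conn scaler_sumr -big_split; apply: eq_bigr => j _ /=.
  have gen (a c : C) (X Y : M2) : a *: X + c *: (a *: Y) = a *: (X + c *: Y).
    by rewrite scalerDr !(scalerA _ _ Y) mulrC.
  have gen2 (x y c : C) (v1 v2 l1 l2 a1 a2 : M2) :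
      (x *: v1 + c *: l1) * a1 - (y *: v2 + c *: l2) * a2 =
      ((x *: v1) * a1 - (y *: v2) * a2) + c *: (l1 * a1 - l2 * a2).
    by rewrite !mulrDl opprD addrACA scalerBr -(scalerAl c l1) -(scalerAl c l2).
  by rewrite gen; congr (_ *: _); exact: gen2.
have -> : lconn t (fun j => p j t *: v j) k =
   p' k t *: v k - lmul t v k + p k t *: lconn t v k by rewrite hp subrK.
set X := lconn t (lmul t v) k; set Y := lmul t (lconn t v) k.
rewrite [Y + _]addrC subrK scaleN1r.
set a := _ *: v k; set b := _ *: lconn t v k.
by rewrite addrA; congr (_ + _); rewrite addrAC.
Qed.

Lemma lax_orbit_moment T n s t :
  \sum_k pi k *: lax_orbit T n k s = \sum_k pi k *: lax_orbit T n k t.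
Proof.
apply: (@has_mderive0_cst _ (fun t => \sum_k pi k *: lax_orbit T n k t)) => {s}t.
apply: has_mderive_eq (sum_lax_conn (p^~ t) pos (A^~ t) (fun k => lax_orbit T n k t)).
apply: has_mderive_sum => k; rewrite /posC; case: (boolP (pos k)) => pk /=.
  rewrite mulr1n scale1r; under eq_fun do rewrite scale1r.
  exact: has_mderive_lax_orbit.
by rewrite mulr0n scale0r; under eq_fun do rewrite scale0r; exact: has_mderive_cst.
Qed.

Lemma lax_orbit_final T n k : lax_orbit T n k T = p k T ^+ n *: A k T.
Proof.
elim: n => [|n ih] /=; first by rewrite expr0 scale1r.
by rewrite ih subrr scale0r addr0 scalerA exprS.
Qed.

End Moments.

(** * From the half-wave maps equation to the residue equations *)

Section Spin.
Context {R : realType}.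
Local Notation C := R[i].
Local Notation iC := (0 +i* 1 : R[i]).
Implicit Types (u w : 'rV[R[i]]_3).

Lemma mx22M (a b c e a' b' c' e' : C) : mx22 a b c e * mx22 a' b' c' e' =
  mx22 (a * a' + b * c') (a * b' + b * e') (c * a' + e * c') (c * b' + e * e').
Proof.
apply/matrixP => i j; rewrite !mxE !big_ord_recl big_ord0 !mxE addr0.
by case: i => [[|[|]]]// ?; case: j => [[|[|]]].
Qed.

Lemma mx22B (a b c e a' b' c' e' : C) : mx22 a b c e - mx22 a' b' c' e' =
  mx22 (a - a') (b - b') (c - c') (e - e').
Proof.
apply/matrixP => i j; rewrite !mxE.
by case: i => [[|[|]]]// ?; case: j => [[|[|]]].
Qed.

Lemma mx22D (a b c e a' b' c' e' : C) : mx22 a b c e + mx22 a' b' c' e' =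
  mx22 (a + a') (b + b') (c + c') (e + e').
Proof.
apply/matrixP => i j; rewrite !mxE.
by case: i => [[|[|]]]// ?; case: j => [[|[|]]].
Qed.

Lemma mx22Z (k a b c e : C) : k *: mx22 a b c e = mx22 (k * a) (k * b) (k * c) (k * e).
Proof.
apply/matrixP => i j; rewrite !mxE.
by case: i => [[|[|]]]// ?; case: j => [[|[|]]].
Qed.

Lemma mx22_1 : 1 = mx22 1 0 0 1 :> 'M[C]_2.
Proof.
apply/matrixP => i j; rewrite !mxE.
by case: i => [[|[|]]]// ?; case: j => [[|[|]]].
Qed.

Lemma sum_ord3 (V : nmodType) (f : 'I_3 -> V) : \sum_i f i = f 0 + f 1 + f 2%:R.
Proof.
rewrite !big_ord_recl big_ord0 addr0 addrA; congr (f _ + f _ + f _); exact: val_inj.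
Qed.

Lemma spin_mxE u : spin_mx u =
  mx22 (u 0 2%:R) (u 0 0 - iC * u 0 1) (u 0 0 + iC * u 0 1) (- u 0 2%:R).
Proof.
rewrite /spin_mx sum_ord3 /pauli /= !mx22Z !mx22D; congr mx22; try by ring.
  have -> : 0 -i* 1 = - iC :> C by apply: eq_ReIm => /=; rewrite ?oppr0.
  by ring.
Qed.

Lemma spin_mxD u w : spin_mx (u + w) = spin_mx u + spin_mx w.
Proof. by rewrite !spin_mxE mx22D !mxE; congr mx22; ring. Qed.

Lemma spin_mxZ (c : C) u : spin_mx (c *: u) = c *: spin_mx u.
Proof. by rewrite !spin_mxE mx22Z !mxE; congr mx22; ring. Qed.

Lemma spin_mx0 : spin_mx 0 = 0 :> 'M[C]_2.
Proof. by rewrite -(scale0r (0 : 'rV[C]_3)) spin_mxZ scale0r. Qed.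

Lemma spin_mx_sum (I : Type) (r : seq I) (f : I -> 'rV[C]_3) :
  spin_mx (\sum_(i <- r) f i) = \sum_(i <- r) spin_mx (f i).
Proof. by apply: (big_morph _ spin_mxD spin_mx0). Qed.

Lemma spin_mx_sqr u : spin_mx u * spin_mx u = (\sum_i u 0 i ^+ 2) *: 1.
Proof.
rewrite spin_mxE mx22M mx22_1 mx22Z sum_ord3.
have h (a b : C) : (a - iC * b) * (a + iC * b) = a ^+ 2 + b ^+ 2.
  have -> : (a - iC * b) * (a + iC * b) = a ^+ 2 - (iC * iC) * b ^+ 2 by ring.
  by rewrite iC2; ring.
congr mx22; [rewrite h|idtac|idtac|rewrite [X in X + _]mulrC h]; ring.
Qed.

Lemma spin_mx_conj u : spin_mx (map_mx conjc u) = map_mx conjc (spin_mx u)^T.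
Proof.
have h (a b : C) : (a - iC * b)^* = a^* + iC * b^*.
  by rewrite rmorphB rmorphM /=; apply: eq_ReIm; rewrite /= !(cReD, cReN, cImD, cImN) ?cReM ?cImM /=; ring.
have h' (a b : C) : (a + iC * b)^* = a^* - iC * b^*.
  by rewrite rmorphD rmorphM /=; apply: eq_ReIm; rewrite /= !(cReD, cReN, cImD, cImN) ?cReM ?cImM /=; ring.
rewrite !spin_mxE; apply/matrixP => i j; rewrite !mxE.
case: i => [[|[|]]]//= ?; case: j => [[|[|]]]//= ?; rewrite ?h ?h' ?rmorphN//.
Qed.

Definition cast_row (u : 'rV[R]_3) : 'rV[C]_3 := map_mx (fun r => r%:C) u.

Lemma comm_spin_mx (u w : 'rV[R]_3) :
  comm (spin_mx (cast_row u)) (spin_mx (cast_row w)) = (2 * iC) *: spin_mx (cast_row (crossmul u w)).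
Proof.
rewrite /comm !spin_mxE !mx22M mx22B mx22Z !mxE.
have -> : (0 : 'I_3) + 1 = 1 by exact: val_inj.
have -> : (0 : 'I_3) + 2%:R = 2%:R by exact: val_inj.
have -> : (1 : 'I_3) + 1 = 2%:R by exact: val_inj.
have -> : (1 : 'I_3) + 2%:R = 0 by exact: val_inj.
have -> : (2%:R : 'I_3) + 1 = 0 by exact: val_inj.
have -> : (2%:R : 'I_3) + 2%:R = 1 by exact: val_inj.
rewrite !rmorphB !rmorphM /=.
move: (u 0 0)%:C (u 0 1)%:C (u 0 2%:R)%:C (w 0 0)%:C (w 0 1)%:C (w 0 2%:R)%:C => u0 u1 u2 w0 w1 w2.
congr mx22; try ring.
- have -> : 2 * iC * (u1 * w2 - u2 * w1 - iC * (u2 * w0 - u0 * w2)) =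
    2 * iC * (u1 * w2 - u2 * w1) - 2 * (iC * iC) * (u2 * w0 - u0 * w2) by ring.
  by rewrite iC2; ring.
- have -> : 2 * iC * (u1 * w2 - u2 * w1 + iC * (u2 * w0 - u0 * w2)) =
    2 * iC * (u1 * w2 - u2 * w1) + 2 * (iC * iC) * (u2 * w0 - u0 * w2) by ring.
  by rewrite iC2; ring.
Qed.

End Spin.

(** * Residue equations of a rational solution *)

Section FromPDE.
Context {R : realType}.
Local Notation C := R[i].
Local Notation iC := (0 +i* 1 : R[i]).
Variables (N : nat) (m : R -> R -> 'rV[R]_3) (minf : 'rV[R]_3)
  (s : 'I_N -> R -> 'rV[R[i]]_3) (x : 'I_N -> R -> R[i]).
Hypothesis hm : rational_solution m minf s x.

Definition upper (k : 'I_N + 'I_N) : bool := if k is inl _ then true else false.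

Definition all_poles (k : 'I_N + 'I_N) (t : R) : C :=
  match k with inl j => x j t | inr j => conjc (x j t) end.

Definition all_poles' (k : 'I_N + 'I_N) (t : R) : C :=
  match k with inl j => cderive (x j) t | inr j => conjc (cderive (x j) t) end.

Definition all_residues (k : 'I_N + 'I_N) (t : R) : 'rV[C]_3 :=
  match k with inl j => s j t | inr j => map_mx conjc (s j t) end.

Definition all_residues' (k : 'I_N + 'I_N) (t : R) : 'rV[C]_3 :=
  match k with
  | inl j => \row_i cderive (fun u => s j u 0 i) t
  | inr j => \row_i conjc (cderive (fun u => s j u 0 i) t) end.

Lemma all_poles_nonreal k t : Im (all_poles k t) != 0.
Proof.
have h j : Im (x j t) != 0 by rewrite gt_eqF// (rational_pole hm).
by case: k => j //=; rewrite cImJ oppr_eq0.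
Qed.

Lemma all_poles_inj t : injective (all_poles^~ t).
Proof.
move=> [j|j] [k|k] /= e.
- by congr inl; exact: (rational_distinct hm e).
- have := rational_pole hm j t; rewrite e cImJ oppr_gt0 => h.
  by have := lt_trans h (rational_pole hm k t); rewrite ltxx.
- have := rational_pole hm k t; rewrite -e cImJ oppr_gt0 => h.
  by have := lt_trans h (rational_pole hm j t); rewrite ltxx.
- congr inr; apply: (rational_distinct hm (t := t)).
  by apply: (can_inj (@conjcK R)).
Qed.

Lemma has_cderive_all_poles k t : has_cderive (all_poles k) t (all_poles' k t).
Proof.
have h j : has_cderive (x j) t (cderive (x j) t).
  by apply: cderivableP; exact: (rational_derivable_pole hm).
by case: k => j; [exact: h|exact: (has_cderiveJ (h j))].
Qed.

Lemma has_cderive_all_residues k i t :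
  has_cderive (fun u => all_residues k u 0 i) t (all_residues' k t 0 i).
Proof.
have h j : has_cderive (fun u => s j u 0 i) t (cderive (fun u => s j u 0 i) t).
  by apply: cderivableP; exact: (rational_derivable_residue hm).
case: k => j /=; rewrite mxE; first exact: h.
by under eq_fun do rewrite mxE; exact: (has_cderiveJ (h j)).
Qed.

Lemma rational_form_cast t (y : R) : cast_row (m t y) =
  cast_row minf + \sum_k (y%:C - all_poles k t)^-1 *: all_residues k t.
Proof. by rewrite /cast_row (rational_form hm) big_sumType /= addrA. Qed.

Lemma sphere_sqr (u : 'rV[R]_3) : on_sphere u -> spin_mx (cast_row u) * spin_mx (cast_row u) = 1.
Proof.
move=> h; rewrite spin_mx_sqr -[RHS]scale1r; congr (_ *: _).
rewrite -[RHS](rmorph1 (real_complex R)) -h rmorph_sum.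
by apply: eq_bigr => i _; rewrite mxE rmorphXn.
Qed.

Lemma spin_form t (y : R) : spin_mx (cast_row (m t y)) =
  spin_mx (cast_row minf) + \sum_k (y%:C - all_poles k t)^-1 *: spin_mx (all_residues k t).
Proof.
rewrite rational_form_cast spin_mxD spin_mx_sum; congr (_ + _).
by apply: eq_bigr => k _; rewrite spin_mxZ.
Qed.

Lemma rational_entry t (y : R) i : m t y 0 i =
  minf 0 i + 2 * Re (\sum_j (y%:C - x j t)^-1 * s j t 0 i).
Proof.
have := congr1 (fun u : 'rV[C]_3 => Re (u 0 i)) (rational_form_cast t y).
rewrite /cast_row !mxE /= cReD cReC => ->; congr (_ + _).
rewrite summxE big_sumType/= cReD mulr_natl mulr2n; congr (_ + _).
  by congr Re; apply: eq_bigr => j _; rewrite mxE.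
rewrite -(cReJ (\sum_j (y%:C - x j t)^-1 * _)) rmorph_sum; congr Re; apply: eq_bigr => j _.
by rewrite !mxE rmorphM fmorphV rmorphB /= oppr0.
Qed.

Lemma conjc_double_pole (y : R) (S X : C) : Im X != 0 ->
  2^-1 * conjc (iC * ((- 2 * S) / (y%:C - X) ^+ 2)) =
  - iC * (-1 * ((y%:C - conjc X) ^+ 2)^-1) * conjc S.
Proof.
move=> hX; set d := y%:C - X.
have -> : conjc (iC * ((- 2 * S) / d ^+ 2)) = conjc iC * (- conjc 2 * conjc S / conjc d ^+ 2).
  by rewrite !(rmorphM, rmorphXn, fmorphV, rmorphN).
have -> : conjc iC = - iC :> C by apply: eq_ReIm; rewrite /= ?oppr0.
have -> : conjc 2 = 2 :> C by apply: eq_ReIm; rewrite /= ?addr0 ?oppr0.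
have -> : conjc d = y%:C - conjc X by apply: eq_ReIm; rewrite /d !(cReJ, cReD, cReN, cReC, cImJ, cImD, cImN, cImC) ?sub0r.
have n0 : y%:C - conjc X != 0 by apply: sub_nonreal_neq0; rewrite cImJ oppr_eq0.
by field.
Qed.

(** The derivative of [m] is twice the real part of a sum of double poles, on which the Hilbert
    transform is multiplication by i. Writing the real part as half the sum with the conjugate makes
    the lower poles appear with the opposite sign. *)
Lemma absgrad_entry t (y : R) w : is_absgrad (m t) y w -> forall i,
  (w 0 i)%:C = \sum_k (- iC * (eps upper k * ((y%:C - all_poles k t) ^+ 2)^-1)) * all_residues k t 0 i.
Proof.
move=> h i; have := h i.
have zn j : Im (x j t) != 0 by exact: (all_poles_nonreal (inl j)).
have -> : (fun y => m t y 0 i)^`()%classic =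
    (fun y => Re (\sum_j (- 2 * s j t 0 i) / (y%:C - x j t) ^+ 2)).
  apply/funext => u; rewrite derive1E; apply: derive_val.
  under eq_fun do rewrite rational_entry.
  have hd : has_cderive (fun y : R => \sum_j (y%:C - x j t)^-1 * s j t 0 i) u
     (\sum_j - ((u%:C - x j t) ^+ 2)^-1 * s j t 0 i).
    apply: has_cderive_sum => j _; apply: has_cderive_eq.
      apply: has_cderiveM; last exact: has_cderive_cst.
      exact: has_cderive_pole (zn j).
    by rewrite mulr0 addr0 /pole exprVn.
  apply: (is_derive_eq (is_deriveD (is_derive_cst (minf 0 i) u 1) (is_deriveZ (2 : R) hd.1))).
  rewrite add0r /GRing.scale/= mulr_natl mulr2n -cReD -big_split; congr Re.
  by apply: eq_bigr => j _ /=; ring.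
move=> /(is_hilbert_double_pole (rational_pole hm ^~ t)) ->.
set Z := iC * _; have -> : (Re Z)%:C = 2^-1 * (Z + conjc Z).
  by apply: eq_ReIm; rewrite /Z; case: (iC * _) => a b; rewrite ?cReM ?cImM /=; field.
rewrite big_sumType /= mulrDr /Z; congr (_ + _).
  rewrite !mulr_sumr; apply: eq_bigr => j _; rewrite /eps /=.
  by have := sub_nonreal_neq0 y (zn j) => n0; field.
rewrite !mulr_sumr rmorph_sum mulr_sumr; apply: eq_bigr => j _; rewrite /eps /= mxE.
exact: conjc_double_pole.
Qed.

(** The commutator of Pauli forms is 2 i times the cross product, and |nabla| contributes - i in
    [e2]; their quotient is the constant - 1/2. *)
Lemma spin_evolution t (y : R) :
  \sum_k ((y%:C - all_poles k t)^-1 *: spin_mx (all_residues' k t) +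
          ((y%:C - all_poles k t) ^+ 2)^-1 *: (all_poles' k t *: spin_mx (all_residues k t))) =
  (- 2^-1) *: comm (spin_mx (cast_row minf) +
      \sum_k (y%:C - all_poles k t)^-1 *: spin_mx (all_residues k t))
    (\sum_k ((y%:C - all_poles k t) ^+ 2)^-1 *: (eps upper k *: spin_mx (all_residues k t))).
Proof.
have [w [hw dw]] := (rational_hwm hm).2 t y.
have pn k : y%:C - all_poles k t != 0 by apply: sub_nonreal_neq0; exact: all_poles_nonreal.
have e1 : cast_row (crossmul (m t y) w) =
   \sum_k ((y%:C - all_poles k t)^-1 *: all_residues' k t +
          ((y%:C - all_poles k t) ^+ 2)^-1 *: (all_poles' k t *: all_residues k t)).
  apply/rowP => i; rewrite mxE summxE.
  apply: (@has_cderive_unique _ (fun u => (m u y 0 i)%:C) t).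
    by apply: has_cderive_real; exact: dw.
  apply: (@has_cderive_ext _ (fun u => (minf 0 i)%:C +
    \sum_k (y%:C - all_poles k u)^-1 * all_residues k u 0 i)).
    move=> u; have := congr1 (fun u : 'rV[C]_3 => u 0 i) (rational_form_cast u y).
    rewrite /cast_row !mxE summxE => ->; congr (_ + _).
    by apply: eq_bigr => k _; rewrite mxE.
  rewrite -[X in has_cderive _ _ X]add0r.
  apply: has_cderiveD; first exact: has_cderive_cst.
  apply: has_cderive_sum => k _; apply: has_cderive_eq.
    apply: has_cderiveM; last exact: has_cderive_all_residues.
    apply: has_cderiveV; first exact: pn.
    by apply: has_cderiveB; [exact: has_cderive_cst|exact: has_cderive_all_poles].
  rewrite !mxE sub0r opprK.
  by have := pn k => h; field.
have e2 : spin_mx (cast_row w) = (- iC) *: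
    \sum_k ((y%:C - all_poles k t) ^+ 2)^-1 *: (eps upper k *: spin_mx (all_residues k t)).
  have -> : cast_row w = \sum_k (- iC * (eps upper k * ((y%:C - all_poles k t) ^+ 2)^-1))
      *: all_residues k t.
    apply/rowP => i; rewrite mxE (absgrad_entry hw) summxE.
    by apply: eq_bigr => k _; rewrite mxE.
  rewrite spin_mx_sum scaler_sumr; apply: eq_bigr => k _.
  by rewrite spin_mxZ !scalerA; congr (_ *: _); ring.
have e3 := comm_spin_mx (m t y) w.
rewrite e2 spin_form e1 spin_mx_sum in e3.
have -> : \sum_k ((y%:C - all_poles k t)^-1 *: spin_mx (all_residues' k t) +
          ((y%:C - all_poles k t) ^+ 2)^-1 *: (all_poles' k t *: spin_mx (all_residues k t))) =
  \sum_k spin_mx ((y%:C - all_poles k t)^-1 *: all_residues' k t +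
          ((y%:C - all_poles k t) ^+ 2)^-1 *: (all_poles' k t *: all_residues k t)).
  by apply: eq_bigr => k _; rewrite spin_mxD !spin_mxZ.
move: e3; set W := \sum_k _ *: (eps _ _ *: _); set S := \sum_k spin_mx _; set M := _ + _.
have commZ (c : C) (X Y : 'M[C]_2) : comm X (c *: Y) = c *: comm X Y.
  by rewrite /comm scalerBr scalerAr scalerAl.
rewrite commZ => e3.
have i2 : (2 * iC) != 0 by rewrite mulf_neq0 ?iC_neq0// pnatr_eq0.
apply: (scalerI i2); rewrite -e3 scalerA; congr (_ *: _).
by field.
Qed.

Lemma pde_sphere t k :
  spin_mx (all_residues k t) * regular (all_poles^~ t) (spin_mx (cast_row minf))
    (fun k => spin_mx (all_residues k t)) k +
  regular (all_poles^~ t) (spin_mx (cast_row minf)) (fun k => spin_mx (all_residues k t)) k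
    * spin_mx (all_residues k t) = 0 /\
  spin_mx (all_residues k t) * spin_mx (all_residues k t) = 0.
Proof.
apply: (sphere_residues (@all_poles_inj t) (all_poles_nonreal ^~ t)).
  exact: sphere_sqr (rational_minf hm).
by move=> y; rewrite -!spin_form; exact: sphere_sqr ((rational_hwm hm).1 t y).
Qed.

Lemma pde_evolution t k :
  spin_mx (all_residues' k t) = (- 2^-1) *: \sum_l ((eps upper k + eps upper l) *
      ipole (all_poles^~ t) k l ^+ 2) *: comm (spin_mx (all_residues k t)) (spin_mx (all_residues l t)) /\
  all_poles' k t *: spin_mx (all_residues k t) = (- (2^-1 * eps upper k)) *:
    comm (regular (all_poles^~ t) (spin_mx (cast_row minf)) (fun k => spin_mx (all_residues k t)) k)
      (spin_mx (all_residues k t)).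
Proof.
exact: (evolution_residues (@all_poles_inj t) (all_poles_nonreal ^~ t) (spin_evolution t)).
Qed.

Lemma has_mderive_spin k t :
  has_mderive (fun u => spin_mx (all_residues k u)) t (spin_mx (all_residues' k t)).
Proof.
have D a := @has_cderive_all_residues k a t.
move=> i j; rewrite spin_mxE.
apply: (@has_cderive_ext _ (fun u => mx22 (all_residues k u 0 2%:R)
  (all_residues k u 0 0 - iC * all_residues k u 0 1)
  (all_residues k u 0 0 + iC * all_residues k u 0 1) (- all_residues k u 0 2%:R) i j)).
  by move=> u; rewrite spin_mxE.
have Di a : has_cderive (fun u => iC * all_residues k u 0 a) t (iC * all_residues' k t 0 a).
  rewrite -[X in has_cderive _ _ X]add0r -[X in X + _](mul0r (all_residues k t 0 a)).
  by apply: has_cderiveM; [exact: has_cderive_cst|exact: D].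
rewrite mxE; under eq_fun do rewrite mxE.
case: i => [[|[|]]]//= ?; case: j => [[|[|]]]//= ?.
- exact: has_cderiveB.
- exact: has_cderiveD.
- exact: has_cderiveN.
Qed.

(** The orbit sum is the same at times [T] and 0: at [T] it is the moment of the residues, at 0 it
    involves initial data only. *)
Lemma residue_moments T n :
  \sum_j x j T ^+ n *: spin_mx (s j T) =
  \sum_j lax_orbit upper (spin_mx (cast_row minf)) all_poles
     (fun k t => spin_mx (all_residues k t)) T n (inl j) 0.
Proof.
have h := lax_orbit_moment all_poles_inj has_cderive_all_poles has_mderive_spin
  (fun k t => (pde_sphere t k).2) (fun k t => (pde_sphere t k).1)
  (fun k t => (pde_evolution t k).2) (fun k t => (pde_evolution t k).1) T n T 0.
move: h; rewrite !big_sumType /posC /=.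
rewrite [X in _ + X = _ -> _]big1 ?addr0 => [|j _]; last by rewrite mulr0n scale0r.
rewrite [X in _ = _ + X -> _]big1 ?addr0 => [|j _]; last by rewrite mulr0n scale0r.
under eq_bigr do rewrite mulr1n scale1r.
under [X in _ = X -> _]eq_bigr do rewrite mulr1n scale1r.
by move=> <-; apply: eq_bigr => j _; rewrite lax_orbit_final.
Qed.

End FromPDE.

Lemma Cayley_Hamilton_sum (R : comNzRingType) n (Z : 'M[R]_n) :
  \sum_(i < size (char_poly Z)) (char_poly Z)`_i *: Z ^+ i = 0.
Proof.
(* [horner_mx] requires a positive size, hence the separate empty case. *)
case: n Z => [Z|n Z]; first by rewrite [LHS]flatmx0 [RHS]flatmx0.
rewrite -[RHS](Cayley_Hamilton Z) -[X in horner_mx _ X]coefK poly_def rmorph_sum.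
apply: eq_bigr => i _; rewrite -mul_polyC rmorphM rmorphXn /=.
by rewrite horner_mx_C horner_mx_X; exact: (esym (mul_scalar_mx _ _)).
Qed.

(** * Spectral asymptotics *)

Section SpectralMoments.
Variables (F : fieldType) (N : nat) (x : 'I_N -> F).
Hypothesis x_inj : injective x.

(** Injectivity of the Vandermonde system, by testing against the polynomial that vanishes at every
    [x l] except [x k]. *)
Lemma moments_eq0 m n (c : 'I_N -> 'M[F]_(m, n)) :
  (forall i, \sum_k x k ^+ i *: c k = 0) -> forall k, c k = 0.
Proof.
move=> h k.
have hq (q : {poly F}) : \sum_l q.[x l] *: c l = 0.
  transitivity (\sum_(i < size q) q`_i *: \sum_l x l ^+ i *: c l); last first.
    by rewrite big1 // => i _; rewrite h scaler0.
  under [RHS]eq_bigr do rewrite scaler_sumr; rewrite exchange_big.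
  apply: eq_bigr => l _; rewrite horner_coef scaler_suml.
  by apply: eq_bigr => i _; rewrite scalerA.
have := hq (\prod_(l | l != k) ('X - (x l)%:P)).
rewrite (bigD1 k)//= [X in _ + X]big1 ?addr0 => [|l lk]; last first.
  by rewrite horner_prod (bigD1 l)//= hornerXsubC subrr mul0r scale0r.
move/eqP; rewrite scaler_eq0 => /orP[|/eqP//].
rewrite horner_prod prodf_seq_eq0 => /hasP[l _ /andP[lk]].
by rewrite hornerXsubC subr_eq0 (inj_eq x_inj) eq_sym (negPf lk).
Qed.

Variables (m n : nat) (c : 'I_N -> 'M[F]_(m, n)).
Variables (Z : 'M[F]_N) (E : 'M[F]_(m, N)) (X : 'M[F]_(N, n)).
Hypothesis moments : forall i, \sum_k x k ^+ i *: c k = E *m (Z ^+ i) *m X.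

(** Combining moments with the coefficients of the characteristic polynomial q gives 0 by
    Cayley-Hamilton, so all moments of the family q(x_l) c_l vanish. *)
Lemma moments_eigenvalue k : c k != 0 -> eigenvalue Z (x k).
Proof.
move=> ck; rewrite eigenvalue_root_char; apply: contra_neqT ck => qk.
set q := char_poly Z in qk.
have Zq : \sum_(i < size q) q`_i *: Z ^+ i = 0 by exact: Cayley_Hamilton_sum.
apply: (scalerI qk); rewrite scaler0.
apply: (moments_eq0 (c := fun l => q.[x l] *: c l)) => j {qk}.
transitivity (E *m ((\sum_(i < size q) q`_i *: Z ^+ i) *m (Z ^+ j)) *m X); last first.
  by rewrite Zq mul0mx mulmx0 mul0mx.
rewrite mulmx_suml mulmx_sumr mulmx_suml.
transitivity (\sum_(i < size q) q`_i *: \sum_l x l ^+ (i + j) *: c l); last first.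
  apply: eq_bigr => i _; rewrite moments exprD -scalemxAl -scalemxAr -scalemxAl.
  by rewrite mulmxE.
under [RHS]eq_bigr do rewrite scaler_sumr; rewrite exchange_big.
apply: eq_bigr => l _; rewrite horner_coef scaler_suml scaler_sumr.
by apply: eq_bigr => i _; rewrite !scalerA exprD; congr (_ *: _); ring.
Qed.

(** Dual bases of eigenvectors resolve the identity, so the spectral projections produce a family
    with the same moments. *)
Lemma moments_residue (u : 'I_N -> 'rV[F]_N) (w : 'I_N -> 'cV[F]_N) :
  (forall k l, u k *m w l = (k == l)%:R%:M) -> (forall k, Z *m w k = x k *: w k) ->
  forall k, c k = E *m (w k *m u k) *m X.
Proof.
move=> uw Zw k; apply/eqP; rewrite -subr_eq0; apply/eqP.
apply: (moments_eq0 (c := fun k => c k - E *m (w k *m u k) *m X)) => i {k}.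
under eq_bigr do rewrite scalerBr; rewrite sumrB moments.
have ZwX k : Z ^+ i *m w k = x k ^+ i *: w k.
  elim: i => [|i IH]; first by rewrite !expr0 mul1mx scale1r.
  by rewrite exprSr -[_ * Z]/(_ *m Z) -mulmxA Zw -scalemxAr IH scalerA exprS.
have id : \sum_k w k *m u k = 1%:M.
  pose U := \matrix_k u k; pose W := (\matrix_k (w k)^T)^T.
  have UW : U *m W = 1%:M.
    apply/matrixP => k l; rewrite !mxE -[RHS](_ : (u k *m w l) 0 0 = _); last first.
      by rewrite uw !mxE eqxx mulr1n.
    by rewrite !mxE; apply: eq_bigr => j _; rewrite !mxE.
  rewrite -(mulmx1C UW); apply/matrixP => a b; rewrite summxE !mxE.
  by apply: eq_bigr => k _; rewrite mxE big_ord1 !mxE.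
apply/eqP; rewrite subr_eq0; apply/eqP.
rewrite -[Z ^+ i]mulmx1 -id mulmx_sumr mulmx_sumr mulmx_suml.
by apply: eq_bigr => k _; rewrite (mulmxA (Z ^+ i)) ZwX -scalemxAl -scalemxAr -scalemxAl.
Qed.

End SpectralMoments.

(** * Localization of one eigenvector for large time *)

Section Localization.
Context {R : realType}.
Local Notation C := R[i].
Variables (N : nat) (v : 'I_N -> C).
Hypothesis v_inj : injective v.
Local Notation J := (diag_mx (\row_j v j)).

Lemma separation_gap : exists2 g : R, 0 < g & forall l j, l != j -> g <= normc (v l - v j).
Proof.
(* The diagonal terms are [0^-1 = 0], and the bound [(1 + S)^-1] is positive for every N. *)
pose S := \sum_l \sum_j (normc (v l - v j))^-1.
have S0 : 0 <= S by do 2!(apply: sumr_ge0 => ? _); rewrite invr_ge0 normc_ge0.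
exists (1 + S)^-1; first by rewrite invr_gt0 ltr_wpDr.
move=> l j lj; have n0 : 0 < normc (v l - v j).
  rewrite lt_neqAle normc_ge0 andbT eq_sym; apply: contra lj => /eqP e.
  by rewrite -(inj_eq v_inj) -subr_eq0; apply/eqP/ComplexField.Normc.eq0_normc.
rewrite -[leRHS]invrK lef_pV2 ?posrE ?invr_gt0//; last by rewrite ltr_wpDr.
apply: le_trans (_ : S <= _); last by rewrite lerDr.
have nn a b : 0 <= (normc (v a - v b))^-1 by rewrite invr_ge0 normc_ge0.
apply: le_trans (_ : \sum_k (normc (v l - v k))^-1 <= _).
  by rewrite (bigD1 j)//= lerDl sumr_ge0.
by rewrite /S [leRHS](bigD1 l)//= lerDl; do 2!apply: sumr_ge0 => ? _.
Qed.

(** Normalizing at the largest entry [l] keeps [z] within a fixed distance of v_l t. For large |t|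
    it is then far from every other v_j t, so the other entries are small, and the equation at [l]
    yields the shift [Y l l]. *)
Lemma eigenvector_localization (Y : 'M[C]_N) (e : R) : 0 < e ->
  exists2 T : R, 0 < T & forall (t : R) (z : C), T <= `|t| ->
    eigenvalue (Y + t%:C *: J) z ->
    exists (u : 'rV[C]_N) (l : 'I_N), [/\ u *m (Y + t%:C *: J) = z *: u, u 0 l = 1,
      forall j, j != l -> normc (u 0 j) <= e
      & normc (z - v l * t%:C - Y l l) <= e].
Proof.
move=> e0; have [g g0 gap] := separation_gap.
pose B := \sum_i \sum_j normc (Y i j).
have B0 : 0 <= B by do 2!(apply: sumr_ge0 => ? _); rewrite normc_ge0.
have colB j : \sum_i normc (Y i j) <= B.
  apply: ler_sum => i _; rewrite (bigD1 j)//= lerDl; apply: sumr_ge0 => ? _; exact: normc_ge0.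
(* A distance from [z] to the other v_j t that makes [B / D <= e / (1 + B)]. *)
pose D := B * (1 + B) / e + 1.
have D0 : 0 < D by rewrite ltr_wpDl// divr_ge0 ?mulr_ge0 ?addr_ge0// ltW.
exists ((D + B) / g) => [|t z tT]; first by rewrite divr_gt0// ltr_wpDr.
move=> /eigenvalueP[u0 u0z u0n].
have [l0 l0n] : exists l, u0 0 l != 0.
  apply/existsP; apply: contraNT u0n; rewrite negb_exists => /forallP h.
  by apply/eqP/rowP => l; rewrite mxE; apply/eqP; have := h l; rewrite negbK.
case: (@Order.TotalTheory.arg_maxP _ _ _ l0 xpredT (fun l => normc (u0 0 l)) isT) => l _ lmax.
have ul : u0 0 l != 0.
  apply/negP => /eqP h; have := lmax l0 isT.
  rewrite h ComplexField.Normc.normc0 => h2; move: l0n.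
  rewrite (ComplexField.Normc.eq0_normc (x := u0 0 l0)) ?eqxx//.
  by apply: le_anti; apply/andP; split; [exact: h2|exact: normc_ge0].
pose u := (u0 0 l)^-1 *: u0.
have ul1 : u 0 l = 1 by rewrite mxE mulVf.
have ule j : normc (u 0 j) <= 1.
  rewrite mxE normcM ComplexField.Normc.normcV mulrC ler_pdivrMr ?mul1r; first exact: lmax.
  rewrite lt_neqAle normc_ge0 andbT eq_sym; apply: contra ul => /eqP h.
  by apply/eqP/ComplexField.Normc.eq0_normc.
have uz : u *m (Y + t%:C *: J) = z *: u.
  by rewrite -scalemxAl u0z !scalerA mulrC.
clearbody u.
have eqn j : (z - v j * t%:C) * u 0 j = \sum_i u 0 i * Y i j.
  have := congr1 (fun M : 'rV[C]_N => M 0 j) uz; rewrite mulmxDr -scalemxAr !mxE.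
  rewrite [X in _ + _ * X](_ : _ = u 0 j * v j); last first.
    rewrite (bigD1 j)//= big1 ?addr0 ?mxE ?eqxx ?mulr1n// => i ij.
    by rewrite !mxE (negPf ij) mulr0n mulr0.
  by rewrite mulrBl => <-; ring.
have sumB j : normc (\sum_i u 0 i * Y i j) <= B.
  apply: le_trans (colB j); apply: normc_sum_le => i.
  by rewrite normcM ler_piMl ?normc_ge0.
have zl : normc (z - v l * t%:C) <= B.
  by have := sumB l; rewrite -eqn ul1 mulr1.
have small j : j != l -> normc (u 0 j) <= e / (1 + B).
  move=> jl; have zj : D <= normc (z - v j * t%:C).
    have h1 : normc ((v l - v j) * t%:C) <= normc (z - v j * t%:C) + normc (z - v l * t%:C).
      rewrite -[normc (z - v l * _)]normcN'; apply: le_trans (normcD _ _).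
      by rewrite (_ : (v l - v j) * t%:C = z - v j * t%:C + - (z - v l * t%:C))//; ring.
    have h2 : D + B <= normc ((v l - v j) * t%:C).
      rewrite normcM normc_real.
      have h3 : g * `|t| <= normc (v l - v j) * `|t|.
        by rewrite ler_wpM2r// gap// eq_sym.
      by apply: le_trans h3; rewrite mulrC -ler_pdivrMr.
    by move: (le_trans h2 h1) zl; lra.
  have h : D * normc (u 0 j) <= B.
    apply: le_trans (sumB j); by rewrite -eqn normcM ler_wpM2r// normc_ge0.
  rewrite ler_pdivlMr; last by rewrite ltr_wpDr.
  have h2 : e * D = B * (1 + B) + e by rewrite /D; field; rewrite gt_eqF.
  rewrite -(ler_pM2l D0) mulrA (mulrC D e) h2.
  apply: le_trans (_ : B * (1 + B) <= _); last by rewrite lerDl ltW.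
  by rewrite ler_wpM2r// addr_ge0.
have B1 : 0 < 1 + B by rewrite ltr_wpDr.
exists u, l; split => //.
  move=> j jl; apply: le_trans (small j jl) _.
  by rewrite ler_pdivrMr// mulrDr mulr1 lerDl mulr_ge0// ltW.
have -> : z - v l * t%:C - Y l l = \sum_(i | i != l) u 0 i * Y i l.
  by have := eqn l; rewrite ul1 mulr1 => ->; rewrite (bigD1 l)//= ul1 mul1r addrAC subrr add0r.
rewrite big_mkcond; apply: le_trans (normc_sum_le (g := fun i => e / (1 + B) * normc (Y i l)) _) _.
  move=> i; case: ifP => [il|_]; first by rewrite normcM ler_wpM2r ?normc_ge0 ?small.
  by rewrite ComplexField.Normc.normc0 mulr_ge0 ?normc_ge0// divr_ge0 ?ltW.
rewrite -mulr_sumr; apply: le_trans (_ : e / (1 + B) * B <= _).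
  by rewrite ler_wpM2l// divr_ge0 ?ltW.
by rewrite mulrAC ler_pdivrMr// ler_wpM2l ?ltW// ltrDr.
Qed.

End Localization.

(** * Matching left and right eigenvectors *)

Section Matching.
Context {R : realType}.
Local Notation C := R[i].

Lemma eigenvalue_trmx (F : fieldType) n (A : 'M[F]_n) a : eigenvalue A^T a = eigenvalue A a.
Proof.
rewrite !eigenvalue_root_char; congr (root _ a).
rewrite /char_poly -[RHS]det_tr; congr (\det _).
by rewrite /char_poly_mx linearB/= tr_scalar_mx map_trmx.
Qed.

Variables (N : nat) (v : 'I_N -> C).
Hypothesis v_inj : injective v.
Local Notation J := (diag_mx (\row_j v j)).

Lemma normc_sub_le (a b : C) (d : R) : normc (a - b) <= d -> normc b <= d + normc a.
Proof.
move=> h; rewrite (_ : b = - (a - b) + a); last by ring.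
by apply: le_trans (normcD _ _) _; rewrite normcN' lerD2r.
Qed.

(** Left vectors come from [Y], right ones from its transpose. The gap makes both localize at the
    same index, so their pairing is near 1, while vectors of different eigenvalues pair to 0; hence
    the index map is injective and the vectors can be scaled to dual bases. *)
Lemma eigensystem_localization (Y : 'M[C]_N) (e : R) : 0 < e -> e <= 1 ->
  exists2 T : R, 0 < T & forall (t : R) (z : 'I_N -> C), T <= `|t| -> injective z ->
    (forall k, eigenvalue (Y + t%:C *: J) (z k)) ->
    exists (l : 'I_N -> 'I_N) (u : 'I_N -> 'rV[C]_N) (w : 'I_N -> 'cV[C]_N),
      [/\ injective l,
          forall j k, u j *m w k = (j == k)%:R%:M,
          forall k, (Y + t%:C *: J) *m w k = z k *: w k
        & forall k, normc (z k - v (l k) * t%:C - Y (l k) (l k)) <= e /\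
            forall p q, normc ((w k *m u k) p q - delta_mx (l k) (l k) p q) <= e].
Proof.
move=> e0 e1; have N0 : 0 < 2 * (N.+1)%:R :> R by rewrite mulr_gt0.
(* The pairing differs from 1 by at most [N%:R * d], and dividing by it at most doubles an error, so
   the total is [2 * (d + N%:R * d) = e]. *)
pose d := e / (2 * N.+1%:R); have d0 : 0 < d by rewrite divr_gt0.
have eE : e = 2 * d + 2 * N%:R * d.
  by rewrite -[LHS](@divfK _ (2 * N.+1%:R)) ?gt_eqF// -/d -natr1; ring.
have Nd0 : 0 <= N%:R * d by rewrite mulr_ge0// ltW.
have d1 : d <= 1 by lra.
have Nd : N%:R * d <= 2^-1 by lra.
have [T1 T10 loc1] := eigenvector_localization v_inj Y d0.
have [T2 T20 loc2] := eigenvector_localization v_inj Y^T d0.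
have [g g0 gap] := separation_gap v_inj.
pose S := \sum_i normc (Y i i).
have diagS i : normc (Y i i) <= S.
  by rewrite /S (bigD1 i)//= lerDl sumr_ge0 // => j _; rewrite normc_ge0.
pose T3 := (2 * d + 2 * S + 1) / g.
exists (T1 + T2 + `|T3|) => [|t z tT z_inj ez].
  by rewrite ltr_wpDr// addr_gt0.
have tT1 : T1 <= `|t|.
  by apply: le_trans tT; rewrite -addrA lerDl addr_ge0// ltW.
have tT2 : T2 <= `|t|.
  by apply: le_trans tT; rewrite addrAC lerDr addr_ge0 // ltW.
have tT3 : 2 * d + 2 * S + 1 <= g * `|t|.
  rewrite (mulrC g) -ler_pdivrMr//; apply: le_trans (ler_norm _) _.
  by apply: le_trans tT; rewrite lerDr addr_ge0// ltW.
have left_vec k : exists ul : 'rV[C]_N * 'I_N,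
    [/\ ul.1 *m (Y + t%:C *: J) = z k *: ul.1, ul.1 0 ul.2 = 1,
      forall j, j != ul.2 -> normc (ul.1 0 j) <= d
      & normc (z k - v ul.2 * t%:C - Y ul.2 ul.2) <= d].
  by have [u [l h]] := loc1 t (z k) tT1 (ez k); exists (u, l).
have right_vec k : exists ul : 'rV[C]_N * 'I_N,
    [/\ (Y + t%:C *: J) *m ul.1^T = z k *: ul.1^T, ul.1 0 ul.2 = 1,
      forall j, j != ul.2 -> normc (ul.1 0 j) <= d
      & normc (z k - v ul.2 * t%:C - Y ul.2 ul.2) <= d].
  have ZT : (Y + t%:C *: J)^T = Y^T + t%:C *: J by rewrite linearD linearZ /= tr_diag_mx.
  have [|u [l [h1 h2 h3 h4]]] := loc2 t (z k) tT2; first by rewrite -ZT eigenvalue_trmx.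
  exists (u, l); split => //=; last by move: h4; rewrite mxE.
  by rewrite -[LHS]trmxK trmx_mul trmxK ZT h1 linearZ.
have [ul hul] := choice left_vec.
have [wl hwl] := choice right_vec.
have ll k : (wl k).2 = (ul k).2.
  apply/eqP; apply: contraT => ne.
  have [_ _ _ h1] := hul k; have [_ _ _ h2] := hwl k.
  move: (gap _ _ ne) => h3.
  have h4 : g * `|t| <= normc ((v (wl k).2 - v (ul k).2) * t%:C).
    by rewrite normcM normc_real ler_wpM2r.
  have h5 : normc ((v (wl k).2 - v (ul k).2) * t%:C) <= 2 * d + 2 * S.
    rewrite (_ : _ * _ = (z k - v (ul k).2 * t%:C - Y (ul k).2 (ul k).2) -
        (z k - v (wl k).2 * t%:C - Y (wl k).2 (wl k).2) + (Y (ul k).2 (ul k).2 - Y (wl k).2 (wl k).2)); last by ring.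
    apply: le_trans (normcD _ _) _; apply: lerD; apply: le_trans (normcD _ _) _;
      rewrite normcN' mulr_natl mulr2n; exact: lerD.
  by move: tT3 h4 h5; lra.
pose sp j k : C := \sum_i (ul j).1 0 i * (wl k).1 0 i.
have sp_near j k : (ul j).2 = (ul k).2 -> normc (sp j k - 1) <= N%:R * d.
  move=> jk; have [_ h1 h2 _] := hul j; have [_ h3 h4 _] := hwl k.
  have h5 : normc (sp j k - 1) <= \sum_(i < N) d.
    rewrite /sp (bigD1 (ul j).2)//= h1 mul1r jk -ll h3 addrAC subrr add0r big_mkcond.
    apply: normc_sum_le => i; case: ifP => [il|_]; last by rewrite ComplexField.Normc.normc0 ltW.
    rewrite normcM; apply: le_trans (_ : d * 1 <= _); last by rewrite mulr1.
    apply: ler_pM; rewrite ?normc_ge0//; first by apply: h2; rewrite jk -ll.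
    exact: le_trans (h4 _ il) d1.
  by move: h5; rewrite sumr_const card_ord mulr_natl.
have sp_ge j k : (ul j).2 = (ul k).2 -> 2^-1 <= normc (sp j k).
  move=> /sp_near h; have := normc_sub_le (a := sp j k) (b := 1) h.
  have -> : normc (1 : C) = 1 by rewrite -[1]/(1%:C) normc_real normr1.
  lra.
have sp_neq0 j k : (ul j).2 = (ul k).2 -> sp j k != 0.
  move=> /sp_ge h; apply/eqP => e2; move: h; rewrite e2 ComplexField.Normc.normc0.
  by rewrite leNgt invr_gt0 ltr0n.
have spE j k : (ul j).1 *m (wl k).1^T = (sp j k)%:M.
  apply/matrixP => a b; rewrite !ord1 !mxE eqxx mulr1n.
  by apply: eq_bigr => i _; rewrite !mxE.
have sp0 j k : j != k -> sp j k = 0.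
  move=> jk; have [h1 _ _ _] := hul j; have [h2 _ _ _] := hwl k.
  have : z j *: (sp j k)%:M = z k *: (sp j k)%:M :> 'M[C]_1.
    by rewrite -!spE scalemxAl -h1 -mulmxA h2 scalemxAr.
  move/(congr1 (fun M : 'M[C]_1 => M 0 0)); rewrite !mxE eqxx mulr1n => /eqP.
  by rewrite -subr_eq0 -mulrBl mulf_eq0 subr_eq0 (inj_eq z_inj) (negPf jk) /= => /eqP.
exists (fun k => (ul k).2), (fun k => (ul k).1), (fun k => (sp k k)^-1 *: (wl k).1^T).
split.
- move=> j k jk; apply/eqP; apply: contraT => ne.
  by have := sp_neq0 _ _ jk; rewrite sp0 ?eqxx.
- move=> j k; rewrite -scalemxAr spE; case: eqVneq => [->|jk].
    by rewrite scale_scalar_mx mulVf ?sp_neq0.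
  by rewrite (sp0 _ _ jk) scale_scalar_mx mulr0.
- by move=> k; have [h _ _ _] := hwl k; rewrite -scalemxAr h !scalerA mulrC.
move=> k; have [_ h1 h2 h3] := hul k; have [_ h4 h5 _] := hwl k; split.
  by apply: le_trans h3 _; lra.
move=> p q; have s0 := sp_neq0 k k erefl.
have -> : (((sp k k)^-1 *: (wl k).1^T) *m (ul k).1) p q = (sp k k)^-1 * ((wl k).1 0 p * (ul k).1 0 q).
  by rewrite -scalemxAl !mxE big_ord1 !mxE.
rewrite mxE; set D : C := (_ && _)%:R.
have -> : (sp k k)^-1 * ((wl k).1 0 p * (ul k).1 0 q) - D =
   (sp k k)^-1 * (((wl k).1 0 p * (ul k).1 0 q - D) - (sp k k - 1) * D) by field.
have n1 : normc ((wl k).1 0 p * (ul k).1 0 q - D) <= d.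
  rewrite /D; case: (eqVneq p (ul k).2) => [->|pl] /=.
    rewrite -[X in (wl k).1 0 X]ll h4 mul1r; case: (eqVneq q (ul k).2) => [->|ql] /=.
      by rewrite h1 subrr ComplexField.Normc.normc0 ltW.
    by rewrite subr0 h2.
  rewrite subr0 normcM; apply: le_trans (_ : d * 1 <= _); last by rewrite mulr1.
  apply: ler_pM; rewrite ?normc_ge0//; first by apply: h5; rewrite ll.
  case: (eqVneq q (ul k).2) => [->|ql]; last exact: le_trans (h2 _ ql) d1.
  by rewrite h1 -[1]/(1%:C) normc_real normr1.
have n2 : normc ((sp k k - 1) * D) <= N%:R * d.
  rewrite normcM; apply: le_trans (_ : normc (sp k k - 1) * 1 <= _); last by rewrite mulr1 sp_near.
  rewrite ler_wpM2l ?normc_ge0// /D; case: (_ && _).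
    by rewrite -[true%:R]/(1%:C) normc_real normr1.
  by rewrite ComplexField.Normc.normc0.
rewrite normcM ComplexField.Normc.normcV.
have n3 : (normc (sp k k))^-1 <= 2.
  rewrite -[leRHS]invrK lef_pV2 ?posrE ?invr_gt0//; first exact: sp_ge.
  by apply: lt_le_trans (sp_ge k k erefl); rewrite invr_gt0.
apply: le_trans (_ : 2 * (d + N%:R * d) <= _); last by rewrite eE; lra.
apply: ler_pM; rewrite ?invr_ge0 ?normc_ge0//.
by apply: le_trans (normcD _ _) _; rewrite normcN' lerD.
Qed.

End Matching.

(** * Half spins *)

Section HalfSpins.
Context {R : realType}.
Local Notation C := R[i].
Variable N : nat.
Implicit Types (E F A K : 'I_N -> 'M[C]_2) (U P : 'M[C]_N).

(** Every entry of [Hmx] is 1, so [E j *m Hmx *m F j] is the rank-one product of the diagonals of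
    [E j] and [F j]. Storing the diagonals alone reduces the doubled matrices to matrices of size
    N. *)
Definition spin_row E : 'M[C]_(2, N) := \matrix_(a, j) E j a a.
Definition spin_col F : 'M[C]_(N, 2) := \matrix_(j, b) F j b b.

Lemma half_spin_entry (D D' : 'M[C]_2) a b : is_diag_mx D -> is_diag_mx D' ->
  (D *m Hmx *m D') a b = D a a * D' b b.
Proof.
move=> /is_diag_mxP dD /is_diag_mxP dD'.
rewrite mxE (bigD1 b)//= [X in _ + X]big1 ?addr0 => [|k kb]; last first.
  by rewrite [D' _ _]dD' ?mulr0.
rewrite mxE (bigD1 a)//= [X in _ + X]big1 ?addr0 => [|k ka]; last first.
  by rewrite [D _ _]dD ?mul0r// eq_sym.
by rewrite !mxE mulr1.
Qed.

Lemma half_spinsE A E F j : half_spins A E F ->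
  A j = col j (spin_row E) *m row j (spin_col F).
Proof.
move=> /(_ j)[dE dF <-]; apply/matrixP => a b.
by rewrite half_spin_entry// !mxE big_ord1 !mxE.
Qed.

Lemma spin_col_row E F j k : (spin_col F *m spin_row E) j k = diag_dot (F j) (E k).
Proof. by rewrite mxE; apply: eq_bigr => a _; rewrite !mxE. Qed.

Lemma doubledM U P : doubled U *m doubled P = doubled (U *m P).
Proof.
rewrite /doubled mul_mxblock; apply: eq_mxblock => i j.
rewrite mxE raddf_sum; apply: eq_bigr => k _.
by rewrite -scalar_mxM.
Qed.

Lemma doubled1 : doubled (1%:M : 'M[C]_N) = 1%:M.
Proof.
rewrite /doubled -mxdiagZ; apply: eq_mxblock => i j.
rewrite mxE; case: eqVneq => _; first by rewrite conform_mx_id.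
by rewrite -scalemx1 scale0r.
Qed.

Lemma doubled_unit P : P \in unitmx -> doubled P \in unitmx /\ invmx (doubled P) = doubled (invmx P).
Proof.
move=> uP; have h : doubled P *m doubled (invmx P) = 1%:M by rewrite doubledM mulmxV// doubled1.
have [uD _] := mulmx1_unit h; split => //.
by rewrite -[LHS]mulmx1 -h mulmxA mulVmx// mul1mx.
Qed.

Lemma doubled_block_col U F :
  doubled U *m block_col F = block_col (fun i => \sum_j U i j *: F j).
Proof.
rewrite /doubled /block_col mul_mxblock_mxrow; apply: eq_mxcol => i.
by apply: eq_bigr => j _; rewrite mul_scalar_mx.
Qed.

Lemma block_spin_product E F U : (forall j, is_diag_mx (E j)) -> (forall j, is_diag_mx (F j)) ->
  block_row E *m Hdiag N *m doubled U *m block_col F = spin_row E *m U *m spin_col F.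
Proof.
move=> dE dF; rewrite -mulmxA doubled_block_col /block_row /Hdiag /block_col.
rewrite mul_mxrow_mxdiag mul_mxrow_mxcol; apply/matrixP => a b.
rewrite summxE -mulmxA mxE; apply: eq_bigr => i _.
rewrite mulmx_sumr summxE !mxE mulr_sumr; apply: eq_bigr => j _.
by rewrite -scalemxAr mxE half_spin_entry// !mxE; ring.
Qed.

(** A nonzero rank-one matrix determines its two factors up to reciprocal scalars; any nonzero entry
    exhibits the scalar. *)
Lemma half_spins_gauge A E F E' F' : (forall j, A j != 0) ->
  half_spins A E F -> half_spins A E' F' ->
  exists2 c : 'I_N -> C, (forall j, c j != 0) &
    (forall j a, E' j a a = c j * E j a a) /\ (forall j b, F' j b b = (c j)^-1 * F j b b).
Proof.
move=> A0 hE hE'.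
have ent j a b : E j a a * F j b b = E' j a a * F' j b b.
  have [d1 d2 e1] := hE j; have [d3 d4 e2] := hE' j.
  by rewrite -!half_spin_entry// e1 e2.
suff H j : exists c : C, [/\ c != 0, forall a, E' j a a = c * E j a a
    & forall b, F' j b b = c^-1 * F j b b].
  by have [c hc] := choice H; exists c; last split; move=> j *; have [h1 h2 h3] := hc j.
have [a [b ab]] : exists a b, E j a a * F j b b != 0.
  apply: contrapT => h; move: (A0 j); have [d1 d2 <-] := hE j => /negP; apply.
  apply/eqP/matrixP => a b; rewrite half_spin_entry// mxE; apply/eqP; apply: contraT => ab.
  by exfalso; apply: h; exists a, b.
have [] : E j a a != 0 /\ F j b b != 0.
  by move: ab; rewrite mulf_eq0 negb_or => /andP.
have [] : E' j a a != 0 /\ F' j b b != 0.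
  by move: ab; rewrite ent mulf_eq0 negb_or => /andP.
move=> ea' fb' ea fb.
have cE : E' j a a / E j a a = F j b b / F' j b b.
  by apply/eqP; rewrite eqr_div// mulrC [X in _ == X]mulrC ent mulrC.
exists (E' j a a / E j a a); split; first by rewrite mulf_neq0 ?invr_neq0.
  move=> a'; rewrite cE; apply: (mulIf fb'); rewrite -ent; by field.
move=> b'; apply: (mulfI ea'); rewrite -ent; by field; rewrite ea ea'.
Qed.

Lemma lax0_gauge (x : 'I_N -> R -> C) E F E' F' (c : 'I_N -> C) : (forall j, c j != 0) ->
  (forall j a, E' j a a = c j * E j a a) -> (forall j b, F' j b b = (c j)^-1 * F j b b) ->
  [/\ spin_row E' = spin_row E *m diag_mx (\row_j c j),
      spin_col F' = diag_mx (\row_j (c j)^-1) *m spin_col F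
    & lax0 x E' F' = diag_mx (\row_j (c j)^-1) *m lax0 x E F *m diag_mx (\row_j c j)].
Proof.
move=> c0 hE hF; split.
- by apply/matrixP => a j; rewrite mul_mx_diag !mxE hE mulrC.
- by apply/matrixP => a j; rewrite mul_diag_mx !mxE hF.
apply/matrixP => j k; rewrite mul_mx_diag mul_diag_mx !mxE.
case: eqVneq => [->|jk]; first by rewrite mulrAC mulVf ?mul1r.
rewrite (_ : diag_dot (F' j) (E' k) = (c j)^-1 * diag_dot (F j) (E k) * c k); first by ring.
by rewrite /diag_dot mulr_sumr mulr_suml; apply: eq_bigr => i _; rewrite hE hF; ring.
Qed.

Lemma comm_diag_is_diag (v : 'I_N -> C) (Q : 'M[C]_N) : injective v ->
  diag_mx (\row_j v j) *m Q = Q *m diag_mx (\row_j v j) -> is_diag_mx Q.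
Proof.
move=> v_inj QJ; apply/is_diag_mxP => a b ab.
have := congr1 (fun M : 'M[C]_N => M a b) QJ.
rewrite mul_mx_diag mul_diag_mx !mxE => /eqP.
rewrite mulrC -subr_eq0 -mulrBr mulf_eq0 subr_eq0 (inj_eq v_inj).
by rewrite (_ : (a == b) = false) ?orbF; [move/eqP|apply/negbTE].
Qed.

Lemma diag_mx_delta_comm (Q : 'M[C]_N) j : is_diag_mx Q ->
  Q *m delta_mx j j = delta_mx j j *m Q.
Proof.
move=> /is_diag_mxP Qd; apply/matrixP => a b; rewrite !mxE.
rewrite (bigD1 j)//= big1 => [|k kj]; last by rewrite mxE (negPf kj) mulr0.
rewrite [in RHS](bigD1 j)//= [X in _ = _ + X]big1 => [|k kj]; last by rewrite mxE (negPf kj) andbF mul0r.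
rewrite !mxE eqxx !addr0 andbT /=; have [->|bj] := eqVneq b j.
  have [->|aj] := eqVneq a j; first by rewrite mulr1 mul1r.
  by rewrite Qd// !mul0r.
by rewrite mulr0 [Q j b]Qd ?mulr0// eq_sym.
Qed.

Definition spectral_residue E F P (j : 'I_N) : 'M[C]_2 :=
  spin_row E *m (P *m delta_mx j j *m invmx P) *m spin_col F.

(** The limit residues must be fixed before the half spins and [P] are given. Changing these
    conjugates [lax0] by a diagonal matrix [D]; then [invmx P *m D *m P'] commutes with [J], hence
    is diagonal since the speeds are distinct, and so commutes with the projection onto [j]. *)
Lemma spectral_residue_gauge (x : 'I_N -> R -> C) (v : 'I_N -> C) A E F P E' F' P' j :
  injective v -> (forall j, A j != 0) -> half_spins A E F -> half_spins A E' F' ->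
  P \in unitmx -> P' \in unitmx ->
  lax0 x E F = P *m diag_mx (\row_j v j) *m invmx P ->
  lax0 x E' F' = P' *m diag_mx (\row_j v j) *m invmx P' ->
  spectral_residue E' F' P' j = spectral_residue E F P j.
Proof.
move=> v_inj A0 hE hE' uP uP' eL eL'.
have [c c0 [cE cF]] := half_spins_gauge A0 hE hE'.
have [rE rF rL] := lax0_gauge x c0 cE cF.
set D := diag_mx (\row_j c j) in rE rL; set D' := diag_mx (\row_j (c j)^-1) in rF rL.
have DD : D *m D' = 1%:M.
  apply/matrixP => a b; rewrite mul_diag_mx !mxE.
  by case: eqVneq => [->|_]; rewrite ?mulr1n ?mulr0n ?mulr0// mulfV.
set J := diag_mx _ in eL eL'.
pose Q := invmx P *m D *m P'.
have QJ : J *m Q = Q *m J.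
  have h : D *m (lax0 x E' F') = lax0 x E F *m D.
    by rewrite rL !mulmxA DD mul1mx.
  transitivity (invmx P *m (lax0 x E F *m D) *m P').
    by rewrite eL /Q !mulmxA (mulVmx uP) mul1mx.
  by rewrite -h eL' /Q !mulmxA -(mulmxA _ (invmx P') P') (mulVmx uP') mulmx1.
have Qd : is_diag_mx Q by exact: (comm_diag_is_diag v_inj QJ).
have Qj := diag_mx_delta_comm j Qd.
have e1 : D *m P' = P *m Q by rewrite /Q !mulmxA mulmxV// mul1mx.
have e2 : Q *m invmx P' *m D' = invmx P.
  by rewrite /Q -(mulmxA _ P') mulmxV// mulmx1 -mulmxA DD mulmx1.
clearbody Q.
have key : D *m (P' *m delta_mx j j *m invmx P') *m D' = P *m delta_mx j j *m invmx P.
  by rewrite !mulmxA e1 -(mulmxA P Q) Qj !mulmxA -(mulmxA _ Q) -(mulmxA _ (Q *m _)) e2.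
by rewrite /spectral_residue rE rF -key !mulmxA.
Qed.

End HalfSpins.

(** * Moments in terms of the half spins at time 0 *)

Section MomentFlow.
Context {R : realType}.
Local Notation C := R[i].
Variables (N : nat) (m : R -> R -> 'rV[R]_3) (minf : 'rV[R]_3)
  (s : 'I_N -> R -> 'rV[R[i]]_3) (x : 'I_N -> R -> R[i]).
Hypothesis hm : rational_solution m minf s x.
Variables (E F : 'I_N -> 'M[C]_2).
Hypothesis hEF : half_spins (fun j => spin_mx (s j 0)) E F.

Definition lax_flow (t : R) : 'M[C]_N :=
  diag_mx (\row_j x j 0) + t%:C *: lax0 x E F.

Local Notation orbit T n k t := (lax_orbit (@upper N) (spin_mx (cast_row minf)) (all_poles x)
  (fun l u => spin_mx (all_residues s l u)) T n k t).

Lemma lax_orbit_velocity T n k :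
  orbit T n (inl k) 0 * regular (all_poles x ^~ 0) (spin_mx (cast_row minf))
    (fun k => spin_mx (all_residues s k 0)) (inl k) = cderive (x k) 0 *: orbit T n (inl k) 0.
Proof.
have uk : upper (inl k : 'I_N + 'I_N) by [].
by rewrite (lax_orbit_vB (fun k t => (pde_sphere hm t k).1) (fun k t => (pde_evolution hm t k).2) T n 0 uk).
Qed.

(** One step of the recursion is right multiplication by [lax_flow T]: the product [A j * A k]
    carries the scalar [diag_dot (F j) (E k)], which with [ipole] is the off-diagonal entry of
    [lax0], and [lax_orbit_velocity] gives the diagonal one. *)
Lemma lax_orbit_half_spins T n k :
  orbit T n (inl k) 0 = col k (spin_row E *m (lax_flow T ^+ n)) *m row k (spin_col F).
Proof.
elim: n k => [|n IH] k.
  by rewrite expr0 mulmx1 /= (half_spinsE k hEF).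
rewrite exprSr -[_ * lax_flow T]/(_ *m lax_flow T) mulmxA.
move: (spin_row E *m _) IH => V IH.
rewrite /= /lax_mul lax_orbit_velocity subr0.
under eq_bigr => j _ do rewrite /=.
rewrite big_sumType /= [X in _ *: (_ + (_ + X))]big1 ?addr0 => [|j _]; last first.
  by rewrite /posC /= mulr0n mul0r scale0r.
have term j : (posC (@upper N) (inl j : 'I_N + 'I_N) * ipole (all_poles x ^~ 0) (inl k) (inl j)) *:
    (orbit T n (inl j) 0 * spin_mx (s k 0)) =
    ((x k 0 - x j 0)^-1 * diag_dot (F j) (E k)) *: (col j V *m row k (spin_col F)).
  rewrite /posC /= mulr1n mul1r IH (half_spinsE k hEF).
  rewrite -[_ * (_ *m _)]/(_ *m (_ *m _)) -mulmxA (mulmxA (row j _)).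
  have -> : row j (spin_col F) *m col k (spin_row E) = (diag_dot (F j) (E k))%:M.
    apply/matrixP => a b; rewrite !ord1 -spin_col_row !mxE eqxx mulr1n.
    by apply: eq_bigr => i _; rewrite !mxE.
  by rewrite mul_scalar_mx -scalemxAr scalerA.
under eq_bigr => j _ do rewrite term.
rewrite IH; apply/matrixP => a b.
have entry (W : 'M[C]_(2, N)) j : (col j W *m row k (spin_col F)) a b = W a j * F k b b.
  by rewrite mxE big_ord1 !mxE.
have split_entry (p c c' : C) (W S : 'M[C]_2) :
    (p *: W + c *: (c' *: W + S)) a b = p * W a b + c * (c' * W a b + S a b).
  by rewrite !mxE.
rewrite split_entry summxE !entry.
have -> : (V *m lax_flow T) a k = x k 0 * V a k + T%:C * (V *m lax0 x E F) a k.
  rewrite /lax_flow mulmxDr -scalemxAr mxE [X in _ + X]mxE; congr (_ + _).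
  by rewrite mul_mx_diag !mxE mulrC.
have -> : (V *m lax0 x E F) a k = cderive (x k) 0 * V a k +
    \sum_j (x k 0 - x j 0)^-1 * diag_dot (F j) (E k) * V a j.
  rewrite mxE (bigD1 k)//= [in RHS](bigD1 k)//= subrr invr0 !mul0r add0r.
  rewrite mxE eqxx mulrC; congr (_ + _); apply: eq_bigr => j jk.
  by rewrite mxE (negPf jk); ring.
rewrite (_ : \sum_(j < N) _ = (\sum_j (x k 0 - x j 0)^-1 * diag_dot (F j) (E k) * V a j) * F k b b).
  by ring.
by rewrite mulr_suml; apply: eq_bigr => j _; rewrite mxE entry !mulrA.
Qed.

Lemma moments_half_spins T n : \sum_j x j T ^+ n *: spin_mx (s j T) =
  spin_row E *m (lax_flow T ^+ n) *m spin_col F.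
Proof.
rewrite (residue_moments hm); under eq_bigr do rewrite lax_orbit_half_spins.
apply/matrixP => a b; rewrite summxE [RHS]mxE; apply: eq_bigr => j _.
by rewrite mxE big_ord1 [X in X * _]mxE [X in _ * X]mxE.
Qed.

End MomentFlow.

(** * Asymptotics of poles and residues *)

Section Asymptotics.
Context {R : realType}.
Local Notation C := R[i].
Local Notation iC := (0 +i* 1 : R[i]).

(** A left inverse of [spin_mx] that does not increase entrywise errors, so that convergence for M
    yields convergence for m. *)
Definition unspin (A : 'M[C]_2) : 'rV[C]_3 :=
  \row_i nth 0 [:: (A 0 1 + A 1 0) / 2; iC * (A 0 1 - A 1 0) / 2; A 0 0] i.

Lemma spin_mxK : cancel (@spin_mx R) unspin.
Proof.
move=> u; rewrite spin_mxE; apply/rowP => i; rewrite !mxE /=.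
have e : iC * (u 0 0 - iC * u 0 1 - (u 0 0 + iC * u 0 1)) / 2 = - (iC * iC) * u 0 1 by field.
case: i => [[|[|[|]]]]//= ?; first 1 last.
- by rewrite e iC2 opprK mul1r; congr (u 0 _); exact: val_inj.
- by congr (u 0 _); exact: val_inj.
- by rewrite (_ : _ / 2 = u 0 0); [congr (u 0 _); exact: val_inj|field].
Qed.

Lemma spin_mx_neq0 u : u != 0 -> spin_mx u != 0 :> 'M[C]_2.
Proof.
apply: contra => /eqP h; rewrite -(spin_mxK u) h; apply/eqP/rowP => i; rewrite !mxE.
by rewrite addr0 subr0 mulr0 mul0r; case: i => [[|[|[|]]]].
Qed.

Lemma unspin_sub_le (A B : 'M[C]_2) (e : R) : (forall a b, normc (A a b - B a b) <= e) ->
  forall i, normc (unspin A 0 i - unspin B 0 i) <= e.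
Proof.
move=> h i; rewrite !mxE.
have h2 : normc (2^-1 : C) = 2^-1.
  rewrite (_ : 2^-1 = (2^-1 : R)%:C) ?normc_real ?ger0_norm//.
  by rewrite fmorphV rmorph_nat.
have hi : normc iC = 1 by rewrite /= expr0n add0r expr1n sqrtr1.
have half (z w : C) : normc z <= e -> normc w <= e -> normc ((z + w) / 2) <= e.
  move=> hz hw; rewrite normcM h2 ler_pdivrMr//; apply: le_trans (normcD _ _) _.
  by rewrite mulrDr mulr1 lerD.
case: i => [[|[|[|]]]]//= ?.
- rewrite (_ : _ - _ = ((A 0 1 - B 0 1) + (A 1 0 - B 1 0)) / 2); last by field.
  exact: half.
- rewrite (_ : _ - _ = iC * (((A 0 1 - B 0 1) + - (A 1 0 - B 1 0)) / 2)); last by field.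
  by rewrite normcM hi mul1r; apply: half; rewrite ?normcN'.
Qed.

Lemma normc_mulmx3_le N (M : 'M[C]_(2, N)) (D : 'M[C]_N) (M' : 'M[C]_(N, 2)) (d : R) a b :
  (forall p q, normc (D p q) <= d) ->
  normc ((M *m D *m M') a b) <=
    (\sum_a \sum_p normc (M a p)) * (\sum_q \sum_b normc (M' q b)) * d.
Proof.
move=> hD; have nn (z : C) := normc_ge0 z.
apply: le_trans (_ : (\sum_p normc (M a p)) * (\sum_q normc (M' q b)) * d <= _).
  rewrite mxE mulr_sumr mulr_suml; apply: normc_sum_le => q.
  rewrite normcM mulrAC; apply: ler_wpM2r => //.
  rewrite mxE mulr_suml; apply: normc_sum_le => p.
  by rewrite normcM ler_wpM2l.
(* A negative [d] is possible only for N = 0, where both sides vanish. *)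
case: (leP 0 d) => [d0|d0].
  rewrite ler_wpM2r// ler_pM ?sumr_ge0//.
    by rewrite (bigD1 a)//= lerDl; do 2!apply: sumr_ge0 => ? _.
  apply: ler_sum => q _; rewrite (bigD1 b)//= lerDl; by apply: sumr_ge0.
have N0 (p : 'I_N) : False by have := le_lt_trans (le_trans (nn _) (hD p p)) d0; rewrite ltxx.
by rewrite !big1 ?mul0r// => *; rewrite ?big1// => *; exfalso; exact: N0.
Qed.

Variables (N : nat) (m : R -> R -> 'rV[R]_3) (minf : 'rV[R]_3)
  (s : 'I_N -> R -> 'rV[R[i]]_3) (x : 'I_N -> R -> R[i]).
Hypothesis hm : rational_solution m minf s x.
Variables (E F : 'I_N -> 'M[C]_2).
Hypothesis hEF : half_spins (fun j => spin_mx (s j 0)) E F.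
Variables (v : 'I_N -> C) (P : 'M[C]_N).
Hypotheses (v_inj : injective v) (uP : P \in unitmx)
  (eL : lax0 x E F = P *m diag_mx (\row_j v j) *m invmx P).
Local Notation J := (diag_mx (\row_j v j)).

Definition conj_poles : 'M[C]_N := invmx P *m diag_mx (\row_j x j 0) *m P.

Lemma lax_flow_conj t : lax_flow x E F t = P *m (conj_poles + t%:C *: J) *m invmx P.
Proof.
rewrite /lax_flow eL mulmxDr mulmxDl; congr (_ + _).
  by rewrite /conj_poles !mulmxA mulmxV// mul1mx -mulmxA mulmxV// mulmx1.
by rewrite -scalemxAr -scalemxAl.
Qed.

Lemma moments_conj t n : \sum_j x j t ^+ n *: spin_mx (s j t) =
  (spin_row E *m P) *m (conj_poles + t%:C *: J) ^+ n *m (invmx P *m spin_col F).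
Proof.
rewrite (moments_half_spins hm hEF) lax_flow_conj.
move: (_ + _ *: J) => Z.
have -> : (P *m Z *m invmx P) ^+ n = P *m Z ^+ n *m invmx P.
  elim: n => [|n IH]; first by rewrite !expr0 -[1]/(1%:M) mulmx1 mulmxV.
  rewrite exprSr IH exprSr -[_ * (_ *m _)]/(_ *m (_ *m _)) -[Z ^+ n * Z]/(Z ^+ n *m Z).
  move: (Z ^+ n) => W; rewrite !mulmxA; congr (_ *m _); congr (_ *m _).
  by rewrite -mulmxA mulVmx// mulmx1.
by rewrite !mulmxA.
Qed.

(** The labelling [l] may change with [t]. The threshold concerns |t| only, so the same limits serve
    both time directions. *)
Lemma pole_residue_asymptotics (e : R) : 0 < e ->
  exists2 T : R, 0 < T & forall t : R, T <= `|t| -> exists2 l : 'I_N -> 'I_N, injective l &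
    forall k, normc (x k t - (v (l k) * t%:C + conj_poles (l k) (l k))) <= e /\
      forall a b, normc (spin_mx (s k t) a b - spectral_residue E F P (l k) a b) <= e.
Proof.
move=> e0; pose B := (\sum_a \sum_p normc ((spin_row E *m P) a p)) *
  (\sum_q \sum_b normc ((invmx P *m spin_col F) q b)).
have B0 : 0 <= B by rewrite mulr_ge0//; do 2!apply: sumr_ge0 => ? _; exact: normc_ge0.
have B1 : 0 < 1 + B by rewrite ltr_wpDr.
pose d := Num.min 1 (e / (1 + B)).
have d0 : 0 < d by rewrite lt_min ltr01 divr_gt0.
have d1 : d <= 1 by rewrite ge_min lexx.
have dB : d * (1 + B) <= e by rewrite -ler_pdivlMr// ge_min lexx orbT.
have [T T0 loc] := eigensystem_localization v_inj conj_poles d0 d1.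
exists T => // t tT.
have x_inj : injective (x^~ t) by exact: (rational_distinct hm).
have ev k : eigenvalue (conj_poles + t%:C *: J) (x k t).
  apply: (moments_eigenvalue x_inj (moments_conj t)).
  exact/spin_mx_neq0/(rational_residue hm).
have [l [u [w [l_inj uw Zw h]]]] := loc t _ tT x_inj ev.
exists l => // k; have [h1 h2] := h k; split.
  rewrite opprD addrA; apply: le_trans h1 _; apply: le_trans dB.
  by rewrite mulrDr mulr1 lerDl mulr_ge0// ltW.
move=> a b; rewrite (moments_residue x_inj (moments_conj t) uw Zw k) /spectral_residue.
have -> (Q Q' : 'M[C]_2) : Q a b - Q' a b = (Q - Q') a b by rewrite !mxE.
rewrite (_ : _ - _ = (spin_row E *m P) *m (w k *m u k - delta_mx (l k) (l k)) *m
    (invmx P *m spin_col F)); last first.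
  by rewrite mulmxBr mulmxBl !mulmxA.
apply: le_trans (normc_mulmx3_le (d := d) _ _ _ _ _) _.
  by move=> p q; have := h2 p q; rewrite [in X in _ -> X]mxE [(- delta_mx _ _) _ _]mxE.
apply: le_trans dB; rewrite -/B mulrC ler_wpM2l ?lerDr//.
exact: ltW.
Qed.

End Asymptotics.

(* Partial fractions of [1 / ((x l - x j) (x l - y k))]; here [y] stands for the
   conjugate poles, [h'] for the conjugate of [h]. *)
Lemma cauchy_intertwining (K : fieldType) (I : finType) (x y dx dy : I -> K)
    (g h h' M : I -> I -> K) :
  injective x -> injective y -> (forall j k, x j != y k) ->
  (forall j, h j j = 0) -> (forall j, h' j j = 0) ->
  (forall j k, dx j * g j k = M j k + \sum_l (x j - x l)^-1 * (h j l * g l k)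
     + \sum_l (x j - y l)^-1 * (g j l * h' k l)) ->
  (forall j k, dy k * g j k = M j k + \sum_l (y k - y l)^-1 * (h' k l * g j l)
     + \sum_l (y k - x l)^-1 * (g l k * h j l)) ->
  forall j k,
  dx j * (g j k / (x j - y k)) + \sum_l (h j l / (x l - x j)) * (g l k / (x l - y k)) =
  dy k * (g j k / (x j - y k)) + \sum_l (g j l / (x j - y l)) * (h' k l / (y l - y k)).
Proof.
move=> x_inj y_inj xy hh hh' H1 H2 j k; have n0 a b : x a - y b != 0 by rewrite subr_eq0.
apply: (mulfI (n0 j k)); apply/eqP; rewrite -subr_eq0; apply/eqP.
have S1 : (x j - y k) * (\sum_l (h j l / (x l - x j)) * (g l k / (x l - y k))) =
   - (\sum_l (x j - x l)^-1 * (h j l * g l k)) + \sum_l (y k - x l)^-1 * (g l k * h j l).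
  rewrite mulr_sumr -sumrN -big_split; apply: eq_bigr => l _ /=.
  have [->|lj] := eqVneq l j; first by rewrite hh !(mul0r, mulr0) oppr0 addr0.
  have n1 : x l - x j != 0 by rewrite subr_eq0 (inj_eq x_inj).
  have n2 := n0 l k.
  rewrite -(opprB (x l) (x j)) -(opprB (x l) (y k)) !invrN.
  by field; rewrite n1 n2.
have S2 : (x j - y k) * (\sum_l (g j l / (x j - y l)) * (h' k l / (y l - y k))) =
   - (\sum_l (y k - y l)^-1 * (h' k l * g j l)) + \sum_l (x j - y l)^-1 * (g j l * h' k l).
  rewrite mulr_sumr -sumrN -big_split; apply: eq_bigr => l _ /=.
  have [->|lk] := eqVneq l k; first by rewrite hh' !(mul0r, mulr0) oppr0 addr0.
  have n1 : y l - y k != 0 by rewrite subr_eq0 (inj_eq y_inj).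
  have n2 := n0 j l.
  rewrite -(opprB (y l) (y k)) !invrN.
  by field; rewrite n1 n2.
rewrite !mulrDr S1 S2.
have cancel_d z : (x j - y k) * (z * (g j k / (x j - y k))) = z * g j k.
  by have := n0 j k => n; field.
by rewrite !cancel_d H1 H2; ring.
Qed.

(** * The asymptotic poles lie in the upper half plane *)

Section PoleShift.
Context {R : realType}.
Local Notation C := R[i].

Definition cadj p q (A : 'M[C]_(p, q)) : 'M[C]_(q, p) := map_mx conjc A^T.

Lemma cadjE p q (A : 'M[C]_(p, q)) i j : cadj A i j = conjc (A j i).
Proof. by rewrite !mxE. Qed.

Lemma cadjM p q r (A : 'M[C]_(p, q)) (B : 'M[C]_(q, r)) :
  cadj (A *m B) = cadj B *m cadj A.
Proof. by rewrite /cadj trmx_mul map_mxM. Qed.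

Lemma cadjK p q (A : 'M[C]_(p, q)) : cadj (cadj A) = A.
Proof. by apply/matrixP => i j; rewrite !mxE conjcK. Qed.

Variables (N : nat) (m : R -> R -> 'rV[R]_3) (minf : 'rV[R]_3)
  (s : 'I_N -> R -> 'rV[R[i]]_3) (x : 'I_N -> R -> R[i]).
Hypothesis hm : rational_solution m minf s x.
Variables (E F : 'I_N -> 'M[C]_2).
Hypothesis hEF : half_spins (fun j => spin_mx (s j 0)) E F.
Local Notation Xi := (spin_col F).
Local Notation M0 := (spin_mx (cast_row minf)).
Local Notation dx j := (cderive (x j) 0).
Local Notation g j k := ((row j Xi *m cadj (row k Xi)) 0 0).
Local Notation M j k := ((row j Xi *m M0 *m cadj (row k Xi)) 0 0).
Local Notation h j l := (diag_dot (F j) (E l)).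

Lemma half_spin_col_neq0 j : exists a, E j a a != 0.
Proof.
apply: contrapT => ne; have := spin_mx_neq0 (rational_residue hm j 0) => /negP; apply.
rewrite (half_spinsE j hEF); apply/eqP/matrixP => a b; rewrite !mxE big_ord1 !mxE.
by have [->|ea] := eqVneq (E j a a) 0; [rewrite mul0r|exfalso; apply: ne; exists a].
Qed.

(** A_j^2 is this scalar times A_j; it vanishes while A_j does not. *)
Lemma half_spin_nilpotent j : h j j = 0.
Proof.
have := (pde_sphere hm 0 (inl j)).2; rewrite /= (half_spinsE j hEF) => e.
have := spin_mx_neq0 (rational_residue hm j 0); rewrite (half_spinsE j hEF) => n0.
have e2 : h j j *: (col j (spin_row E) *m row j Xi) = 0.
  rewrite -[RHS]e -[RHS]/(_ *m (_ *m _)); rewrite -mulmxA (mulmxA (row j _)).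
  have -> : row j Xi *m col j (spin_row E) = (h j j)%:M.
    apply/matrixP => a b; rewrite !ord1 -spin_col_row !mxE eqxx mulr1n.
    by apply: eq_bigr => i _; rewrite !mxE.
  by rewrite mul_scalar_mx -scalemxAr.
by move/eqP: e2; rewrite scaler_eq0 (negPf n0) orbF => /eqP.
Qed.

(** The relation x_j' A_j = A_j B_j with the nonzero column factor of A_j cancelled. *)
Lemma half_spin_velocity j :
  row j Xi *m regular (all_poles x ^~ 0) M0 (fun k => spin_mx (all_residues s k 0)) (inl j)
  = dx j *: row j Xi.
Proof.
have := lax_orbit_velocity hm 0 0 j; rewrite /= (half_spinsE j hEF).
move: (regular _ _ _ _) => B e.
have [a ea] := half_spin_col_neq0 j.
apply/rowP => b; apply: (mulfI ea).
have := congr1 (fun A : 'M[C]_2 => A a b) e; rewrite -[_ * B]/(_ *m B) -mulmxA !mxE !big_ord1 !mxE.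
by move=> ->; rewrite mulrCA.
Qed.

(** [half_spin_velocity] paired with the conjugate of row [k], with B_j expanded over its poles. The
    lower residues are adjoints of the upper ones, which is where the conjugated products come
    from. *)
Lemma half_spin_gram j k : dx j * g j k = M j k
  + \sum_l (x j 0 - x l 0)^-1 * (h j l * g l k)
  + \sum_l (x j 0 - conjc (x l 0))^-1 * (g j l * conjc (h k l)).
Proof.
have e := congr1 (fun u => (u *m cadj (row k Xi)) 0 0) (half_spin_velocity j).
have prod4 (r r' : 'rV[C]_2) (c c' : 'cV[C]_2) :
    (r *m (c *m r') *m c') 0 0 = (r *m c) 0 0 * (r' *m c') 0 0.
  by rewrite !mulmxA -mulmxA [LHS]mxE big_ord1.
rewrite /= -scalemxAl [RHS]mxE in e; rewrite -{}e /regular big_sumType /=.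
rewrite mulmxDr mulmxDr !mulmxDl mxE [X in _ + X]mxE addrA; congr (_ + _ + _).
  rewrite mulmx_sumr mulmx_suml summxE; apply: eq_bigr => l _.
  rewrite -scalemxAr -scalemxAl mxE (half_spinsE l hEF) prod4; congr (_ * (_ * _)).
  by rewrite -spin_col_row !mxE; apply: eq_bigr => i _; rewrite !mxE.
rewrite mulmx_sumr mulmx_suml summxE; apply: eq_bigr => l _.
rewrite -scalemxAr -scalemxAl mxE spin_mx_conj -/(cadj _) (half_spinsE l hEF) cadjM.
rewrite prod4 -cadjM; congr (_ * (_ * _)).
rewrite /cadj !mxE -spin_col_row !mxE; congr conjc.
by apply: eq_bigr => i _; rewrite !mxE.
Qed.

Lemma half_spin_gram_conj j k : conjc (dx k) * g j k = M j k
  + \sum_l (conjc (x k 0) - conjc (x l 0))^-1 * (conjc (h k l) * g j l)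
  + \sum_l (conjc (x k 0) - x l 0)^-1 * (g l k * h j l).
Proof.
have gJ a b : conjc (g a b) = g b a.
  have := congr1 (fun A : 'M[C]_1 => A 0 0) (cadjM (row a Xi) (cadj (row b Xi))).
  by rewrite cadjK cadjE.
have MJ a b : conjc (M a b) = M b a.
  have := congr1 (fun A : 'M[C]_1 => A 0 0) (cadjM (row a Xi *m M0) (cadj (row b Xi))).
  rewrite cadjE cadjK cadjM => ->; rewrite mulmxA; congr ((_ *m _ *m _) 0 0).
  rewrite /cadj -spin_mx_conj; congr spin_mx; apply/rowP => i; rewrite !mxE.
  exact: conjc_real.
have := congr1 conjc (half_spin_gram k j).
rewrite rmorphM !rmorphD /= gJ MJ !rmorph_sum => ->; congr (_ + _ + _).
  apply: eq_bigr => l _; rewrite !rmorphM /= gJ; congr (_ * _).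
  by rewrite fmorphV rmorphB.
apply: eq_bigr => l _; rewrite !rmorphM /= gJ conjcK; congr (_ * _).
by rewrite fmorphV rmorphB /= conjcK.
Qed.

Let x_inj : injective (x ^~ 0). Proof. exact: (rational_distinct hm). Qed.

Lemma pole_conj_neq j k : x j 0 != conjc (x k 0).
Proof.
apply/eqP => e; have := @all_poles_inj _ _ _ _ _ _ hm 0 (inl j) (inr k) e; by [].
Qed.

Definition cauchy_gram : 'M[C]_N := \matrix_(j, k) (g j k / (x j 0 - conjc (x k 0))).

Lemma lax_cauchy_gram : lax0 x E F *m cauchy_gram = cauchy_gram *m cadj (lax0 x E F).
Proof.
apply/matrixP => j k.
have conj_inj : injective (fun j => conjc (x j 0)).
  by move=> a b /(can_inj (@conjcK R)); exact: x_inj.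
have := @cauchy_intertwining C 'I_N (x ^~ 0) (fun j => conjc (x j 0)) (fun j => dx j)
  (fun j => conjc (dx j)) (fun j k => g j k) (fun j k => h j k)
  (fun j k => conjc (h j k)) (fun j k => M j k) x_inj conj_inj pole_conj_neq
  half_spin_nilpotent _ half_spin_gram half_spin_gram_conj j k.
have hh j' : conjc (h j' j') = 0 by rewrite half_spin_nilpotent conjc0.
move=> /(_ hh) e.
have -> : (lax0 x E F *m cauchy_gram) j k = dx j * (g j k / (x j 0 - conjc (x k 0))) +
    \sum_l (h j l / (x l 0 - x j 0)) * (g l k / (x l 0 - conjc (x k 0))).
  rewrite mxE (bigD1 j)//= [in RHS](bigD1 j)//= subrr invr0 mulr0 mul0r add0r.
  rewrite mxE eqxx [X in _ * X]mxE; congr (_ + _); apply: eq_bigr => l lj.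
  by rewrite mxE eq_sym (negPf lj) [X in _ * X]mxE.
rewrite {}e [RHS]mxE (bigD1 k)//= [in RHS](bigD1 k)//= subrr invr0 mulr0 mulr0 add0r.
have ge l : cauchy_gram j l = g j l / (x j 0 - conjc (x l 0)) by rewrite [LHS]mxE.
have he l : l != k -> cadj (lax0 x E F) l k = conjc (h k l) / (conjc (x l 0) - conjc (x k 0)).
  move=> lk; rewrite cadjE [in LHS]mxE eq_sym (negPf lk).
  by rewrite rmorphM fmorphV rmorphB.
have hkk : cadj (lax0 x E F) k k = conjc (dx k) by rewrite cadjE [in LHS]mxE eqxx.
rewrite ge hkk mulrC; congr (_ + _); apply: eq_bigr => l lk.
by rewrite ge he.
Qed.

Lemma pole_cauchy_gram : diag_mx (\row_j x j 0) *m cauchy_gram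
  - cauchy_gram *m cadj (diag_mx (\row_j x j 0)) = Xi *m cadj Xi.
Proof.
apply/matrixP => j k.
have -> : cadj (diag_mx (\row_j x j 0)) = diag_mx (\row_j conjc (x j 0)).
  by rewrite /cadj tr_diag_mx map_diag_mx; congr diag_mx; apply/rowP => i; rewrite !mxE.
rewrite mxE mul_diag_mx [X in _ + X]mxE mul_mx_diag !mxE.
have n0 : x j 0 - conjc (x k 0) != 0 by rewrite subr_eq0 pole_conj_neq.
rewrite (_ : \sum_(i < 2) Xi j i * cadj Xi i k =
  \sum_(i < 2) row j Xi 0 i * cadj (row k Xi) i 0); last first.
  by apply: eq_bigr => i _; rewrite !mxE.
by field.
Qed.

(** Conjugated by [P], this expresses the off-diagonal entries of [conj_poles] through the half
    spins. *)
Lemma pole_lax_comm : diag_mx (\row_j x j 0) *m lax0 x E F - lax0 x E F *m diag_mx (\row_j x j 0)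
  = - (Xi *m spin_row E).
Proof.
apply/matrixP => j k; rewrite mxE mul_diag_mx [X in _ + X]mxE mul_mx_diag.
rewrite [RHS]mxE spin_col_row !mxE; case: eqVneq => [->|jk].
  by rewrite half_spin_nilpotent mulrC subrr oppr0.
have n0 : x k 0 - x j 0 != 0 by rewrite subr_eq0 (inj_eq x_inj) eq_sym.
by field.
Qed.

End PoleShift.

(** * Reality of the speeds and positivity of the shifts *)

Section UpperHalfPlane.
Context {R : realType}.
Local Notation C := R[i].
Variables (N : nat) (m : R -> R -> 'rV[R]_3) (minf : 'rV[R]_3)
  (s : 'I_N -> R -> 'rV[R[i]]_3) (x : 'I_N -> R -> R[i]).
Hypothesis hm : rational_solution m minf s x.
Variables (E F : 'I_N -> 'M[C]_2).
Hypothesis hEF : half_spins (fun j => spin_mx (s j 0)) E F.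
Variables (v : 'I_N -> C) (P : 'M[C]_N).
Hypotheses (v_inj : injective v) (uP : P \in unitmx)
  (eL : lax0 x E F = P *m diag_mx (\row_j v j) *m invmx P).
Local Notation J := (diag_mx (\row_j v j)).
Local Notation X := (diag_mx (\row_j x j 0)).
Local Notation a j := (conj_poles x P j j).

(** An injective labelling of a finite set is bijective, so every asymptote [j] is followed by some
    pole, and that pole has positive imaginary part. *)
Lemma asymptotic_pole_ge j (e : R) : 0 < e ->
  exists2 T : R, 0 < T & forall t : R, T <= `|t| -> - e <= Im (v j) * t + Im (a j).
Proof.
move=> e0; have [T T0 h] := pole_residue_asymptotics hm hEF v_inj uP eL e0.
exists T => // t /h[l l_inj hl]; pose k := invF l_inj j.
have lk : l k = j by exact: f_invF.
have [h1 _] := hl k; rewrite lk in h1.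
have := le_trans (Im_le_normc _) h1; rewrite ler_norml => /andP[_].
rewrite cImD cImN cImD cImM cImC cReC mulr0 add0r => h2.
have := rational_pole hm k t; lra.
Qed.

(** A nonreal speed would carry a pole below the real line in one of the two time directions. *)
Lemma speed_real j : Im (v j) = 0.
Proof.
apply/eqP; apply: contraT => v0; have [T T0 h] := asymptotic_pole_ge j (ltr01 : 0 < 1 :> R).
have v1 : 0 < `|Im (v j)| by rewrite normr_gt0.
(* At least [T], and large enough for [|Im (v j)| * S] to exceed [1 + |Im (a j)|]. *)
pose S := T + (2 + `|Im (a j)|) / `|Im (v j)|.
have S0 : T <= S by rewrite lerDl divr_ge0// addr_ge0.
have Spos : 0 <= S by rewrite (le_trans _ S0)// ltW.
have := h (- Num.sg (Im (v j)) * S); rewrite normrM normrN normr_sg v0 mul1r ger0_norm// => /(_ S0).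
have -> : Im (v j) * (- Num.sg (Im (v j)) * S) = - (`|Im (v j)| * S).
  by rewrite normrEsg; ring.
have e1 : `|Im (v j)| * S = `|Im (v j)| * T + (2 + `|Im (a j)|).
  by rewrite /S mulrDr; congr (_ + _); field; rewrite gt_eqF.
have := ler_norm (Im (a j)); have : 0 < `|Im (v j)| * T by rewrite mulr_gt0.
by rewrite e1; lra.
Qed.

Lemma asymptotic_shift_ge0 j : 0 <= Im (a j).
Proof.
apply/ler_addgt0Pr => e e0; have [T T0 h] := asymptotic_pole_ge j e0.
by have := h T (ler_norm T); rewrite speed_real mul0r add0r; lra.
Qed.

Lemma asymptotic_shift_gt0 j : 0 < Im (a j).
Proof.
rewrite lt_neqAle asymptotic_shift_ge0 andbT eq_sym; apply/negP => /eqP a0.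
pose Q := invmx P; pose Y := conj_poles x P.
have QP : Q *m P = 1%:M by exact: mulVmx.
have PQ : P *m Q = 1%:M by exact: mulmxV.
have eL' : lax0 x E F = P *m J *m Q by [].
have QLP : Q *m lax0 x E F = J *m Q.
  by rewrite eL !mulmxA QP mul1mx.
have QX : Q *m X = Y *m Q by rewrite /Y /conj_poles -(mulmxA (_ *m X) P Q) PQ mulmx1.
have {}a0 : Im (Y j j) = 0 by [].
clearbody Y Q.
pose G := Q *m cauchy_gram x F *m cadj Q.
have cadjJ : cadj J = J.
  rewrite /cadj tr_diag_mx map_diag_mx; congr diag_mx; apply/rowP => i; rewrite !mxE.
  by apply: eq_ReIm; rewrite ?cReJ ?cImJ ?speed_real ?oppr0.
(* Real speeds make [J] self-adjoint, so the intertwining of [lax0] with its adjoint becomes a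
   commutation, and distinct speeds make [G] diagonal. *)
have JG : J *m G = G *m J.
  rewrite /G mulmxA mulmxA -QLP -[Q *m lax0 _ _ _ *m _]mulmxA (lax_cauchy_gram hm hEF).
  rewrite -!mulmxA; congr (_ *m (_ *m _)).
  by rewrite -cadjM QLP cadjM cadjJ.
have Gd i k : i != k -> G i k = 0.
  by move/is_diag_mxP: (comm_diag_is_diag v_inj JG) => Gd /Gd.
have dist (A B B' D : 'M[C]_N) : A *m (B *m D) - A *m (B' *m D) = A *m ((B - B') *m D).
  by rewrite mulmxBl mulmxBr.
have YG : Y *m G - G *m cadj Y = (Q *m spin_col F) *m cadj (Q *m spin_col F).
  have -> : Y *m G = Q *m (X *m cauchy_gram x F *m cadj Q) by rewrite /G !mulmxA QX.
  have -> : G *m cadj Y = Q *m (cauchy_gram x F *m cadj X *m cadj Q).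
    by rewrite /G -!mulmxA -!cadjM QX.
  by rewrite dist (pole_cauchy_gram hm F) (cadjM Q (spin_col F)) !mulmxA.
clearbody G.
have hY : conjc (Y j j) = Y j j by apply: eq_ReIm; rewrite ?cReJ ?cImJ // a0 oppr0.
have e1 : (Y *m G) j j = Y j j * G j j.
  by rewrite mxE (bigD1 j)//= big1 ?addr0 // => k kj; rewrite Gd ?mulr0.
have e2 : (G *m cadj Y) j j = G j j * Y j j.
  rewrite mxE (bigD1 j)//= big1 ?addr0 => [|k kj]; first by rewrite cadjE hY.
  by rewrite Gd ?mul0r// eq_sym.
(* For diagonal [G] this entry is 2 i Im (a_j) G_jj; by [YG] it is also the squared norm of row [j]
   of [Q *m spin_col F], which therefore vanishes. *)
have Sj : (Y *m G - G *m cadj Y) j j = 0.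
  by move: e1 e2; move: (Y *m G) (G *m _) => A B eA eB; rewrite !mxE eA eB mulrC subrr.
have QXi b : (Q *m spin_col F) j b = 0.
  move: Sj; rewrite YG mxE; move: (Q *m spin_col F) => Z.
  have -> : \sum_k Z j k * cadj Z k j = (\sum_k csqnorm (Z j k))%:C.
    rewrite rmorph_sum; apply: eq_bigr => k _; rewrite cadjE.
    by apply: eq_ReIm; rewrite /csqnorm /= ?cReM ?cImM ?cReJ ?cImJ /=; ring.
  move/(congr1 (fun z : C => Re z)) => /= /eqP.
  rewrite psumr_eq0 => [|k _]; last by rewrite /csqnorm addr_ge0 ?sqr_ge0.
  move=> /allP /(_ b (mem_index_enum _)) /=.
  rewrite /csqnorm paddr_eq0 ?sqr_ge0// !sqrf_eq0 => /andP[/eqP r0 /eqP i0].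
  exact: eq_ReIm.
(* By [QXi] row [j] of the commutator of [Y] and [J] vanishes, and its entries are those of [Y]
   times differences of distinct speeds. *)
have Yj k : k != j -> Y j k = 0.
  move=> kj; have e : Y *m J - J *m Y = - ((Q *m spin_col F) *m (spin_row E *m P)).
    have -> : Y *m J = Q *m (X *m lax0 x E F *m P).
      by rewrite eL' !mulmxA QX -(mulmxA Y Q P) QP mulmx1 -(mulmxA (Y *m J) Q P) QP mulmx1.
    have -> : J *m Y = Q *m (lax0 x E F *m X *m P).
      by rewrite !mulmxA QLP -(mulmxA J Q X) QX -!mulmxA QP mulmx1.
    by rewrite dist (pole_lax_comm hm hEF) mulNmx mulmxN !mulmxA.
  have := congr1 (fun M : 'M[C]_N => M j k) e.
  rewrite mxE mul_mx_diag [in X in _ + X]mxE mul_diag_mx [X in X + _ = _ -> _]mxE [X in _ - X = _ -> _]mxE.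
  rewrite ![(\row__ _) _ _]mxE [in RHS]mxE [X in _ = - X -> _]mxE.
  rewrite [X in _ = - X -> _]big1 => [|b _]; last by rewrite QXi mul0r.
  rewrite oppr0 mulrC -mulrBl => /eqP; rewrite mulf_eq0 subr_eq0 (inj_eq v_inj) (negPf kj).
  by move/eqP.
have [k Qk] : exists k, Q j k != 0.
  apply/existsP; apply: contraT; rewrite negb_exists => /forallP h.
  have := congr1 (fun M : 'M[C]_N => M j j) QP; rewrite !mxE eqxx big1 => [/esym/eqP|k _].
    by rewrite oner_eq0.
  by have := h k; rewrite negbK => /eqP ->; rewrite mul0r.
(* Row [j] of [Q] is now an eigenrow of the diagonal [X], so the real [Y j j] equals [x k 0]. *)
have := congr1 (fun M : 'M[C]_N => M j k) QX; rewrite mul_mx_diag ![in X in X -> _]mxE.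
rewrite (bigD1 j)//= big1 ?addr0 => [|i ij]; last by rewrite Yj ?mul0r.
rewrite mulrC => /(mulIf Qk) e.
have := rational_pole hm k 0; by move: a0; rewrite -e => ->; rewrite ltxx.
Qed.

End UpperHalfPlane.

(** * Convergence in the Sobolev seminorm *)

Section HhalfConvergence.
Context {R : realType}.
Local Notation C := R[i].

Lemma Hhalf_norm_cvg0 p q (f : R -> R -> 'M[C]_(p, q)) :
  (forall e : R, 0 < e -> exists2 T : R, 0 < T & forall t, T <= `|t| ->
     forall i j, (Hhalf_sqnorm (fun y => f t y i j) <= e%:E)%E) ->
  Hhalf_norm (f t) @[t --> +oo] --> 0%E /\ Hhalf_norm (f t) @[t --> -oo] --> 0%E.
Proof.
move=> h; have small (e : R) : 0 < e -> exists2 T : R, 0 < T &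
    forall t, T <= `|t| -> (0 <= Hhalf_norm (f t) <= e%:E)%E.
  (* The successor keeps the denominator positive for empty matrices as well. *)
  move=> e0; pose d := e ^+ 2 / (p * q).+1%:R.
  have d0 : 0 < d by rewrite divr_gt0 ?exprn_gt0.
  have [T T0 hT] := h _ d0; exists T => // t tT; rewrite poweR_ge0 /=.
  have -> : e%:E = ((e ^+ 2)%:E `^ 2^-1)%E.
    by rewrite poweR_EFin powR12_sqrt ?sqr_ge0// sqrtr_sqr gtr0_norm.
  have S0 : (0 <= \sum_(i < p) \sum_(j < q) Hhalf_sqnorm (fun y => f t y i j))%E.
    by do 2!(apply: sume_ge0 => ? _); exact: Hhalf_sqnorm_ge0.
  have inT (z : \bar R) : (0 <= z)%E -> z \in `[0%E, +oo%E].
    by move=> z0; rewrite in_itv /= z0 leey.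
  apply: (gt0_ler_poweR _ (inT _ S0)); rewrite ?invr_ge0//.
    by apply: inT; rewrite lee_fin sqr_ge0.
  apply: (@le_trans _ _ (\sum_(i < p) \sum_(j < q) d%:E)%E).
    by apply: lee_sum => i _; apply: lee_sum => j _; exact: hT.
  under eq_bigr do rewrite sumEFin; rewrite sumEFin lee_fin.
  rewrite !sumr_const !card_ord -mulrnA -mulr_natr /d mulrAC ler_pdivrMr//.
  by rewrite ler_wpM2l ?sqr_ge0// ler_nat mulnC leqnSn.
have conv (G : set_system R) : Filter G -> (forall T : R, \forall t \near G, T <= `|t|) ->
    Hhalf_norm (f t) @[t --> G] --> 0%E.
  move=> FG hG; apply/fine_cvgP; split.
    have [T _ hT] := small _ (ltr01 : 0 < 1 :> R).
    near=> t; have /hT /andP[h1 h2] : T <= `|t| by near: t; exact: hG.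
    by rewrite ge0_fin_numE// (le_lt_trans h2) ?ltry.
  apply/cvgr0Pnorm_le => e e0; have [T _ hT] := small _ e0.
  near=> t; have /hT /andP[h1 h2] : T <= `|t| by near: t; exact: hG.
  have fn : Hhalf_norm (f t) \is a fin_num by rewrite ge0_fin_numE// (le_lt_trans h2) ?ltry.
  by rewrite /= ger0_norm ?fine_ge0// -lee_fin fineK.
split; apply: conv => T.
  near=> t; apply: le_trans (ler_norm _); near: t; exact: nbhs_pinfty_ge (num_real _).
near=> t; rewrite -normrN; apply: le_trans (ler_norm _); rewrite lerNr.
near: t; exact: nbhs_ninfty_le (num_real _).
Unshelve. all: by end_near.
Qed.

(** Reindexing the limit sum by the bijection [l] pairs each pole with its own asymptote, whatever
    the labelling at time [t]. *)
Lemma pole_sum_Hhalf_cvg0 N p q (c : 'I_N -> R -> 'M[C]_(p, q)) (x : 'I_N -> R -> C)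
    (r : 'I_N -> 'M[C]_(p, q)) (v a : 'I_N -> C) :
  (forall j, Im (v j) = 0) -> (forall j, 0 < Im (a j)) ->
  (forall e : R, 0 < e -> exists2 T : R, 0 < T &
    forall t : R, T <= `|t| -> exists2 l : 'I_N -> 'I_N, injective l &
    forall k, normc (x k t - (v (l k) * t%:C + a (l k))) <= e /\
      forall i j, normc (c k t i j - r (l k) i j) <= e) ->
  let f t y := pole_sum (c ^~ t) (x ^~ t) y - pole_sum r (fun j => v j * t%:C + a j) y in
  Hhalf_norm (f t) @[t --> +oo] --> 0%E /\ Hhalf_norm (f t) @[t --> -oo] --> 0%E.
Proof.
move=> v0 a0 h f; apply: Hhalf_norm_cvg0 => e e0.
(* Twice [b], so that poles within [d <= b] of their asymptotes still have height at least [b]. *)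
have [b b0 ab] : exists2 b : R, 0 < b & forall j, 2 * b <= Im (a j).
  pose S := \sum_j (Im (a j))^-1.
  have S0 : 0 <= S by apply: sumr_ge0 => j _; rewrite invr_ge0 ltW.
  exists (2 * (1 + S))^-1 => [|j]; first by rewrite invr_gt0 mulr_gt0// ltr_wpDr.
  rewrite invfM mulrA divff// mul1r -[leRHS]invrK lef_pV2 ?posrE ?invr_gt0//.
    apply: le_trans (_ : S <= _); last by rewrite lerDr.
    by rewrite /S (bigD1 j)//= lerDl; apply: sumr_ge0 => k _; rewrite invr_ge0 ltW.
  by rewrite ltr_wpDr.
pose M := \sum_k \sum_i \sum_j normc (r k i j).
have M0 : 0 <= M by do 3!(apply: sumr_ge0 => ? _); exact: normc_ge0.
have rM k i j : normc (r k i j) <= M.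
  rewrite /M (bigD1 k)//= (bigD1 i)//= (bigD1 j)//= -!addrA lerDl.
  by rewrite !addr_ge0//; do ?(apply: sumr_ge0 => ? _); exact: normc_ge0.
have [K K0 hK] := Hhalf_sqnorm_pole_diff 'I_N b0 M0.
pose d := Num.min b (Num.min 1 (e / (K + 1))).
have K1 : 0 < K + 1 by rewrite ltr_wpDl.
have d0 : 0 < d by rewrite !lt_min b0 ltr01 divr_gt0.
have db : d <= b by rewrite ge_min lexx.
have d1 : d <= 1 by rewrite !ge_min lexx orbT.
have de : d * (K + 1) <= e by rewrite -ler_pdivlMr// !ge_min lexx !orbT.
have [T T0 hT] := h _ d0; exists T => // t /hT[l l_inj hl] i j.
have -> : (fun y => f t y i j) = (fun y => \sum_k c k t i j * pole (x k t) y -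
    \sum_k r (l k) i j * pole (v (l k) * t%:C + a (l k)) y).
  apply/funext => y; rewrite /f /pole_sum mxE [X in _ + X]mxE !summxE; congr (_ - _).
    by apply: eq_bigr => k _; rewrite mxE mulrC.
  by rewrite [LHS](reindex_inj l_inj); apply: eq_bigr => k _; rewrite mxE mulrC.
have Imy k : Im (v (l k) * t%:C + a (l k)) = Im (a (l k)).
  by rewrite cImD cImM cImC v0 mul0r mulr0 !add0r.
apply: le_trans (hK _ _ _ _ d _) _.
  move=> k; have [h1 h2] := hl k; split => //; rewrite ?Imy.
  - have := le_trans (Im_le_normc _) h1; rewrite cImD cImN Imy ler_norml => /andP[h3 _].
    by have := ab (l k); lra.
  - by have := ab (l k); lra.
rewrite lee_fin; apply: le_trans de.
rewrite expr2 mulrCA ler_wpM2l ?(ltW d0)//.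
by apply: le_trans (_ : K * 1 <= _); [rewrite ler_wpM2l|rewrite mulr1 lerDl].
Qed.

End HhalfConvergence.

(** * Diagonalization and the block formula *)

Section Diagonalization.
Variables (F : fieldType) (N : nat).

(** Left eigenvectors are the rows of the inverse of [P]. A linear relation among them, multiplied
    by powers of [L], has vanishing moments and is trivial by [moments_eq0]. *)
Lemma eigenvalues_diagonalize (L : 'M[F]_N) (v : 'I_N -> F) : injective v ->
  (forall k, eigenvalue L (v k)) ->
  exists2 P, P \in unitmx & L = P *m diag_mx (\row_j v j) *m invmx P.
Proof.
move=> v_inj ev.
have [u hu] : exists u : 'I_N -> 'rV[F]_N, forall k, u k *m L = v k *: u k /\ u k != 0.
  have /choice[u hu] k : exists u : 'rV[F]_N, u *m L = v k *: u /\ u != 0.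
    by have /eigenvalueP[u h1 h2] := ev k; exists u.
  by exists u.
pose U := \matrix_k u k.
have UL : U *m L = diag_mx (\row_j v j) *m U.
  apply/row_matrixP => k; rewrite row_mul rowK (hu k).1.
  by apply/rowP => j; rewrite [RHS]mxE mul_diag_mx !mxE.
have uU : U \in unitmx.
  rewrite -row_free_unit; apply: inj_row_free => w wU.
  have wk : forall k, w 0 k *: u k = 0.
    apply: (moments_eq0 v_inj) => i.
    transitivity (w *m U *m L ^+ i); last by rewrite wU mul0mx.
    rewrite [w *m U]mulmx_sum_row mulmx_suml; apply: eq_bigr => k _.
    rewrite rowK -scalemxAl scalerA mulrC -scalerA; congr (_ *: _).
    elim: i => [|i IH]; first by rewrite !expr0 scale1r -[1]/(1%:M) mulmx1.
    by rewrite exprS [in RHS]exprS -[L * _]/(L *m _) mulmxA (hu k).1 -scalemxAl -IH scalerA.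
  apply/rowP => k; rewrite mxE; have /eqP := wk k.
  by rewrite scaler_eq0 (negPf (hu k).2) orbF => /eqP.
exists (invmx U); first by rewrite unitmx_inv.
by rewrite invmxK -mulmxA -UL mulmxA mulVmx// mul1mx.
Qed.

End Diagonalization.

Lemma block_col_delta {R : realType} N (K : 'I_N -> 'M[R[i]]_2) j :
  block_col (fun k => if k == j then K j else 0) = doubled (delta_mx j j) *m block_col K.
Proof.
rewrite doubled_block_col; apply: eq_mxcol => k.
rewrite (bigD1 j)//= big1 ?addr0 => [|l lj]; last by rewrite mxE (negPf lj) andbF scale0r.
by rewrite mxE eqxx andbT; case: eqVneq => _; rewrite ?scale1r ?scale0r.
Qed.

Lemma spectral_residue_block {R : realType} N (A E F : 'I_N -> 'M[R[i]]_2) (P : 'M[R[i]]_N) j :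
  half_spins A E F -> P \in unitmx ->
  spectral_residue E F P j = block_row E *m Hdiag N *m doubled P
    *m doubled (delta_mx j j) *m invmx (doubled P) *m block_col F.
Proof.
move=> h uP; rewrite (doubled_unit uP).2 -(mulmxA _ (doubled P)) doubledM.
rewrite -(mulmxA _ (doubled (P *m _))) doubledM block_spin_product// => k; by have [] := h k.
Qed.

Theorem theorem6 (R : realType) (N : nat)
  (m : R -> R -> 'rV[R]_3) (minf : 'rV[R]_3)
  (s : 'I_N -> R -> 'rV[R[i]]_3) (x : 'I_N -> R -> R[i])
  (hm : rational_solution m minf s x)
  (E0 F0 : 'I_N -> 'M[R[i]]_2)
  (h0 : half_spins (fun j => spin_mx (s j 0)) E0 F0)
  (v : 'I_N -> R[i])
  (hv : forall z, eigenvalue (lax0 x E0 F0) z = (z \in codom v))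
  (v_inj : injective v) :
  exists (rp rm : 'I_N -> 'rV[R[i]]_3) (Rp Rm : 'I_N -> 'M[R[i]]_2)
         (ap am : 'I_N -> R[i]),
  let Pim (t : R) := pole_sum (fun j => s j t) (fun j => x j t) in
  let PiM (t : R) := pole_sum (fun j => spin_mx (s j t)) (fun j => x j t) in
  let fp (t : R) := pole_sum rp (fun j => v j * t%:C + ap j) in
  let fm (t : R) := pole_sum rm (fun j => v j * t%:C + am j) in
  let Fp (t : R) := pole_sum Rp (fun j => v j * t%:C + ap j) in
  let Fm (t : R) := pole_sum Rm (fun j => v j * t%:C + am j) in
  [/\ [/\ Hhalf_norm (fun y => Pim t y - fp t y) @[t --> +oo] --> 0%E,
          Hhalf_norm (fun y => Pim t y - fm t y) @[t --> -oo] --> 0%E,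
          Hhalf_norm (fun y => PiM t y - Fp t y) @[t --> +oo] --> 0%E
        & Hhalf_norm (fun y => PiM t y - Fm t y) @[t --> -oo] --> 0%E],
      forall t y : R, fp t y = fm t y,
      forall t y : R, Fp t y = Fm t y
    & forall (E F : 'I_N -> 'M[R[i]]_2) (P : 'M[R[i]]_N)
             (K : 'I_N -> 'M[R[i]]_2),
        half_spins (fun j => spin_mx (s j 0)) E F ->
        P \in unitmx ->
        lax0 x E F = P *m diag_mx (\row_j v j) *m invmx P ->
        block_col K = invmx (doubled P) *m block_col F ->
        forall j,
        [/\ Rp j = Rm j,
            Rm j = block_row E *m Hdiag N *m doubled P
                     *m block_col (fun k => if k == j then K j else 0)
          & Rm j = block_row E *m Hdiag N *m doubled P
                     *m doubled (delta_mx j j) *m invmx (doubled P)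
                     *m block_col F]].
Proof.
have [P0 uP0 eL0] : exists2 P, P \in unitmx & lax0 x E0 F0 = P *m diag_mx (\row_j v j) *m invmx P.
  by apply: eigenvalues_diagonalize => // k; rewrite hv codom_f.
pose Rs := spectral_residue E0 F0 P0; pose a j := conj_poles x P0 j j.
have v0 := speed_real hm h0 v_inj uP0 eL0.
have a0 := asymptotic_shift_gt0 hm h0 v_inj uP0 eL0.
have asym := pole_residue_asymptotics hm h0 v_inj uP0 eL0.
have [Mp Mm] := pole_sum_Hhalf_cvg0 v0 a0 asym.
(* The vector version shares the poles of the matrix version; only the residues pass through
   [unspin]. *)
have [mp mm] : let f t y := pole_sum (s ^~ t) (x ^~ t) y -
      pole_sum (fun j => unspin (Rs j)) (fun j => v j * t%:C + a j) y in
    Hhalf_norm (f t) @[t --> +oo] --> 0%E /\ Hhalf_norm (f t) @[t --> -oo] --> 0%E.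
  apply: pole_sum_Hhalf_cvg0 => // e /asym[T T0 hT]; exists T => // t /hT[l l_inj hl].
  exists l => // k; have [h1 h2] := hl k; split=> // i j.
  by rewrite ord1 -{1}(spin_mxK (s k t)); exact: unspin_sub_le.
exists (fun j => unspin (Rs j)), (fun j => unspin (Rs j)), Rs, Rs, a, a.
split => [|//|//|E F P K hEF uP eL eK j]; first by split.
(* The witnesses were built from [E0], [F0], [P0]; gauge invariance carries them to the given half
   spins and diagonalization. *)
have -> : Rs j = spectral_residue E F P j.
  apply: (spectral_residue_gauge _ v_inj _ hEF h0 uP uP0 eL eL0) => k.
  exact/spin_mx_neq0/(rational_residue hm).
by split => //; rewrite (spectral_residue_block _ hEF uP)// block_col_delta eK !mulmxA.
Qed.
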